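(* Let $p,q\in(0,\infty]$ and let $\mathcal{Q}=(Q_i)_{i\in I}$ be an $L^p$-decomposition covering of the open set $\emptyset\neq\mathcal{O}\subset\mathbb{R}^d$. Assume that $\{0\}\neq Y\leq\mathbb{C}^I$ is a $\mathcal{Q}$-regular sequence space on $I$. Finally, assume that $$\iota_\alpha:\mathcal{S}_{\mathcal{O}}^{p,Y}(\mathbb{R}^d)\to L^q(\mathbb{R}^d),\quad f\mapsto\partial^\alpha f$$ is bounded for some $\alpha\in\mathbb{N}_0^d$ (where $\mathcal{S}_{\mathcal{O}}^{p,Y}(\mathbb{R}^d)$ carries the quasi-norm of $\mathcal{D}(\mathcal{Q},L^p,Y)$). Then $p\leq q$.
   Context: Notation. $\|A\|=\max_{|x|=1}|Ax|$ for matrices. $\mathcal{F}f(\xi)=\widehat f(\xi)=\int f(x)e^{-2\pi i\langle x,\xi\rangle}\,dx$. Coverings. All coverings of the open set $\mathcal{O}$ are of the form $\mathcal{Q}=(Q_i)_{i\in I}=(T_iQ_i'+b_i)_{i\in I}$ with $Q_i'\subset\mathbb{R}^d$, $T_i\in\mathrm{GL}(\mathbb{R}^d)$, $b_i\in\mathbb{R}^d$ and $\bigcup_{i\in I}Q_i=\mathcal{O}$. Put $i^*:=\{j\in I: Q_i\cap Q_j\neq\emptyset\}$. $\mathcal{Q}$ is admissible if all $Q_i\neq\emptyset$ and $\sup_{i}|i^*|<\infty$. $\mathcal{Q}$ is semi-structured if it is admissible, $\bigcup_iQ_i'$ is bounded, and $\sup_{i\in I}\sup_{j\in i^*}\|T_i^{-1}T_j\|<\infty$.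 A partition of unity subordinate to $\mathcal{Q}$ is a family $(\varphi_i)_{i\in I}$ in $C_c^\infty(\mathcal{O})$ with $\varphi_i\equiv0$ off $Q_i$ and $\sum_i\varphi_i\equiv1$ on $\mathcal{O}$. It is an $L^p$-BAPU if $\sup_i\|\mathcal{F}^{-1}\varphi_i\|_{L^1}<\infty$ (for $p\in[1,\infty]$), respectively $\sup_i|\det T_i|^{\frac1p-1}\|\mathcal{F}^{-1}\varphi_i\|_{L^p}<\infty$ (for $p\in(0,1)$). $\mathcal{Q}$ is an $L^p$-decomposition covering if it is semi-structured and admits an $L^p$-BAPU. Sequence spaces. A $\mathcal{Q}$-regular sequence space is a complete quasi-normed space $Y\leq\mathbb{C}^I$ that is solid ($|x_i|\le|y_i|$ for all $i$ and $y\in Y$ imply $x\in Y$, $\|x\|_Y\le\|y\|_Y$) and such that $Y\to Y$, $x\mapsto(\sum_{\ell\in i^*}x_\ell)_{i\in I}$ is well-defined and bounded. Decomposition spaces. $Z(\mathcal{O}):=\mathcal{F}(C_c^\infty(\mathcal{O}))$, with the topology making $\mathcal{F}:C_c^\infty(\mathcal{O})=\mathcal{D}(\mathcal{O})\to Z(\mathcal{O})$ a homeomorphism; $Z'(\mathcal{O})$ is its topological dual and $\widehat f=\mathcal{F}f:=f\circ\mathcal{F}\in\mathcal{D}'(\mathcal{O})$ for $f\in Z'(\mathcal{O})$. $\mathcal{D}(\mathcal{Q},L^p,Y)$ is the space of $f\in Z'(\mathcal{O})$ with $\|f\|_{\mathcal{D}(\mathcal{Q},L^p,Y)}:=\|(\|\mathcal{F}^{-1}(\varphi_i\widehat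 f)\|_{L^p})_{i\in I}\|_Y<\infty$, where $(\varphi_i)$ is an $L^p$-BAPU for $\mathcal{Q}$ (different choices give equivalent quasi-norms; $\mathcal{F}^{-1}(\varphi_i\widehat f)$ is identified with a smooth function; the norm is $\infty$ if an entry is infinite or the sequence is not in $Y$). $\mathcal{S}_{\mathcal{O}}(\mathbb{R}^d):=\{f\in\mathcal{S}(\mathbb{R}^d):\widehat f\in C_c^\infty(\mathcal{O})\}$ (regarded inside $Z'(\mathcal{O})$ via integration) and $\mathcal{S}_{\mathcal{O}}^{p,Y}(\mathbb{R}^d):=\mathcal{S}_{\mathcal{O}}(\mathbb{R}^d)\cap\mathcal{D}(\mathcal{Q},L^p,Y)$. *)

(* Defs.v *)
From HB Require Import structures.
From mathcomp Require Import all_boot all_order all_algebra.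
From mathcomp Require Import complex.
From mathcomp Require Import all_classical all_reals all_analysis.

Set Implicit Arguments.
Unset Strict Implicit.
Unset Printing Implicit Defensive.
Import Order.TTheory GRing.Theory Num.Theory.
Import numFieldNormedType.Exports.
Local Open Scope classical_set_scope.
Local Open Scope ring_scope.

(* Points of [R^d] are row vectors ['rV[R]_d].  They carry the product of [d]
copies of the Borel sigma-algebra of [R] (as [n.-tuple R] does in the library),
and Lebesgue measure is the iterated product of [lebesgue_measure] (see [leb_box]). *)

Section rV_measurable.
Context {R : realType} (n : nat).

Definition rV_coord (i : 'I_n) (x : 'rV[R]_n) : R := x ord0 i.

Definition rV_measurable : set (set 'rV[R]_n) := g_sigma_preimage rV_coord.

Let rV_set0 : rV_measurable set0.
Proof. exact: sigma_algebra0. Qed.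

Let rV_setC A : rV_measurable A -> rV_measurable (~` A).
Proof. exact: sigma_algebraC. Qed.

Let rV_bigcup (F : _^nat) : (forall i, rV_measurable (F i)) ->
  rV_measurable (\bigcup_i (F i)).
Proof. exact: sigma_algebra_bigcup. Qed.

Definition rV_display : measure_display.
Proof. exact: default_measure_display. Qed.

HB.instance Definition _ := @isMeasurable.Build rV_display
  'rV[R]_n rV_measurable rV_set0 rV_setC rV_bigcup.

End rV_measurable.

Lemma measurable_rV_coord (R : realType) n (i : 'I_n) :
  measurable_fun [set: 'rV[R]_n] (rV_coord i).
Proof.
move=> _ Y mY; rewrite setTI; apply: sub_sigma_algebra => /=.
rewrite -bigcup_seq/=; exists i => /=; first by rewrite mem_index_enum.
by exists Y => //; rewrite setTI.
Qed.

Lemma measurable_fun_rVP d (T : measurableType d) (R : realType) n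
    (f : T -> 'rV[R]_n) :
  (forall i, measurable_fun [set: T] (fun x => rV_coord i (f x))) ->
  measurable_fun [set: T] f.
Proof.
move=> mf.
suff : g_sigma_preimage (fun i => rV_coord i \o f) `<=` measurable.
  rewrite g_sigma_preimage_comp => prefS _ A mA.
  by apply: prefS; exists A.
apply: smallest_sub; first exact: sigma_algebra_measurable.
rewrite -bigcup_seq => A [i /= _ [B mB <-]].
exact: mf.
Qed.

Section leb_step.
Context {R : realType} (n : nat).

Definition rV_cons (x : R * 'rV[R]_n) : 'rV[R]_n.+1 := row_mx x.1%:M x.2.

Lemma rV_cons0 x : rV_cons x ord0 ord0 = x.1.
Proof.
rewrite /rV_cons (_ : ord0 = lshift n (ord0 : 'I_1)); last exact/val_inj.
by rewrite (row_mxEl x.1%:M x.2) mxE eqxx mulr1n.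
Qed.

Lemma rV_consS x i : rV_cons x ord0 (lift ord0 i) = x.2 ord0 i.
Proof.
rewrite /rV_cons (_ : lift _ i = rshift 1 i); last exact/val_inj.
by rewrite (row_mxEr x.1%:M x.2).
Qed.

Definition rV_uncons (x : 'rV[R]_n.+1) : R * 'rV[R]_n :=
  (x ord0 ord0, \row_i x ord0 (lift ord0 i)).

Lemma rV_consK : cancel rV_cons rV_uncons.
Proof.
move=> [a x]; rewrite /rV_uncons rV_cons0; congr pair.
by apply/rowP => i; rewrite mxE rV_consS.
Qed.

Lemma rV_unconsK : cancel rV_uncons rV_cons.
Proof.
move=> x; apply/rowP => i; case: (unliftP ord0 i) => [j ->|->].
- by rewrite rV_consS mxE.
- by rewrite rV_cons0.
Qed.

Lemma measurable_rV_cons : measurable_fun [set: R * 'rV[R]_n] rV_cons.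
Proof.
apply: measurable_fun_rVP => i; case: (unliftP ord0 i) => [j ->|->].
- under eq_fun do rewrite /rV_coord rV_consS.
  apply: (@measurableT_comp _ _ _ _ _ _ (rV_coord j)); last exact: measurable_snd.
  exact: measurable_rV_coord.
- by under eq_fun do rewrite /rV_coord rV_cons0; exact: measurable_fst.
Qed.

Lemma measurable_rV_uncons : measurable_fun [set: 'rV[R]_n.+1] rV_uncons.
Proof.
apply/measurable_fun_pairP; split; first exact: (measurable_rV_coord ord0).
apply: measurable_fun_rVP => i.
under eq_fun do rewrite /rV_coord mxE.
exact: (measurable_rV_coord (lift ord0 i)).
Qed.

Variable mu : {sigma_finite_measure set 'rV[R]_n -> \bar R}.

Definition leb_step : set 'rV[R]_n.+1 -> \bar R :=
  pushforward (lebesgue_measure \x mu)%E rV_cons.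

HB.instance Definition _ := Measure.copy leb_step
  (measure_function_pushforward__canonical__measure_function_Measure
    (lebesgue_measure \x mu)%E measurable_rV_cons).

Lemma leb_stepX (A : set R) (B : set 'rV[R]_n) :
  measurable A -> measurable B ->
  leb_step (rV_uncons @^-1` (A `*` B)) = (lebesgue_measure A * mu B)%E.
Proof.
move=> mA mB; rewrite -product_measure1E// /leb_step /pushforward.
by rewrite -comp_preimage (_ : _ \o _ = id)//; apply/funext => x; exact: rV_consK.
Qed.

Let leb_step_sigma_finite : sigma_finite setT leb_step.
Proof.
have /sigma_finiteP[F [TF ndF Foo]] := sigma_finiteT (@lebesgue_measure R).
have /sigma_finiteP[G [TG ndG Goo]] := sigma_finiteT mu.
exists (fun k => rV_uncons @^-1` (F k `*` G k)).
  rewrite -preimage_bigcup (_ : \bigcup_i _ = setT) ?preimage_setT//.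
  rewrite -subTset => -[a x] _.
  have [k _ Fk] : (\bigcup_i F i) a by rewrite -TF.
  have [l _ Gl] : (\bigcup_i G i) x by rewrite -TG.
  exists (maxn k l) => //; split => /=.
  - by move: a Fk; exact/subsetPset/ndF/leq_maxl.
  - by move: x Gl; exact/subsetPset/ndG/leq_maxr.
move=> k; have [mF Fk] := Foo k; have [mG Gk] := Goo k; split.
  rewrite -[X in measurable X]setTI; apply: measurable_rV_uncons => //.
  exact: measurableX.
by rewrite [ltLHS](leb_stepX mF mG) lte_mul_pinfty// ge0_fin_numE.
Qed.

HB.instance Definition _ := Measure_isSigmaFinite.Build _ _ _ leb_step
  leb_step_sigma_finite.

End leb_step.

Fixpoint leb {R : realType} (n : nat) :
    {sigma_finite_measure set 'rV[R]_n -> \bar R} :=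
  if n is m.+1 then leb_step (leb m) else \d_(0 : 'rV[R]_0).

Lemma measurable_rV_box (R : realType) n (A : 'I_n -> set R) :
  (forall i, measurable (A i)) ->
  measurable [set x : 'rV[R]_n | forall i, A i (x ord0 i)].
Proof.
move=> mA.
rewrite (_ : mkset _ = \bigcap_(i in [set: 'I_n]) rV_coord i @^-1` A i).
  apply: fin_bigcap_measurable => [|i _]; first exact: finite_finset.
  rewrite -[X in measurable X]setTI.
  exact: measurable_rV_coord.
by apply/seteqP; split=> x /= h i; [move=> _; exact: h | exact: (h i)].
Qed.

Lemma leb_box (R : realType) n (A : 'I_n -> set R) :
  (forall i, measurable (A i)) ->
  leb n [set x : 'rV[R]_n | forall i, A i (x ord0 i)] =
  (\prod_(i < n) lebesgue_measure (A i))%E.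
Proof.
elim: n A => [|n IH] A mA.
  by rewrite big_ord0 /= diracE mem_set// => -[].
rewrite big_ord_recl -IH//.
rewrite -leb_stepX; [|exact: mA|].
  2: exact: (measurable_rV_box (fun i => mA (lift ord0 i))).
congr (leb_step _ _); apply/seteqP; split=> x /=.
- by move=> h; split=> [|i]; rewrite ?mxE.
- move=> [h0 h] i; case: (unliftP ord0 i) => [j ->|-> //].
  by have := h j; rewrite mxE.
Qed.

Section decomposition_spaces.
Context {R : realType} {d : nat}.
Local Notation E := 'rV[R]_d.
Local Notation C := R[i].
Local Notation normc := ComplexField.Normc.normc.
Implicit Types (f g : E -> C) (O : set E).

Definition dot (x y : E) : R := \sum_i x ord0 i * y ord0 i.

(* Euclidean norm; the library norm on ['rV[R]_d] is the maximum norm *)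
Definition enorm (x : E) : R := Num.sqrt (dot x x).

Definition mxact (A : 'M[R]_d) (x : E) : E := x *m A^T.

Definition opnorm (A : 'M[R]_d) : R :=
  sup [set enorm (mxact A x) | x in [set x | enorm x = 1]].

Definition cintegral f : C :=
  Complex (\int[leb d]_x complex.Re (f x)) (\int[leb d]_x complex.Im (f x)).

Definition Lpnorm (p : \bar R) f : \bar R :=
  'N[leb d]_p[(fun x => (normc (f x))%:E)].

Definition evec (j : 'I_d) : E := delta_mx ord0 j.

Definition pderiv (j : 'I_d) f : E -> C := fun x =>
  Complex ('D_(evec j) (fun y => complex.Re (f y)) x)
          ('D_(evec j) (fun y => complex.Im (f y)) x).

(* [pderivs [:: j1; ..; jk] f] is the iterated partial derivative
   [d_{j1} .. d_{jk} f] *)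
Definition pderivs (s : seq 'I_d) f : E -> C := foldr pderiv f s.

Definition mderiv (alpha : 'I_d -> nat) f : E -> C :=
  pderivs (flatten [seq nseq (alpha j) j | j <- enum 'I_d]) f.

Definition morder (alpha : 'I_d -> nat) : nat := (\sum_j alpha j)%N.

Definition smooth f : Prop := forall s : seq 'I_d,
  [/\ continuous (fun x => complex.Re (pderivs s f x)),
      continuous (fun x => complex.Im (pderivs s f x)) &
      forall j x,
        derivable (fun y => complex.Re (pderivs s f y)) x (evec j) /\
        derivable (fun y => complex.Im (pderivs s f y)) x (evec j)].

Definition vanishes_off (K : set E) f : Prop := forall x, ~ K x -> f x = 0.

(* C_c^infty(O), each function being extended by 0 to R^d *)
Definition test O : set (E -> C) := [set f | smooth f /\
  exists K : set E, [/\ compact K, K `<=` O & vanishes_off K f]].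

Definition schwartz : set (E -> C) := [set f | smooth f /\
  forall (N : nat) (alpha : 'I_d -> nat), exists M : R, forall x,
    (1 + enorm x) ^+ N * normc (mderiv alpha f x) <= M].

Definition expi (t : R) : C := Complex (cos t) (sin t).

Definition wave (x xi : E) : C := expi (2 * pi * dot x xi).

Definition fourier f : E -> C := fun xi =>
  cintegral (fun x => f x * expi (- (2 * pi * dot x xi))).

Definition inv_fourier f : E -> C := fun x =>
  cintegral (fun xi => f xi * wave x xi).

(* D'(O): functionals are represented by total maps on [E -> C], of which only
   the values on [test O] matter.  Continuity for the usual topology of D(O) is
   stated through the seminorms on each compact subset of O. *)

Definition distribution O : set ((E -> C) -> C) := [set u |
  [/\ forall f g, test O f -> test O g -> u (fun x => f x + g x) = u f + u g,
      forall a f, test O f -> u (fun x => a * f x) = a * u f &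
      forall K : set E, compact K -> K `<=` O ->
        exists (N : nat) (c : R), forall f, smooth f -> vanishes_off K f ->
        forall M : R,
          (forall alpha x, (morder alpha <= N)%N ->
             normc (mderiv alpha f x) <= M) ->
          normc (u f) <= c * M]].

(* the Fourier transform of a functional on Z(O), as a functional on D(O) *)
Definition fourierZ (u : (E -> C) -> C) : (E -> C) -> C := fun f => u (fourier f).

(* Z(O) = F(D(O)) has the topology that makes F a homeomorphism, so that u is
   linear and continuous on Z(O) iff u \o F is a distribution on O *)
Definition Zdual O : set ((E -> C) -> C) := [set u | distribution O (fourierZ u)].

(* the inverse Fourier transform of [v] multiplied by a test function [phi]:
   a compactly supported distribution, hence transformed to the smooth function
   [x |-> <phi v, e^(2 pi i <x, .>)>] *)
Definition freq_piece (phi : E -> C) (v : (E -> C) -> C) : E -> C := fun x =>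
  v (fun xi => phi xi * wave x xi).

Definition of_fun f : (E -> C) -> C := fun g => cintegral (fun x => f x * g x).

Definition SO O : set (E -> C) := [set f | schwartz f /\ test O (fourier f)].

Section covering.
Context {I : choiceType}.

(* the data of a family [Q_i = T_i Q_i' + b_i] *)
Record affine_family := AffineFamily {
  base : I -> set E ;
  lin : I -> 'M[R]_d ;
  shift : I -> E ;
  lin_unit : forall i, lin i \in unitmx }.

Implicit Types (Q : affine_family) (phi : I -> E -> C).

Definition cell Q (i : I) : set E :=
  [set mxact (lin Q i) x + shift Q i | x in base Q i].

Definition covers Q O : Prop := \bigcup_(i in [set: I]) cell Q i = O.

(* the index cluster i^* *)
Definition cluster Q (i : I) : set I := [set j | cell Q i `&` cell Q j !=set0].

Definition admissible Q : Prop :=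
  (forall i, cell Q i !=set0) /\
  exists N : nat, forall i, (cluster Q i #<= `I_N)%card.

Definition semi_structured Q : Prop :=
  [/\ admissible Q,
      bounded_set (\bigcup_(i in [set: I]) base Q i) &
      exists c : R, forall i j, cluster Q i j ->
        opnorm (invmx (lin Q i) *m lin Q j) <= c].

Definition partition_of_unity O Q phi : Prop :=
  [/\ forall i, test O (phi i),
      forall i, vanishes_off (cell Q i) (phi i) &
      forall x, O x -> \sum_(i \in [set: I]) phi i x = 1].

Definition Lp_bapu O Q (p : \bar R) phi : Prop :=
  [/\ partition_of_unity O Q phi,
      (1 <= p)%E -> exists c : R, forall i,
        (Lpnorm 1 (inv_fourier (phi i)) <= c%:E)%E &
      (p < 1)%E -> exists c : R, forall i,
        ((`|\det (lin Q i)| `^ ((fine p)^-1 - 1))%:E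
          * Lpnorm p (inv_fourier (phi i)) <= c%:E)%E].

Definition Lp_decomposition_covering O Q (p : \bar R) : Prop :=
  [/\ covers Q O, semi_structured Q & exists phi, Lp_bapu O Q p phi].

Definition quasi_norm (Y : set (I -> C)) (nY : (I -> C) -> R) : Prop :=
  [/\ forall x, Y x -> 0 <= nY x,
      forall x, Y x -> nY x = 0 -> x = (fun=> 0),
      forall a x, Y x -> nY (fun i => a * x i) = normc a * nY x &
      exists k : R, forall x y, Y x -> Y y ->
        nY (fun i => x i + y i) <= k * (nY x + nY y)].

Definition subspace (Y : set (I -> C)) : Prop :=
  [/\ Y (fun=> 0),
      forall x y, Y x -> Y y -> Y (fun i => x i + y i) &
      forall a x, Y x -> Y (fun i => a * x i)].

Definition seq_complete (Y : set (I -> C)) (nY : (I -> C) -> R) : Prop :=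
  forall u : nat -> I -> C, (forall n, Y (u n)) ->
  (forall e : R, 0 < e -> exists N : nat, forall m n, (N <= m)%N -> (N <= n)%N ->
     nY (fun i => u m i - u n i) < e) ->
  exists2 x, Y x &
    forall e : R, 0 < e -> exists N : nat, forall n, (N <= n)%N ->
      nY (fun i => u n i - x i) < e.

Definition solid (Y : set (I -> C)) (nY : (I -> C) -> R) : Prop :=
  forall x y, Y y -> (forall i, normc (x i) <= normc (y i)) ->
  Y x /\ nY x <= nY y.

Definition clustering Q (x : I -> C) : I -> C := fun i =>
  \sum_(l \in cluster Q i) x l.

Definition regular_sequence_space Q (Y : set (I -> C)) (nY : (I -> C) -> R) : Prop :=
  [/\ subspace Y, quasi_norm Y nY, seq_complete Y nY, solid Y nY &
      exists c : R, forall x, Y x ->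
        Y (clustering Q x) /\ nY (clustering Q x) <= c * nY x].

Definition piece_norms (p : \bar R) phi (u : (E -> C) -> C) (i : I) : \bar R :=
  Lpnorm p (freq_piece (phi i) (fourierZ u)).

(* +oo if an entry is infinite or if the sequence of norms is not in Y *)
Definition decomp_norm (p : \bar R) phi (Y : set (I -> C)) (nY : (I -> C) -> R)
    (u : (E -> C) -> C) : \bar R :=
  let c i := Complex (fine (piece_norms p phi u i)) 0 in
  if `[< (forall i, piece_norms p phi u i \is a fin_num) /\ Y c >]
  then (nY c)%:E else +oo%E.

Definition decomposition_space O (p : \bar R) phi (Y : set (I -> C))
    (nY : (I -> C) -> R) : set ((E -> C) -> C) :=
  [set u | Zdual O u /\ (decomp_norm p phi Y nY u < +oo)%E].

Definition SOpY O (p : \bar R) phi (Y : set (I -> C)) (nY : (I -> C) -> R) :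
    set (E -> C) :=
  [set f | SO O f /\ decomposition_space O p phi Y nY (of_fun f)].

End covering.
End decomposition_spaces.

Arguments affine_family R d I : clear implicits.

(* Main.v *)
(* Suppose q < p, so that q is finite.  Some index i0 is such that phi_i0 does not
vanish at a point a with nonzero coordinates and the indicator of the cluster of i0
belongs to Y.  For small e let f_e be the function whose Fourier transform is a
product of bumps of width e around the coordinates of a: f_e is a modulation by a
of a profile dilated by 1/e.  Its Fourier transform is supported in Q_i0, so only the
finitely many pieces with i in the cluster of i0 are nonzero; each is the convolution
of f_e with the rapidly decreasing F^-1 phi_i, hence is bounded by a fixed profile
dilated by 1/e, and its L^p norm is O(e^(-d/p)) (this works for p < 1 too).  On the
other hand d^alpha f_e is about (2 pi i a)^alpha f_e, which is bounded below on a box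
of side of order 1/e, so its L^q norm is at least of order e^(-d/q).  Letting e tend
to 0 contradicts 1/q > 1/p.

The bump is the restriction of phi_i0 to a line through a, so that no explicit bump
function is needed.  That the Fourier transform of f_e has compact support is Fourier
inversion in dimension 1, proved by Abel summation. *)
Require Import Defs.
From HB Require Import structures.
From mathcomp Require Import all_boot all_order all_algebra.
From mathcomp Require Import complex.
From mathcomp Require Import all_classical all_reals all_analysis.
From mathcomp Require Import measurable_realfun ess_sup_inf.
From mathcomp Require Import ring lra.

Set Implicit Arguments.
Unset Strict Implicit.
Unset Printing Implicit Defensive.
Import Order.TTheory GRing.Theory Num.Theory.
Import numFieldNormedType.Exports.
Local Open Scope classical_set_scope.
Local Open Scope ring_scope.

Local Notation normc := ComplexField.Normc.normc.
Local Notation cRe := (@complex.Re _).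
Local Notation cIm := (@complex.Im _).

(** * Complex-valued integrals *)

(** Tensor products are used because integrals, partial derivatives and Fourier transforms all
    factor over the coordinates: the study of [f_e], Fourier inversion included, takes place on the
    line. Only the [phi i], which are not products, need estimates in several variables. Convolution
    with an integrable kernel obeys no Young inequality in L^p for p < 1. The pieces are therefore
    bounded pointwise. Products over the coordinates of 1 / (1 + e^2 t^2)^m survive convolution with
    a rapidly decreasing kernel, by Peetre's inequality, with constants uniform in e <= 1; and once
    m p >= 1 the L^p norm of such a product is controlled by an explicit integral. The coordinates
    of [a] must be nonzero because differentiation multiplies the Fourier transform by a factor
    close to (2 pi i a)^alpha on its support, and this factor has to stay away from 0. Membership of
    the indicator in [Y] comes from solidity and from the clustering map; the finiteness of the
    cluster of i0 provides one constant for all the pieces that do not vanish. *)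

Section complex_basics.
Context {R : realType}.
Implicit Types (z w : R[i]) (x y : R).

Lemma ReM z w : cRe (z * w) = cRe z * cRe w - cIm z * cIm w.
Proof. by case: z; case: w. Qed.

Lemma ImM z w : cIm (z * w) = cRe z * cIm w + cIm z * cRe w.
Proof. by case: z; case: w. Qed.

Lemma ReD z w : cRe (z + w) = cRe z + cRe w. Proof. by case: z; case: w. Qed.

Lemma ImD z w : cIm (z + w) = cIm z + cIm w. Proof. by case: z; case: w. Qed.

Lemma ReN z : cRe (- z) = - cRe z. Proof. by case: z. Qed.

Lemma ImN z : cIm (- z) = - cIm z. Proof. by case: z. Qed.

Lemma complex_ext z w : cRe z = cRe w -> cIm z = cIm w -> z = w.
Proof. by case: z; case: w => /= a b c e -> ->. Qed.

Lemma normcE z : normc z = Num.sqrt (cRe z ^+ 2 + cIm z ^+ 2).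
Proof. by case: z. Qed.

Lemma normc_ge0 z : 0 <= normc z.
Proof. by rewrite normcE sqrtr_ge0. Qed.

Lemma normcD z w : normc (z + w) <= normc z + normc w.
Proof.
have : `|z + w| <= `|z| + `|w| := ler_normD z w.
by rewrite lecE /= => /andP[].
Qed.

Lemma normcM z w : normc (z * w) = normc z * normc w.
Proof. exact: ComplexField.Normc.normcM. Qed.

Lemma normc0 : normc (0 : R[i]) = 0.
Proof. exact: ComplexField.Normc.normc0. Qed.

Lemma normc1 : normc (1 : R[i]) = 1.
Proof. exact: ComplexField.Normc.normc1. Qed.

Lemma normcN z : normc (- z) = normc z.
Proof. by rewrite !normcE ReN ImN !sqrrN. Qed.

Lemma normcX z n : normc (z ^+ n) = normc z ^+ n.
Proof. by elim: n => [|n IH]; rewrite ?expr0 ?normc1// !exprS normcM IH. Qed.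

Lemma normc_prod (J : Type) (s : seq J) (F : J -> R[i]) :
  normc (\prod_(j <- s) F j) = \prod_(j <- s) normc (F j).
Proof. by rewrite (big_morph _ (@normcM) (@normc1)). Qed.

Lemma normc_real x : normc (Complex x 0) = `|x|.
Proof. by rewrite normcE /= expr0n addr0 sqrtr_sqr. Qed.

Lemma normc_gt0 z : z != 0 -> 0 < normc z.
Proof.
move=> z0; rewrite lt_neqAle normc_ge0 andbT eq_sym.
by apply: contraNneq z0 => /ComplexField.Normc.eq0_normc ->.
Qed.

Lemma ler_Re z : `|cRe z| <= normc z.
Proof. by rewrite normcE -sqrtr_sqr ler_wsqrtr// lerDl sqr_ge0. Qed.

Lemma ler_Im z : `|cIm z| <= normc z.
Proof. by rewrite normcE -sqrtr_sqr ler_wsqrtr// lerDr sqr_ge0. Qed.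

Lemma normc_le_ReIm z : normc z <= `|cRe z| + `|cIm z|.
Proof.
rewrite normcE -[leRHS]ger0_norm ?addr_ge0// -sqrtr_sqr ler_wsqrtr//.
by rewrite sqrrD !real_normK ?num_real// addrAC lerDl mulrn_wge0// mulr_ge0.
Qed.

Lemma expiD x y : expi (x + y) = expi x * expi y.
Proof.
by apply: complex_ext; rewrite ?ReM ?ImM /= ?cosD// sinD addrC; congr (_ + _);
  rewrite mulrC.
Qed.

Lemma expi0 : expi (0 : R) = 1.
Proof. by rewrite /expi cos0 sin0. Qed.

Lemma normc_expi x : normc (expi x) = 1.
Proof. by rewrite normcE /= cos2Dsin2 sqrtr1. Qed.

End complex_basics.

Section complex_integral.
Context d {T : measurableType d} {R : realType}.
Implicit Types (f g : T -> R[i]) (mu : {measure set T -> \bar R}).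

Definition cmeasurable f := measurable_fun setT (fun x => cRe (f x)) /\
  measurable_fun setT (fun x => cIm (f x)).

Definition cint mu f : R[i] :=
  Complex (\int[mu]_x cRe (f x)) (\int[mu]_x cIm (f x)).

Definition cintegrable mu f :=
  cmeasurable f /\ mu.-integrable setT (fun x => (normc (f x))%:E).

Lemma cmeasurable_cst z : cmeasurable (fun=> z).
Proof. by split; exact: measurable_cst. Qed.

Lemma cmeasurableD f g : cmeasurable f -> cmeasurable g ->
  cmeasurable (fun x => f x + g x).
Proof.
move=> [f1 f2] [g1 g2]; split; under eq_fun do rewrite ?ReD ?ImD;
  exact: measurable_funD.
Qed.

Lemma cmeasurableM f g : cmeasurable f -> cmeasurable g ->
  cmeasurable (fun x => f x * g x).
Proof.
move=> [f1 f2] [g1 g2]; split; under eq_fun do rewrite ?ReM ?ImM.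
- by apply: measurable_funB; exact: measurable_funM.
- by apply: measurable_funD; exact: measurable_funM.
Qed.

Lemma cmeasurable_prod (J : Type) (s : seq J) (F : J -> T -> R[i]) :
  (forall j, cmeasurable (F j)) -> cmeasurable (fun x => \prod_(j <- s) F j x).
Proof.
move=> mF; elim: s => [|j s IH].
  by under eq_fun do rewrite big_nil; exact: cmeasurable_cst.
by under eq_fun do rewrite big_cons; exact: cmeasurableM.
Qed.

Lemma cmeasurable_expi (h : T -> R) : measurable_fun setT h ->
  cmeasurable (fun x => expi (h x)).
Proof.
move=> mh; split => /=.
- by apply: (measurableT_comp _ mh); apply: continuous_measurable_fun => x; exact: continuous_cos.
- by apply: (measurableT_comp _ mh); apply: continuous_measurable_fun => x; exact: continuous_sin.
Qed.

Lemma cmeasurable_real (h : T -> R) : measurable_fun setT h ->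
  cmeasurable (fun x => Complex (h x) 0).
Proof. by move=> mh; split => //=; exact: measurable_cst. Qed.

Lemma measurable_normc f : cmeasurable f -> measurable_fun setT (fun x => normc (f x)).
Proof.
move=> [f1 f2]; under eq_fun do rewrite normcE.
apply: (@measurableT_comp _ _ _ _ _ _ (@Num.sqrt R)).
  apply: continuous_measurable_fun; exact: sqrt_continuous.
by apply: measurable_funD; exact: measurable_funX.
Qed.

Lemma cintegrable_Re mu f : cintegrable mu f ->
  mu.-integrable setT (EFin \o (fun x => cRe (f x))).
Proof.
move=> [[f1 f2] fi]; apply: le_integrable fi => //; first exact/measurable_EFinP.
by move=> x _ /=; rewrite lee_fin (ger0_norm (normc_ge0 _)) ler_Re.
Qed.

Lemma cintegrable_Im mu f : cintegrable mu f ->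
  mu.-integrable setT (EFin \o (fun x => cIm (f x))).
Proof.
move=> [[f1 f2] fi]; apply: le_integrable fi => //; first exact/measurable_EFinP.
by move=> x _ /=; rewrite lee_fin (ger0_norm (normc_ge0 _)) ler_Im.
Qed.

Lemma le_cintegrable mu f (g : T -> R) : cmeasurable f ->
  mu.-integrable setT (EFin \o g) -> (forall x, normc (f x) <= g x) ->
  cintegrable mu f.
Proof.
move=> mf ig fg; split => //; apply: le_integrable ig => //.
  exact/measurable_EFinP/measurable_normc.
move=> x _ /=; rewrite lee_fin (ger0_norm (normc_ge0 _)).
by rewrite (le_trans (fg x))// ler_norm.
Qed.

Lemma cintegrableD mu f g : cintegrable mu f -> cintegrable mu g ->
  cintegrable mu (fun x => f x + g x).
Proof.
move=> [mf fi] [mg gi].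
apply: (@le_cintegrable _ _ (fun x => normc (f x) + normc (g x))).
- exact: cmeasurableD.
- by have := integrableD measurableT fi gi.
- by move=> x; exact: normcD.
Qed.

Lemma cintegrableMb mu f g (M : R) : cintegrable mu f -> cmeasurable g ->
  (forall x, normc (g x) <= M) -> cintegrable mu (fun x => f x * g x).
Proof.
move=> [mf fi] mg gM.
apply: (@le_cintegrable _ _ (fun x => M * normc (f x))).
- exact: cmeasurableM.
- by have := integrableZl measurableT M fi.
- by move=> x; rewrite normcM mulrC ler_wpM2r// normc_ge0.
Qed.

Lemma cintegrableZ mu z f : cintegrable mu f -> cintegrable mu (fun x => z * f x).
Proof.
move=> fi; under eq_fun do rewrite mulrC.
by apply: (cintegrableMb fi (cmeasurable_cst z)) => x; exact: lexx.
Qed.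

Lemma eq_cint mu f g : f =1 g -> cint mu f = cint mu g.
Proof. by move=> /funext ->. Qed.

Lemma cint0 mu : cint mu (fun=> 0) = 0.
Proof. by rewrite /cint /= /Rintegral integral0. Qed.

Lemma cintD mu f g : cintegrable mu f -> cintegrable mu g ->
  cint mu (fun x => f x + g x) = cint mu f + cint mu g.
Proof.
move=> fi gi; apply: complex_ext; rewrite ?ReD ?ImD /=.
- under eq_Rintegral do rewrite ReD.
  by rewrite RintegralD//; exact: cintegrable_Re.
- under eq_Rintegral do rewrite ImD.
  by rewrite RintegralD//; exact: cintegrable_Im.
Qed.

Lemma cintZ mu z f : cintegrable mu f ->
  cint mu (fun x => z * f x) = z * cint mu f.
Proof.
move=> fi; have rf := cintegrable_Re fi; have mf := cintegrable_Im fi.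
have rZ (k : R) (h : T -> R) : mu.-integrable setT (EFin \o h) ->
  mu.-integrable setT (EFin \o (fun x => k * h x)).
  by move=> hi; have := integrableZl measurableT k hi.
apply: complex_ext; rewrite ?ReM ?ImM /=.
- under eq_Rintegral do rewrite ReM.
  by rewrite RintegralB ?RintegralZl//; exact: rZ.
- under eq_Rintegral do rewrite ImM.
  by rewrite RintegralD ?RintegralZl//; exact: rZ.
Qed.

(* The factor 2 comes from bounding the real and imaginary parts separately. *)
Lemma normc_cint_le mu f (g : T -> R) : cmeasurable f ->
  mu.-integrable setT (EFin \o g) -> (forall x, normc (f x) <= g x) ->
  normc (cint mu f) <= 2 * \int[mu]_x g x.
Proof.
move=> mf ig fg; have fi := le_cintegrable mf ig fg.
rewrite (le_trans (normc_le_ReIm _))//= mulrDl mul1r lerD//.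
- rewrite (le_trans (le_normr_Rintegral measurableT (cintegrable_Re fi)))//.
  apply: le_Rintegral => //.
  + by apply/integrable_abse : (cintegrable_Re fi).
  + by move=> x _; rewrite (le_trans _ (fg x))// ler_Re.
- rewrite (le_trans (le_normr_Rintegral measurableT (cintegrable_Im fi)))//.
  apply: le_Rintegral => //.
  + by apply/integrable_abse : (cintegrable_Im fi).
  + by move=> x _; rewrite (le_trans _ (fg x))// ler_Im.
Qed.

End complex_integral.

Section complex_fubini.
Context d1 d2 (T1 : measurableType d1) (T2 : measurableType d2) (R : realType).
Variable m1 : {sigma_finite_measure set T1 -> \bar R}.
Variable m2 : {sigma_finite_measure set T2 -> \bar R}.
Implicit Types F : T1 * T2 -> R[i].

Lemma cmeasurable_pair2 F x : cmeasurable F -> cmeasurable (fun y => F (x, y)).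
Proof.
by move=> [F1 F2]; split;
  [exact: (measurable_fun_pair2 x F1)|exact: (measurable_fun_pair2 x F2)].
Qed.

Lemma cmeasurable_pair1 F y : cmeasurable F -> cmeasurable (fun x => F (x, y)).
Proof.
by move=> [F1 F2]; split;
  [exact: (measurable_fun_pair1 y F1)|exact: (measurable_fun_pair1 y F2)].
Qed.

(** Tonelli makes the integrals of the positive and of the negative part measurable separately, and
    the integral is by definition their difference. *)
Lemma measurable_Rintegral_pair (f : T1 * T2 -> R) : measurable_fun setT f ->
  measurable_fun setT (fun x => \int[m2]_y f (x, y)).
Proof.
move=> mf; apply: (measurableT_comp (fine_measurable measurableT)).
have mf' : measurable_fun setT (EFin \o f) by exact/measurable_EFinP.
rewrite (_ : (fun x => _) = (fun x => fubini_F m2 (EFin \o f)^\+ x -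
    fubini_F m2 (EFin \o f)^\- x)%E).
  apply: emeasurable_funB; apply: measurable_fun_fubini_tonelli_F => //.
  - exact: measurable_funepos.
  - exact: measurable_funeneg.
apply/funext => x; rewrite [LHS]integralE.
by congr (_ - _)%E; apply: eq_integral => y _; rewrite ?funeposE ?funenegE.
Qed.

Lemma cmeasurable_cint F : cmeasurable F ->
  cmeasurable (fun x => cint m2 (fun y => F (x, y))).
Proof.
move=> [F1 F2]; split => /=.
- exact: measurable_Rintegral_pair F1.
- exact: measurable_Rintegral_pair F2.
Qed.

Section dominated.
Variables (F : T1 * T2 -> R[i]) (a : T1 -> R) (b : T2 -> R).
Hypothesis mF : cmeasurable F.
Hypothesis ia : m1.-integrable setT (EFin \o a).
Hypothesis ib : m2.-integrable setT (EFin \o b).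
Hypothesis Fab : forall x y, normc (F (x, y)) <= a x * b y.

Lemma cintegrable_pair2 x : cintegrable m2 (fun y => F (x, y)).
Proof.
apply: (@le_cintegrable _ _ _ _ _ (fun y => a x * b y)) => //.
- exact: cmeasurable_pair2.
- by have := integrableZl measurableT (a x) ib.
Qed.

Lemma cintegrable_pair1 y : cintegrable m1 (fun x => F (x, y)).
Proof.
apply: (@le_cintegrable _ _ _ _ _ (fun x => b y * a x)) => //.
- exact: cmeasurable_pair1.
- by have := integrableZl measurableT (b y) ia.
- by move=> x; rewrite mulrC.
Qed.

Lemma integrable_prod_mul :
  (m1 \x m2)%E.-integrable setT (EFin \o (fun z => a z.1 * b z.2)).
Proof.
have ma : measurable_fun setT a by apply/measurable_EFinP; case/integrableP : ia.
have mb : measurable_fun setT b by apply/measurable_EFinP; case/integrableP : ib.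
have mab : measurable_fun setT (fun z : T1 * T2 => a z.1 * b z.2).
  by apply: measurable_funM; [apply: (measurableT_comp ma)|apply: (measurableT_comp mb)].
apply/integrable12ltyP; first exact/measurable_EFinP.
under eq_integral => x _.
  under eq_integral do rewrite /= normrM EFinM.
  rewrite ge0_integralZl//; last first.
    by apply/measurable_EFinP; exact: measurableT_comp.
  over.
rewrite /= ge0_integralZr//; last 2 first.
- by apply/measurable_EFinP; exact: measurableT_comp.
- by apply: integral_ge0 => y _; rewrite lee_fin.
apply: lte_mul_pinfty.
- by apply: integral_ge0 => y _; rewrite lee_fin.
- by rewrite ge0_fin_numE; [case/integrableP : ia|apply: integral_ge0 => y _; rewrite lee_fin].
- by case/integrableP : ib.
Qed.

Lemma cintegrable_prod : cintegrable (m1 \x m2)%E F.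
Proof.
apply: (le_cintegrable mF integrable_prod_mul) => -[x y]; exact: Fab.
Qed.

(** A product majorant makes every slice integrable, not merely almost every one, so the inner
    integrals are finite at each point and [fine] can be undone under the outer integral. *)
Lemma cint_prod :
  cint (m1 \x m2)%E F = cint m1 (fun x => cint m2 (fun y => F (x, y))).
Proof.
have key (f : T1 * T2 -> R) : (m1 \x m2)%E.-integrable setT (EFin \o f) ->
    (forall x, m2.-integrable setT (fun y => (f (x, y))%:E)) ->
    \int[(m1 \x m2)%E]_z f z = \int[m1]_x \int[m2]_y f (x, y).
  move=> fi fx; rewrite /Rintegral -integral12_prod_meas1//; congr fine.
  by apply: eq_integral => x _; rewrite fineK//; exact: integrable_fin_num.
apply: complex_ext => /=.
- exact: (key (cRe \o F) (cintegrable_Re cintegrable_prod)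
    (fun x => cintegrable_Re (cintegrable_pair2 x))).
- exact: (key (cIm \o F) (cintegrable_Im cintegrable_prod)
    (fun x => cintegrable_Im (cintegrable_pair2 x))).
Qed.

Lemma cint_Fubini : cint m1 (fun x => cint m2 (fun y => F (x, y))) =
  cint m2 (fun y => cint m1 (fun x => F (x, y))).
Proof.
have key (f : T1 * T2 -> R) : (m1 \x m2)%E.-integrable setT (EFin \o f) ->
    (forall x, m2.-integrable setT (fun y => (f (x, y))%:E)) ->
    (forall y, m1.-integrable setT (fun x => (f (x, y))%:E)) ->
    \int[m1]_x \int[m2]_y f (x, y) = \int[m2]_y \int[m1]_x f (x, y).
  move=> fi fx fy; rewrite /Rintegral.
  transitivity (fine (\int[m1]_x \int[m2]_y (f (x, y))%:E)%E).
    by congr fine; apply: eq_integral => x _; rewrite fineK//; exact: integrable_fin_num.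
  rewrite (Fubini fi); congr fine.
  by apply: eq_integral => y _; rewrite fineK//; exact: integrable_fin_num.
apply: complex_ext => /=.
- exact: (key (cRe \o F) (cintegrable_Re cintegrable_prod)
    (fun x => cintegrable_Re (cintegrable_pair2 x))
    (fun y => cintegrable_Re (cintegrable_pair1 y))).
- exact: (key (cIm \o F) (cintegrable_Im cintegrable_prod)
    (fun x => cintegrable_Im (cintegrable_pair2 x))
    (fun y => cintegrable_Im (cintegrable_pair1 y))).
Qed.

End dominated.
End complex_fubini.

(** * Lebesgue measure on row vectors *)

Section rV_topology.
Context {R : realType} {n : nat}.
Implicit Types x y : 'rV[R]_n.

Lemma rV_norm_lt x (e : R) : 0 < e -> (forall j, `|x ord0 j| < e) -> `|x| < e.
Proof.
move=> e0 xe; rewrite /Num.norm/= mx_normrE.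
by apply/bigmax_ltP; split => // -[i j] _ /=; rewrite ord1.
Qed.

Lemma coord_le_norm x j : `|x ord0 j| <= `|x|.
Proof.
rewrite {2}/Num.norm/= mx_normrE.
by rewrite (le_trans _ (le_bigmax _ _ (ord0, j))).
Qed.

Lemma cvg_rV (T : Type) (F : set_system T) (FF : Filter F) (f : T -> 'rV[R]_n) x :
  (forall j, f t ord0 j @[t --> F] --> x ord0 j) -> f t @[t --> F] --> x.
Proof.
move=> fx; apply/cvgrPdist_lt => e e0.
have : \forall t \near F, forall j : 'I_n, `|x ord0 j - f t ord0 j| < e.
  by apply: filter_forall => j; move/cvgrPdist_lt : (fx j) => /(_ e e0).
by apply: filterS => t ft; apply: rV_norm_lt => // j; rewrite !mxE.
Qed.

(* [f] is the pointwise limit of [f \o r k], where [r k] rounds down to the grid of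
mesh [1 / (k + 1)], and [f \o r k] is constant on countably many boxes. *)
Lemma continuous_measurable_rV (f : 'rV[R]_n -> R) : continuous f ->
  measurable_fun setT f.
Proof.
move=> cf; pose r (k : nat) x : 'rV[R]_n :=
  \row_j ((Num.floor (k.+1%:R * x ord0 j))%:~R / k.+1%:R).
apply: (@measurable_fun_cvg _ _ _ setT (fun k => f \o r k)); last first.
  move=> x _; apply: (cvg_comp (fun k => r k x) f _ (cf x)); apply: cvg_rV => j.
  apply/cvgrPdist_le => e e0; near=> k.
  have k0 : 0 < k.+1%:R :> R by [].
  have := floor_itv (k.+1%:R * x ord0 j); set m := Num.floor _ => /andP[m1 m2].
  rewrite mxE -/m -(ler_pM2l k0) -{1}(ger0_norm (ltW k0)) -normrM mulrBr.
  rewrite mulrCA divff ?gt_eqF// mulr1 ger0_norm ?subr_ge0//.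
  rewrite intrD in m2; have : k.+1%:R * e >= 1.
    rewrite -ler_pdivrMl// mulr1 ltW//; near: k; exact: (near_infty_natSinv_lt (PosNum e0)).
  move: m2; lra.
move=> k _ Y mY; rewrite setTI.
pose A (m : 'rV[int]_n) : set 'rV[R]_n :=
  [set x | Y (f (\row_j ((m ord0 j)%:~R / k.+1%:R))) /\
      forall j, Num.floor (k.+1%:R * x ord0 j) = m ord0 j].
have AE : \bigcup_m A m = (f \o r k) @^-1` Y.
  apply/seteqP; split => x /=.
  - move=> [m _ [Ym xm]]; congr (Y (f _)): Ym.
    by apply/rowP => j; rewrite !mxE xm.
  - move=> Yx; exists (\row_j Num.floor (k.+1%:R * x ord0 j)) => //; split.
      by congr (Y (f _)): Yx; apply/rowP => j; rewrite !mxE.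
    by move=> j; rewrite mxE.
rewrite -AE; apply: countable_bigcupT_measurable; first exact: countableP.
move=> m; have [Ym|Ym] := pselect (Y (f (\row_j ((m ord0 j)%:~R / k.+1%:R)))); last first.
  by rewrite (_ : A m = set0)//; apply/seteqP; split => // x [].
rewrite (_ : A m = [set x | forall j,
    (fun t => Num.floor (k.+1%:R * t) = m ord0 j) (x ord0 j)]); last first.
  by apply/seteqP; split => [x []|].
apply: (@measurable_rV_box R n (fun j t => Num.floor (k.+1%:R * t) = m ord0 j)) => j.
rewrite (_ : (fun t => _) =
    `[(m ord0 j)%:~R / k.+1%:R, (m ord0 j + 1)%:~R / k.+1%:R[%classic)//.
apply/seteqP; split => t /=; rewrite in_itv/= ler_pdivrMr// ltr_pdivlMr// [t * _]mulrC.
- by move=> <-; exact: floor_itv.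
- exact: floor_def.
Unshelve. all: by end_near. Qed.

End rV_topology.

(** * Integration of tensor products *)

Section tensor.
Context {R : realType}.

(** Over any commutative ring, since it serves both for complex functions and for the real majorants
    of their moduli. *)
Definition tensor {A : comPzRingType} n (g : 'I_n -> R -> A) (x : 'rV[R]_n) : A :=
  \prod_j g j (x ord0 j).

Lemma tensor_cons {A : comPzRingType} n (g : 'I_n.+1 -> R -> A) a x :
  tensor g (rV_cons (a, x)) = g ord0 a * tensor (fun j => g (lift ord0 j)) x.
Proof.
rewrite /tensor big_ord_recl rV_cons0; congr (_ * _).
by apply: eq_bigr => j _; rewrite rV_consS.
Qed.

Lemma tensor0 {A : comPzRingType} (g : 'I_0 -> R -> A) x : tensor g x = 1.
Proof. by rewrite /tensor big_ord0. Qed.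

Lemma measurable_tensor n (g : 'I_n -> R -> R) :
  (forall j, measurable_fun setT (g j)) -> measurable_fun setT (tensor g).
Proof.
move=> mg; apply: measurable_prod => j _ /=.
exact: (measurableT_comp (mg j) (measurable_rV_coord j)).
Qed.

Lemma cmeasurable_tensor n (g : 'I_n -> R -> R[i]) :
  (forall j, cmeasurable (g j)) -> cmeasurable (tensor g).
Proof.
move=> mg; apply: cmeasurable_prod => j; have [g1 g2] := mg j.
by split; [exact: (measurableT_comp g1 (measurable_rV_coord j))|
  exact: (measurableT_comp g2 (measurable_rV_coord j))].
Qed.

Lemma tensor_ge0 n (g : 'I_n -> R -> R) x : (forall j t, 0 <= g j t) ->
  0 <= tensor g x.
Proof. by move=> g0; apply: prodr_ge0. Qed.

Lemma ge0_integral_lebS n (f : 'rV[R]_n.+1 -> \bar R) : measurable_fun setT f ->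
  (forall x, 0 <= f x)%E ->
  (\int[leb n.+1]_x f x =
   \int[(lebesgue_measure \x leb n)]_z f (rV_cons z))%E.
Proof.
move=> mf f0.
pose mu := (@lebesgue_measure R \x leb n)%E.
have mc : measurable_fun setT (@rV_cons R n : (measurableTypeR R * 'rV[R]_n)%type -> 'rV[R]_n.+1).
  exact: measurable_rV_cons.
have := @ge0_integral_pushforward _ _ _ _ R _ mc mu setT f measurableT mf (fun x _ => f0 x).
by rewrite preimage_setT.
Qed.

Lemma Rintegral_lebS n (f : 'rV[R]_n.+1 -> R) : measurable_fun setT f ->
  \int[leb n.+1]_x f x =
  \int[(lebesgue_measure \x leb n)%E]_z f (rV_cons z).
Proof.
move=> mf; rewrite /Rintegral integralE [in RHS]integralE.
have mf' : measurable_fun setT (EFin \o f) by exact/measurable_EFinP.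
rewrite ge0_integral_lebS//; last exact: measurable_funepos.
rewrite ge0_integral_lebS//; last exact: measurable_funeneg.
by congr (fine (_ - _)%E); apply: eq_integral => z _; rewrite ?funeposE ?funenegE.
Qed.

Lemma cint_lebS n (f : 'rV[R]_n.+1 -> R[i]) : cmeasurable f ->
  cint (leb n.+1) f =
  cint (lebesgue_measure \x leb n)%E (fun z => f (rV_cons z)).
Proof. by move=> [f1 f2]; rewrite /cint !Rintegral_lebS. Qed.

Lemma cmeasurable_rV_cons n (f : 'rV[R]_n.+1 -> R[i]) : cmeasurable f ->
  cmeasurable (fun z => f (rV_cons z)).
Proof.
by move=> [f1 f2]; split; [exact: (measurableT_comp f1 (@measurable_rV_cons R n))|
  exact: (measurableT_comp f2 (@measurable_rV_cons R n))].
Qed.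

Lemma ge0_integral_tensor n (g : 'I_n -> R -> R) :
  (forall j, measurable_fun setT (g j)) -> (forall j t, 0 <= g j t) ->
  (\int[leb n]_x (tensor g x)%:E =
   \prod_(j < n) \int[lebesgue_measure]_t (g j t)%:E)%E.
Proof.
elim: n g => [|n IH] g mg g0.
  rewrite big_ord0 /=; under eq_integral do rewrite tensor0.
  by rewrite integral_cst//= mul1e diracT.
have mt : measurable_fun setT (EFin \o tensor g).
  by apply/measurable_EFinP; exact: measurable_tensor.
rewrite ge0_integral_lebS//; last by move=> x; rewrite lee_fin tensor_ge0.
rewrite fubini_tonelli1; last 2 first.
- exact: (measurableT_comp mt (@measurable_rV_cons R n)).
- by move=> x; rewrite lee_fin tensor_ge0.
rewrite /fubini_F /= big_ord_recl -IH//.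
under eq_integral => a _.
  under eq_integral do rewrite tensor_cons EFinM.
  rewrite ge0_integralZl//; last 3 first.
  - by apply/measurable_EFinP; exact: measurable_tensor.
  - by move=> x _; rewrite lee_fin tensor_ge0.
  - by rewrite lee_fin.
  over.
rewrite ge0_integralZr//.
- by have /measurable_EFinP := mg ord0.
- by move=> x _; rewrite lee_fin.
- by apply: integral_ge0 => x _; rewrite lee_fin tensor_ge0.
Qed.

Lemma integrable_tensor n (g : 'I_n -> R -> R) :
  (forall j t, 0 <= g j t) ->
  (forall j, lebesgue_measure.-integrable setT (EFin \o g j)) ->
  (leb n).-integrable setT (EFin \o tensor g).
Proof.
move=> g0 ig; have mg j : measurable_fun setT (g j).
  by apply/measurable_EFinP; case/integrableP : (ig j).
apply/integrableP; split; first by apply/measurable_EFinP; exact: measurable_tensor.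
under eq_integral do rewrite /= ger0_norm ?tensor_ge0//.
rewrite ge0_integral_tensor//.
rewrite (eq_bigr (fun j => (fine (\int[lebesgue_measure]_t (g j t)%:E))%:E)).
  by rewrite prodEFin ltry.
by move=> j _; rewrite fineK//; apply: (integrable_fin_num measurableT (ig j)).
Qed.

Lemma cintegrable_tensor n (g : 'I_n -> R -> R[i]) :
  (forall j, cintegrable lebesgue_measure (g j)) ->
  cintegrable (leb n) (tensor g).
Proof.
move=> ig; apply: (@le_cintegrable _ _ _ _ _ (tensor (fun j t => normc (g j t)))).
- by apply: cmeasurable_tensor => j; case: (ig j).
- by apply: integrable_tensor => [j t|j]; [exact: normc_ge0|case: (ig j)].
- by move=> x; rewrite normc_prod.
Qed.

Lemma cint_tensor n (g : 'I_n -> R -> R[i]) :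
  (forall j, cintegrable lebesgue_measure (g j)) ->
  cint (leb n) (tensor g) = \prod_(j < n) cint lebesgue_measure (g j).
Proof.
elim: n g => [|n IH] g ig.
  rewrite big_ord0 (eq_cint _ (tensor0 g)) /cint -[RHS]/(Complex 1 0).
  congr Complex.
    rewrite (_ : \int[leb 0]_x _ = \int[leb 0]_x (1 : R))// /Rintegral.
    by rewrite integral_cst// mul1e; exact: (congr1 fine (diracT _ _)).
  by rewrite Rintegral_cst// mul0r.
have mt : cmeasurable (tensor g) by apply: cmeasurable_tensor => j; case: (ig j).
rewrite cint_lebS// big_ord_recl.
rewrite (@cint_prod _ _ _ _ R (@lebesgue_measure R) (leb n) _ (fun a => normc (g ord0 a))
  (tensor (fun j t => normc (g (lift ord0 j) t)))); last 4 first.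
- exact: cmeasurable_rV_cons.
- by case: (ig ord0).
- by apply: integrable_tensor => [j t|j]; [exact: normc_ge0|case: (ig (lift ord0 j))].
- by move=> a x; rewrite tensor_cons normcM normc_prod.
have it := cintegrable_tensor (fun j => ig (lift ord0 j)).
rewrite -(IH (fun j => g (lift ord0 j))); last by move=> j; exact: ig.
rewrite mulrC -cintZ; last exact: ig.
apply: eq_cint => a; under eq_cint do rewrite tensor_cons.
by rewrite cintZ// mulrC.
Qed.

End tensor.

(** * Complex derivatives and integration by parts *)

Lemma continuous_mul {R : realType} {T : topologicalType} (f g : T -> R) :
  continuous f -> continuous g -> continuous (fun x => f x * g x).
Proof. by move=> cf cg x; apply: cvgM; [exact: cf|exact: cg]. Qed.

Lemma continuous_add {R : realType} {T : topologicalType} (f g : T -> R) :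
  continuous f -> continuous g -> continuous (fun x => f x + g x).
Proof. by move=> cf cg x; apply: cvgD; [exact: cf|exact: cg]. Qed.

Lemma continuous_sum {R : realType} {T : topologicalType} n (F : 'I_n -> T -> R) :
  (forall j, continuous (F j)) -> continuous (fun x => \sum_j F j x).
Proof.
move=> cF x; apply: cvg_big => [|j _]; first exact: add_continuous.
exact: cF.
Qed.

Section complex_continuity.
Context {R : realType} {T : topologicalType}.
Implicit Types f g : T -> R[i].

Definition ccontinuous f := continuous (fun x => cRe (f x)) /\
  continuous (fun x => cIm (f x)).

Lemma ccontinuous_cst z : ccontinuous (fun=> z).
Proof. by split => x; exact: cvg_cst. Qed.

Lemma ccontinuousD f g : ccontinuous f -> ccontinuous g ->
  ccontinuous (fun x => f x + g x).
Proof.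
move=> [f1 f2] [g1 g2]; split.
- by under eq_fun do rewrite ReD; exact: continuous_add.
- by under eq_fun do rewrite ImD; exact: continuous_add.
Qed.

Lemma ccontinuousM f g : ccontinuous f -> ccontinuous g ->
  ccontinuous (fun x => f x * g x).
Proof.
move=> [f1 f2] [g1 g2]; split => x.
- under eq_fun do rewrite ReM.
  by apply: cvgB; apply: cvgM; [exact: f1|exact: g1|exact: f2|exact: g2].
- under eq_fun do rewrite ImM.
  by apply: cvgD; apply: cvgM; [exact: f1|exact: g2|exact: f2|exact: g1].
Qed.

Lemma ccontinuous_expi (h : T -> R) : continuous h ->
  ccontinuous (fun x => expi (h x)).
Proof.
move=> ch; split => x /=.
- apply: (continuous_comp (f := h) (g := @cos R)); [exact: ch|exact: continuous_cos].
- apply: (continuous_comp (f := h) (g := @sin R)); [exact: ch|exact: continuous_sin].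
Qed.

Lemma continuous_normc f : ccontinuous f -> continuous (fun x => normc (f x)).
Proof.
move=> [f1 f2]; under eq_fun do rewrite normcE.
move=> x; apply: (continuous_comp (f := fun x => cRe (f x) ^+ 2 + cIm (f x) ^+ 2)
  (g := @Num.sqrt R)); last exact: sqrt_continuous.
by apply: cvgD; apply: cvgM; [exact: f1|exact: f1|exact: f2|exact: f2].
Qed.

End complex_continuity.

Lemma ccontinuous_comp (R : realType) (S T : topologicalType) (h : S -> T)
    (f : T -> R[i]) : continuous h ->
  ccontinuous f -> ccontinuous (fun x => f (h x)).
Proof.
move=> ch [f1 f2]; split => y.
- exact: (continuous_comp (f := h) (g := fun x => cRe (f x)) (ch y) (f1 _)).
- exact: (continuous_comp (f := h) (g := fun x => cIm (f x)) (ch y) (f2 _)).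
Qed.

Section complex_derivative.
Context {R : realType} {V : normedModType R}.
Implicit Types (f g : V -> R[i]) (x v : V).

Definition is_cderive x v f (df : R[i]) :=
  is_derive x v (fun y => cRe (f y)) (cRe df) /\
  is_derive x v (fun y => cIm (f y)) (cIm df).

Lemma is_cderive_cst x v z : is_cderive x v (fun=> z) 0.
Proof. by split; exact: is_derive_cst. Qed.

Lemma is_cderiveM x v f g df dg : is_cderive x v f df -> is_cderive x v g dg ->
  is_cderive x v (fun y => f y * g y) (df * g x + f x * dg).
Proof.
move=> [f1 f2] [g1 g2]; split.
- under eq_fun do rewrite ReM.
  apply: (is_derive_eq (is_deriveB (is_deriveM f1 g1) (is_deriveM f2 g2))).
  rewrite ReD !ReM /GRing.scale /=; ring.
- under eq_fun do rewrite ImM.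
  apply: (is_derive_eq (is_deriveD (is_deriveM f1 g2) (is_deriveM f2 g1))).
  rewrite ImD !ImM /GRing.scale /=; ring.
Qed.

Lemma is_cderiveZ x v f df z : is_cderive x v f df ->
  is_cderive x v (fun y => z * f y) (z * df).
Proof.
move=> fd; have := is_cderiveM (is_cderive_cst x v z) fd.
by rewrite mul0r add0r.
Qed.

Lemma is_cderive_eq x v f df df' : is_cderive x v f df -> df = df' ->
  is_cderive x v f df'.
Proof. by move=> + <-. Qed.

(* The difference quotient along [v] is the one of the restriction to a line. *)
Lemma is_derive_line (f : V -> R) x v (t df : R) :
  is_derive (t *: v + x) v f df <-> is_derive t 1 (fun h => f (h *: v + x)) df.
Proof.
have E : (fun h : R => h^-1 *: ((f \o shift (t *: v + x)) (h *: v) - f (t *: v + x))) =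
    (fun h : R => h^-1 *: (((fun h => f (h *: v + x)) \o shift t) (h *: 1) - f (t *: v + x))).
  apply/funext => h /=; congr (_ *: (f _ - _)).
  by rewrite scalerDl addrA /GRing.scale/= mulr1.
by split => -[d1 d2]; split; move: d1 d2; rewrite /derivable /derive E.
Qed.

End complex_derivative.

Lemma is_cderive_line (R : realType) (V : normedModType R) (f : V -> R[i])
    (x v : V) (t : R) df :
  is_cderive (t *: v + x) v f df <-> is_cderive t 1 (fun h => f (h *: v + x)) df.
Proof.
split => -[d1 d2]; split.
- exact/(is_derive_line (fun y => cRe (f y))).
- exact/(is_derive_line (fun y => cIm (f y))).
- exact/(is_derive_line (fun y => cRe (f y))).
- exact/(is_derive_line (fun y => cIm (f y))).
Qed.

Lemma is_cderive_line0 (R : realType) (V : normedModType R) (f : V -> R[i])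
    (x v : V) df :
  is_cderive x v f df <-> is_cderive (0 : R) 1 (fun h => f (h *: v + x)) df.
Proof. by rewrite -is_cderive_line scale0r add0r. Qed.

Section real_line.
Context {R : realType}.
Notation mu := (@lebesgue_measure R).
Implicit Types (f F : R -> R) (v w : R -> R[i]).

Definition ind (r t : R) : R := \1_(`[- r, r]) t.

Lemma indE (r t : R) : ind r t = (`|t| <= r)%R%:R.
Proof. by rewrite /ind indicE mem_setE in_itv/= ler_norml. Qed.

Lemma ind_ge0 (r t : R) : 0 <= ind r t. Proof. by rewrite indE. Qed.

Lemma integrable_ind (r : R) : mu.-integrable setT (EFin \o ind r).
Proof. exact: integrable_indic_itv. Qed.

Lemma ccontinuous_cmeasurable v : ccontinuous v -> cmeasurable v.
Proof. by move=> [v1 v2]; split; exact: continuous_measurable_fun. Qed.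

Lemma is_derive_continuous f F : (forall t : R, is_derive t 1 F (f t)) -> continuous F.
Proof.
by move=> Ff t; apply/differentiable_continuous/derivable1_diffP; case: (Ff t).
Qed.

Lemma is_cderive_continuous v w : (forall t : R, is_cderive t 1 v (w t)) -> ccontinuous v.
Proof.
by move=> vw; split; [apply: (@is_derive_continuous (fun t => cRe (w t)))|
  apply: (@is_derive_continuous (fun t => cIm (w t)))] => t; case: (vw t).
Qed.

Lemma Rintegral_derive f F (a b : R) : a < b -> continuous f ->
  (forall t : R, is_derive t 1 F (f t)) ->
  \int[mu]_(t in `[a, b]) f t = F b - F a.
Proof.
move=> ab cf Ff; have cF := is_derive_continuous Ff.
rewrite /Rintegral (continuous_FTC2 (F := F) ab)//.
- exact: continuous_subspaceT.
- split.
  + by move=> t _; case: (Ff t).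
  + exact/cvg_at_right_filter/cF.
  + exact/cvg_at_left_filter/cF.
- by move=> t _; rewrite derive1E; apply: derive_val.
Qed.

Lemma Rintegral_derive_supp f F (r : R) : 0 < r -> continuous f ->
  (forall t : R, is_derive t 1 F (f t)) -> (forall t, r < `|t| -> f t = 0) ->
  \int[mu]_t f t = F r - F (- r).
Proof.
move=> r0 cf Ff f0; rewrite -(@Rintegral_derive f) //; last by rewrite gtrN.
rewrite [RHS]Rintegral_mkcond; apply: eq_Rintegral => t _.
rewrite patchE; case: ifPn => //; rewrite mem_setE in_itv/= -ler_norml -ltNge.
exact: f0.
Qed.

Lemma cint_derive_supp v w (r : R) : 0 < r -> ccontinuous w ->
  (forall t : R, is_cderive t 1 v (w t)) -> (forall t, r < `|t| -> w t = 0) ->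
  cint mu w = v r - v (- r).
Proof.
move=> r0 [w1 w2] vw w0; apply: complex_ext; rewrite ?ReD ?ImD ?ReN ?ImN /=.
- apply: (@Rintegral_derive_supp _ (fun t => cRe (v t))) => //.
  + by move=> t; case: (vw t).
  + by move=> t /w0 ->.
- apply: (@Rintegral_derive_supp _ (fun t => cIm (v t))) => //.
  + by move=> t; case: (vw t).
  + by move=> t /w0 ->.
Qed.

End real_line.

(** * Functions of several variables supported in a box *)

Section box_support.
Context {R : realType}.

(** Boxes replace general compact sets because a slice of such a function has the same property with
    the same [r], which the induction on the dimension requires. *)
Definition off_box n (r : R) (f : 'rV[R]_n -> R[i]) : Prop :=
  forall x : 'rV[R]_n, (exists j, r < `|x ord0 j|) -> f x = 0.

Lemma ccontinuous_cmeasurable_rV n (f : 'rV[R]_n -> R[i]) :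
  ccontinuous f -> cmeasurable f.
Proof. by move=> [f1 f2]; split; exact: continuous_measurable_rV. Qed.

(** The extreme value theorem on the box. The majorant is a multiple of a product of one-variable
    indicators, the form that the Fubini lemmas accept. *)
Lemma box_bounded n (r : R) (f : 'rV[R]_n -> R[i]) : 0 <= r ->
  ccontinuous f -> off_box r f ->
  exists2 M : R, 0 <= M & forall x, normc (f x) <= M * tensor (fun=> ind r) x.
Proof.
move=> r0 cf fr; pose B := [set x : 'rV[R]_n | forall j, x ord0 j \in `[- r, r]].
have B0 : B !=set0.
  by exists 0 => j; rewrite mxE in_itv/= lerNl oppr0 r0.
have cB : compact B.
  by apply: (@rV_compact R n (fun=> `[- r, r]%classic)) => j; exact: segment_compact.
have [c _ fc] := EVT_max_rV B0 cB (continuous_subspaceT (continuous_normc cf)).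
exists (normc (f c)) => [|x]; first exact: normc_ge0.
have [xB|xB] := pselect (B x).
  have -> : tensor (fun=> ind r) x = 1.
    rewrite /tensor big1// => j _; rewrite indE ler_norml.
    by have := xB j; rewrite in_itv/= => ->.
  by rewrite mulr1 fc// inE.
have fx0 : f x = 0.
  apply: fr; move: xB => /existsNP[j]; rewrite in_itv/= -ler_norml => /negP.
  by rewrite -ltNge; exists j.
rewrite fx0 normc0 mulr_ge0 ?normc_ge0//; apply: tensor_ge0 => j t.
exact: ind_ge0.
Qed.

Lemma integrable_box n (r : R) (M : R) :
  (leb n).-integrable setT (EFin \o (fun x => M * tensor (fun=> ind r) x)).
Proof.
have ir : (leb n).-integrable setT (EFin \o tensor (fun=> ind r)).
  apply: integrable_tensor => [j t|j]; [exact: ind_ge0|exact: integrable_ind].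
by have := integrableZl measurableT M ir.
Qed.

Lemma cintegrable_box n (r : R) (f : 'rV[R]_n -> R[i]) : 0 <= r ->
  ccontinuous f -> off_box r f -> cintegrable (leb n) f.
Proof.
move=> r0 cf fr; have [M M0 fM] := box_bounded r0 cf fr.
apply: (@le_cintegrable _ _ _ _ _ (fun x => M * tensor (fun=> ind r) x)) => //.
- exact: ccontinuous_cmeasurable_rV.
- exact: integrable_box.
Qed.

Lemma rV_cons_line n (t : R) (x : 'rV[R]_n) :
  rV_cons (t, x) = t *: evec ord0 + rV_cons (0, x).
Proof.
apply/rowP => i; rewrite [RHS]mxE; case: (unliftP ord0 i) => [j ->|->].
- by rewrite !rV_consS !mxE lift_eqF /= mulr0 add0r.
- by rewrite !rV_cons0 !mxE eqxx/= mulr1 addr0.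
Qed.

Lemma rV_cons_lineS n (a t : R) (i : 'I_n) (x : 'rV[R]_n) :
  rV_cons (a, t *: evec i + x) = t *: evec (lift ord0 i) + rV_cons (a, x).
Proof.
apply/rowP => k; rewrite [RHS]mxE; case: (unliftP ord0 k) => [j ->|->].
- by rewrite !rV_consS !mxE /= (inj_eq lift_inj).
- by rewrite !rV_cons0 !mxE eq_liftF /= mulr0 add0r.
Qed.

Lemma continuous_rV_cons1 n (x : 'rV[R]_n) : continuous (fun a : R => rV_cons (a, x)).
Proof.
move=> a; apply: cvg_rV => k; case: (unliftP ord0 k) => [j ->|->].
- by under eq_fun do rewrite rV_consS; rewrite rV_consS; exact: cvg_cst.
- by under eq_fun do rewrite rV_cons0; rewrite rV_cons0; exact: cvg_id.
Qed.

Lemma continuous_rV_cons2 n (a : R) : continuous (fun x : 'rV[R]_n => rV_cons (a, x)).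
Proof.
move=> x; apply: (@cvg_rV _ _ _ _ (nbhs_filter x)) => k; case: (unliftP ord0 k) => [j ->|->].
- by under eq_fun do rewrite rV_consS; rewrite rV_consS; exact: (@coord_continuous R 1 n ord0 j x).
- by under eq_fun do rewrite rV_cons0; rewrite rV_cons0; exact: cvg_cst.
Qed.

Lemma off_box_cons1 n (r : R) (f : 'rV[R]_n.+1 -> R[i]) x a :
  off_box r f -> r < `|a| -> f (rV_cons (a, x)) = 0.
Proof. by move=> fr ra; apply: fr; exists ord0; rewrite rV_cons0. Qed.

Lemma off_box_cons2 n (r : R) (f : 'rV[R]_n.+1 -> R[i]) a :
  off_box r f -> off_box r (fun x => f (rV_cons (a, x))).
Proof. by move=> fr x [j rj]; apply: fr; exists (lift ord0 j); rewrite rV_consS. Qed.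

(** Induction on the dimension, splitting off the first coordinate. If [j] is that coordinate, the
    integrals are exchanged and the inner one vanishes by the fundamental theorem of calculus;
    otherwise the inner integral vanishes by induction. *)
Lemma cint_partial n (r : R) (u w : 'rV[R]_n -> R[i]) j : 0 < r ->
  ccontinuous w -> (forall x, is_cderive x (evec j) u (w x)) ->
  off_box r u -> off_box r w -> cint (leb n) w = 0.
Proof.
move=> r0; elim: n u w j => [|n IH] u w j cw uw ur wr; first by case: j uw.
have [M M0 wM] := box_bounded (ltW r0) cw wr.
have mw := ccontinuous_cmeasurable_rV cw.
have wab a x : normc (w (rV_cons (a, x))) <= M * ind r a * tensor (fun=> ind r) x.
  by rewrite (le_trans (wM _))// tensor_cons mulrA.
have iM : lebesgue_measure.-integrable setT (EFin \o (fun a : R => M * ind r a)).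
  by have := integrableZl measurableT M (integrable_ind r).
have it : (leb n).-integrable setT (EFin \o tensor (fun=> ind r)).
  by apply: integrable_tensor => [? ?|?]; [exact: ind_ge0|exact: integrable_ind].
rewrite cint_lebS//.
rewrite (@cint_prod _ _ _ _ R (@lebesgue_measure R) (leb n) _ _ _
  (cmeasurable_rV_cons mw) iM it wab).
case: (unliftP ord0 j) uw => [i ->|->] uw; last first.
  rewrite (@cint_Fubini _ _ _ _ R (@lebesgue_measure R) (leb n) _ _ _
    (cmeasurable_rV_cons mw) iM it wab) -[RHS](cint0 (leb n)).
  apply: eq_cint => x.
  (* The endpoints are put at [2 * r] because vanishing is only known strictly beyond [r]. *)
  rewrite (@cint_derive_supp _ (fun a => u (rV_cons (a, x))) _ (2 * r)).
  - by rewrite !(off_box_cons1 _ ur) ?subrr// ?normrN gtr0_norm ?mulr_gt0// ltr_pMl// ltr1n.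
  - by rewrite mulr_gt0.
  - exact: ccontinuous_comp (@continuous_rV_cons1 n x) cw.
  - move=> t; have := uw (rV_cons (t, x)); rewrite {1}rV_cons_line => /is_cderive_line.
    by under eq_fun do rewrite -rV_cons_line.
  - move=> t rt; apply: (off_box_cons1 _ wr); apply: lt_trans rt.
    by rewrite ltr_pMl// ltr1n.
rewrite -[RHS](cint0 lebesgue_measure); apply: eq_cint => a.
apply: (IH (fun x => u (rV_cons (a, x))) _ i).
- exact: ccontinuous_comp (@continuous_rV_cons2 n a) cw.
- move=> x; apply/is_cderive_line0; under eq_fun do rewrite rV_cons_lineS.
  by apply/(is_cderive_line0 u); exact: uw.
- exact: off_box_cons2.
- exact: off_box_cons2.
Qed.

End box_support.

Section smooth_functions.
Context {R : realType} {d : nat}.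
Notation E := 'rV[R]_d.
Implicit Types (f u w : E -> R[i]) (x : E).

Lemma smooth_ccontinuous f s : smooth f -> ccontinuous (pderivs s f).
Proof. by move=> /(_ s)[f1 f2 _]; split. Qed.

Lemma smooth_is_cderive f s j x : smooth f ->
  is_cderive x (evec j) (pderivs s f) (pderivs (j :: s) f x).
Proof. by move=> /(_ s)[_ _ /(_ j x)[f1 f2]]; split; exact: derivableP. Qed.

(** The condition [r < |x k|] is open, so [f] vanishes near such a point, and a directional
    derivative depends only on the germ. *)
Lemma off_box_pderiv (r : R) f j : off_box r f -> off_box r (pderiv j f).
Proof.
move=> fr x [k rk].
have near0 : \forall y \near x, f y = 0.
  have : \forall y \near x, r < `|(y : E) ord0 k|.
    have ck : {for x, continuous (fun y : E => `|y ord0 k|)}.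
      by apply: (continuous_comp (f := fun y : E => y ord0 k));
        [exact: coord_continuous|exact: norm_continuous].
    exact: (@cvgr_gt R _ _ (nbhs_filter x) (fun y : E => `|y ord0 k|) _ ck _ rk).
  by apply: filterS => y ry; apply: fr; exists k.
rewrite /pderiv; apply: complex_ext => /=.
- rewrite (@near_eq_derive _ _ _ _ (cst 0)) ?derive_cst//.
  by apply: filterS near0 => y ->.
- rewrite (@near_eq_derive _ _ _ _ (cst 0)) ?derive_cst//.
  by apply: filterS near0 => y ->.
Qed.

Lemma off_box_pderivs (r : R) f s : off_box r f -> off_box r (pderivs s f).
Proof. by move=> fr; elim: s => //= j s IH; exact: off_box_pderiv. Qed.

Lemma compact_off_box (K : set E) f : compact K -> vanishes_off K f ->
  exists2 r : R, 0 < r & off_box r f.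
Proof.
move=> cK fK; have [M [_ KM]] := compact_bounded cK.
(* [compact_bounded] bounds [K] by every number strictly above [M]; the maximum with 0 and the added
   1 also make the radius positive. *)
exists (Num.max M 0 + 1) => [|x [j rj]].
  by rewrite ltr_wpDl// le_max lexx orbT.
apply: fK => Kx; have := KM (Num.max M 0 + 1); rewrite ltr_pwDr ?le_max ?lexx//.
move=> /(_ isT x Kx); apply/negP; rewrite -ltNge (lt_le_trans rj)//.
exact: coord_le_norm.
Qed.

Lemma test_off_box (O : set E) f : test O f -> exists2 r : R, 0 < r & off_box r f.
Proof. by move=> [_ [K [cK _ fK]]]; exact: compact_off_box cK fK. Qed.

End smooth_functions.

Lemma is_cderive_expi {R : realType} (a c t : R) :
  is_cderive t 1 (fun s => expi (a * s + c)) (Complex 0 a * expi (a * t + c)).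
Proof.
have dl : is_derive t 1 (fun s : R => a * s + c) a.
  have := is_deriveD (is_deriveM (is_derive_cst a t 1) (is_derive_id t 1)) (is_derive_cst c t 1).
  by move=> H; apply: (is_derive_eq H); rewrite /GRing.scale/= mulr0 !addr0 mulr1.
split.
- have := @is_derive1_comp _ (@cos R) (fun s => a * s + c) t _ _ (is_derive_cos (a * t + c)) dl.
  by move=> H; apply: (is_derive_eq H); rewrite ReM /= mul0r sub0r mulNr mulrC.
- have := @is_derive1_comp _ (@sin R) (fun s => a * s + c) t _ _ (is_derive_sin (a * t + c)) dl.
  by move=> H; apply: (is_derive_eq H); rewrite ImM /= mul0r add0r mulrC.
Qed.

(** * Inverse Fourier transforms of compactly supported functions *)

Section fourier_decay.
Context {R : realType} {d : nat}.
Notation E := 'rV[R]_d.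
Implicit Types (f u w : E -> R[i]) (x y : E).

Lemma dotDl x y z : dot (x + y) z = dot x z + dot y z.
Proof. by rewrite /dot -big_split; apply: eq_bigr => j _; rewrite mxE mulrDl. Qed.

Lemma dotC x y : dot x y = dot y x.
Proof. by apply: eq_bigr => j _; rewrite mulrC. Qed.

Lemma dotDr x y z : dot x (y + z) = dot x y + dot x z.
Proof. by rewrite dotC dotDl ![dot _ x]dotC. Qed.

Lemma dotZr x y (t : R) : dot x (t *: y) = t * dot x y.
Proof. by rewrite /dot big_distrr; apply: eq_bigr => j _; rewrite /= mxE mulrCA. Qed.

Lemma dotNl x y : dot (- x) y = - dot x y.
Proof. by rewrite /dot -sumrN; apply: eq_bigr => j _; rewrite mxE mulNr. Qed.

Lemma dot_evec x j : dot x (evec j) = x ord0 j.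
Proof.
rewrite /dot (bigD1 j)//= mxE !eqxx mulr1 big1 ?addr0// => k kj.
by rewrite mxE (negbTE kj) andbF mulr0.
Qed.

Lemma continuous_dot x : continuous (dot x).
Proof.
rewrite (_ : dot x = fun y => \sum_j x ord0 j * y ord0 j)//.
apply: continuous_sum => j; apply: continuous_mul; first by move=> y; exact: cst_continuous.
exact: coord_continuous.
Qed.

Lemma ccontinuous_wave x : ccontinuous (wave x).
Proof.
apply: ccontinuous_expi; apply: continuous_mul; last exact: continuous_dot.
by move=> y; exact: cst_continuous.
Qed.

Lemma normc_wave x y : normc (wave x y) = 1. Proof. exact: normc_expi. Qed.

Lemma is_cderive_wave x y j : is_cderive y (evec j) (wave x)
  (Complex 0 (2 * pi * x ord0 j) * wave x y).
Proof.
apply/is_cderive_line0.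
have := is_cderive_expi (2 * pi * x ord0 j) (2 * pi * dot x y) 0.
rewrite mulr0 add0r; congr is_cderive; apply/funext => t.
by rewrite /wave dotDr dotZr dot_evec; congr expi; ring.
Qed.

Lemma off_boxM (r : R) f u : off_box r f -> off_box r (fun x => f x * u x).
Proof. by move=> fr x xr; rewrite fr// mul0r. Qed.

(** The integral of the [j]-th partial derivative of [u * wave x] is zero by [cint_partial]; the two
    terms of the product rule are the two sides. *)
Lemma inv_fourier_partial (r : R) u w x j : 0 < r ->
  ccontinuous u -> ccontinuous w ->
  (forall y, is_cderive y (evec j) u (w y)) -> off_box r u -> off_box r w ->
  Complex 0 (2 * pi * x ord0 j) * inv_fourier u x = - inv_fourier w x.
Proof.
move=> r0 cu cw uw ur wr; apply/eqP; rewrite -addr_eq0 addrC; apply/eqP.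
have cuw : ccontinuous (fun y => u y * wave x y).
  exact: ccontinuousM cu (ccontinuous_wave x).
have cww : ccontinuous (fun y => w y * wave x y).
  exact: ccontinuousM cw (ccontinuous_wave x).
have iu := cintegrable_box (ltW r0) cuw (off_boxM _ ur).
have iw := cintegrable_box (ltW r0) cww (off_boxM _ wr).
rewrite /inv_fourier -![cintegral _]/(cint (leb d) _) -cintZ// -cintD//; last first.
  exact: cintegrableZ.
apply: (@cint_partial _ _ r (fun y => u y * wave x y) _ j r0) => //.
- by apply: ccontinuousD => //; apply: ccontinuousM => //; exact: ccontinuous_cst.
- move=> y; apply: (is_cderive_eq (is_cderiveM (uw y) (is_cderive_wave x y j))).
  by congr (_ + _); rewrite mulrCA.
- exact: off_boxM.
- by move=> y yr; rewrite ur// wr// !mul0r mulr0 addr0.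
Qed.

Lemma normc_Complex0 (a : R) : normc (Complex 0 a) = `|a|.
Proof. by rewrite normcE /= expr0n add0r sqrtr_sqr. Qed.

Lemma inv_fourier_pderivs (r : R) f x j m : 0 < r -> smooth f -> off_box r f ->
  `|2 * pi * x ord0 j| ^+ m * normc (inv_fourier f x) =
  normc (inv_fourier (pderivs (nseq m j) f) x).
Proof.
move=> r0 sf fr; elim: m => [|m IH]; first by rewrite expr0 mul1r.
rewrite exprS -mulrA IH -normc_Complex0 -normcM.
rewrite (@inv_fourier_partial r _ (pderivs (nseq m.+1 j) f)) ?normcN//.
- exact: smooth_ccontinuous.
- exact: smooth_ccontinuous.
- by move=> y; exact: smooth_is_cderive.
- exact: off_box_pderivs.
- exact: off_box_pderivs.
Qed.

Lemma inv_fourier_bounded (r : R) f : 0 <= r -> ccontinuous f -> off_box r f ->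
  exists2 C : R, 0 <= C & forall x, normc (inv_fourier f x) <= C.
Proof.
move=> r0 cf fr; have [M M0 fM] := box_bounded r0 cf fr.
have b0 x : 0 <= M * tensor (fun=> ind r) x.
  by rewrite mulr_ge0// tensor_ge0// => j t; exact: ind_ge0.
exists (2 * \int[leb d]_x (M * tensor (fun=> ind r) x)).
  by rewrite mulr_ge0// Rintegral_ge0.
move=> x; apply: normc_cint_le.
- apply: ccontinuous_cmeasurable_rV; exact: ccontinuousM cf (ccontinuous_wave x).
- exact: integrable_box.
- by move=> y; rewrite normcM normc_wave mulr1.
Qed.

End fourier_decay.

(** * Decay estimates *)

Section weights.
Context {R : realType}.
Notation mu := (@lebesgue_measure R).
Implicit Types (e c t x y : R).

Lemma derive_affine e c t : is_derive t 1 (fun s : R => e * (s - c)) e.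
Proof.
have := is_deriveM (is_derive_cst e t 1)
  (is_deriveB (is_derive_id t 1) (is_derive_cst c t 1)).
by move=> H; apply: (is_derive_eq H); rewrite /GRing.scale/= mulr0 addr0 subr0 mulr1.
Qed.

Lemma oneDsqr_gt0 t : 0 < oneDsqr t.
Proof. by rewrite (lt_le_trans ltr01)// oneDsqr_ge1. Qed.

Lemma oneDsqr_ge0 t : 0 <= oneDsqr t.
Proof. exact/ltW/oneDsqr_gt0. Qed.

(** Powers of this Lorentzian profile measure all decay: its integral is explicit through the
    arctangent, and it obeys a Peetre inequality. *)
Definition weight e c t : R := (oneDsqr (e * (t - c)))^-1.

Lemma weight_gt0 e c t : 0 < weight e c t.
Proof. by rewrite invr_gt0 oneDsqr_gt0. Qed.

Lemma weight_le1 e c t : weight e c t <= 1.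
Proof. exact: oneDsqrV_le1. Qed.

Lemma continuous_weight e c : continuous (weight e c).
Proof.
move=> t; apply: (continuous_comp (f := fun t : R => e * (t - c)) (g := (fun x => (oneDsqr x)^-1))).
  exact: (is_derive_continuous (derive_affine e c)).
exact: continuous_oneDsqrV.
Qed.

(** The arctangent gives the integral over a half-line, symmetry doubles it, and the substitution
    [s = e * (t - c)] brings in the factor [1 / e]. *)
Lemma integral_weight e c : 0 < e ->
  (\int[mu]_t (weight e c t)%:E = (pi / e)%:E)%E.
Proof.
move=> e0; pose G : R -> R := (fun x => (oneDsqr x)^-1).
have G0 t : 0 <= G t by rewrite invr_ge0.
have cG : continuous G := @continuous_oneDsqrV R.
have d1 : (fun s : R => e * (s - c))^`()%classic = cst e.
  by apply/funext => t; rewrite derive1E; case: (derive_affine e c t).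
have half : (\int[mu]_(x in [set x | (0 <= x)%R]) (G x)%:E = (pi / 2)%:E)%E.
  rewrite -set_itvcy (@ge0_continuous_FTC2y _ G (@atan R) 0 (pi / 2))//.
  - by rewrite atan0 sube0.
  - exact: continuous_subspaceT.
  - exact: cvgy_atan.
  - by apply: cvg_at_right_filter; exact: continuous_atan.
  - by move=> x _; rewrite derive1_atan.
have : (\int[mu]_x (G x)%:E = pi%:E)%E.
  rewrite ge0_symfun_integralT// ?half ?[RHS]EFinM -?EFinM.
    by congr EFin; rewrite mulrCA divff ?mulr1.
  by move=> t; rewrite /G /= /oneDsqr sqrrN.
rewrite (@increasing_ge0_integration_by_substitutionT _ (fun s : R => e * (s - c)) G)//.
- rewrite d1 => H.
  have mW : measurable_fun setT (EFin \o weight e c).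
    by apply/measurable_EFinP; apply: continuous_measurable_fun; exact: continuous_weight.
  have : (\int[mu]_x (e%:E * (weight e c x)%:E) = pi%:E)%E.
    by rewrite -H; apply: eq_integral => t _; rewrite -EFinM mulrC.
  rewrite ge0_integralZl//; last 2 first.
  + by move=> t _; rewrite lee_fin ltW ?weight_gt0.
  + by rewrite lee_fin ltW.
  move=> /(congr1 (fun z => (e^-1)%:E * z)%E).
  by rewrite muleA -EFinM mulVf ?gt_eqF// mul1e -EFinM mulrC.
- by move=> x y xy; rewrite ltr_pM2l// ltrD2r.
- by rewrite d1 => x; exact: cst_continuous.
- by rewrite d1; exact: is_cvg_cst.
- by rewrite d1; exact: is_cvg_cst.
- apply/cvgrNyPle => A; near=> x; rewrite -ler_pdivlMl// lerBlDr; near: x.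
  by apply: nbhs_ninfty_le; rewrite num_real.
- apply/cvgryPge => A; near=> x; rewrite -ler_pdivrMl// lerBrDr; near: x.
  by apply: nbhs_pinfty_ge; rewrite num_real.
Unshelve. all: by end_near. Qed.

Lemma integrable_weight e c : 0 < e -> mu.-integrable setT (EFin \o weight e c).
Proof.
move=> e0; apply/integrableP; split.
  by apply/measurable_EFinP; apply: continuous_measurable_fun; exact: continuous_weight.
under eq_integral do rewrite /= ger0_norm ?ltW ?weight_gt0//.
by rewrite integral_weight// ltry.
Qed.

(* Peetre's inequality, with the dilation [e <= 1] on one factor only. *)
Lemma weight_peetre e x y : 0 <= e <= 1 ->
  weight e 0 y * weight 1 x y <= 2 * weight e 0 x.
Proof.
move=> /andP[e0 e1]; rewrite /weight mul1r !subr0 -invfM.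
rewrite ler_pdivlMr ?oneDsqr_gt0// mulrC ler_pdivrMr ?mulr_gt0 ?oneDsqr_gt0//.
have : e ^+ 2 * (y - x) ^+ 2 <= (y - x) ^+ 2.
  by rewrite -[leRHS]mul1r ler_wpM2r ?sqr_ge0// expr_le1.
have : 0 <= e ^+ 2 * y ^+ 2 * (y - x) ^+ 2.
  by apply: mulr_ge0; [apply: mulr_ge0|]; exact: sqr_ge0.
have : 0 <= (e * y + e * (y - x)) ^+ 2 by rewrite sqr_ge0.
rewrite /oneDsqr; nra.
Qed.

(** Integration by parts bounds a function and its product with a pure power of [|t|]; this turns
    the two bounds into one by a power of the weight. *)
Lemma oneDsqr_exp_le N t : oneDsqr t ^+ N <= 2 ^+ N * (1 + `|t| ^+ (2 * N)).
Proof.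
have [t1|t1] := lerP `|t| 1.
  rewrite (@le_trans _ _ (2 ^+ N))//.
    rewrite lerXn2r ?nnegrE ?oneDsqr_ge0//.
    have : t ^+ 2 <= 1 by rewrite -real_normK ?num_real// expr_le1.
    by rewrite /oneDsqr; lra.
  by rewrite ler_peMr ?exprn_ge0// lerDl exprn_ge0.
rewrite (@le_trans _ _ ((2 * `|t| ^+ 2) ^+ N))//.
  rewrite lerXn2r ?nnegrE ?mulr_ge0 ?sqr_ge0 ?oneDsqr_ge0//.
  rewrite /oneDsqr -[t ^+ 2]real_normK ?num_real// mulrDl !mul1r lerD2r.
  by rewrite exprn_ege1// ltW.
by rewrite exprMn -exprM ler_wpM2l ?exprn_ge0// lerDr.
Qed.

(** The product is at most the [n]-th power of its largest factor. Joint decay in all coordinates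
    thus follows from derivatives in one direction at a time, and mixed derivatives never occur. *)
Lemma prodr_le_sum_expr n (a : 'I_n -> R) : (forall j, 1 <= a j) ->
  \prod_j a j <= 1 + \sum_j a j ^+ n.
Proof.
case: n a => [|n] a a1; first by rewrite !big_ord0 addr0.
have [i _ ai] := @Order.TotalTheory.arg_maxP _ _ _ ord0 xpredT a isT.
rewrite (@le_trans _ _ (a i ^+ n.+1))//.
  rewrite -[X in _ ^+ X]card_ord -prodr_const; apply: ler_prod => j _.
  by rewrite (le_trans ler01 (a1 j))/=; exact: ai.
rewrite (bigD1 i)//= addrCA lerDl addr_ge0// sumr_ge0// => j _.
by rewrite exprn_ge0// (le_trans ler01 (a1 j)).
Qed.

End weights.

Section decay_rV.
Context {R : realType} {d : nat}.
Notation E := 'rV[R]_d.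

Lemma inv_fourier_decay (r : R) (f : E -> R[i]) m : 0 < r -> smooth f -> off_box r f ->
  exists2 C : R, 0 <= C &
    forall x, normc (inv_fourier f x) <= C * tensor (fun _ t => weight 1 0 t ^+ m) x.
Proof.
(* Bounding a product over [d] coordinates by a sum raises each [oneDsqr (x j) ^+ m] to the power
   [d], whence the exponent [m * d]; the power [2 * N] of a coordinate then costs [2 * N]
   derivatives. *)
move=> r0 sf fr; pose N := (m * d)%N.
have [C0 C00 HC0] := inv_fourier_bounded (ltW r0) (smooth_ccontinuous [::] sf) fr.
have /choice[C HC] : forall j : 'I_d, exists C : R, 0 <= C /\
    forall x, normc (inv_fourier (pderivs (nseq (2 * N) j) f) x) <= C.
  move=> j; have [] := inv_fourier_bounded (ltW r0)
    (smooth_ccontinuous (nseq (2 * N) j) sf) (off_box_pderivs (nseq (2 * N) j) fr).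
  by move=> C ? ?; exists C.
exists (C0 + \sum_j 2 ^+ N * (C0 + C j)).
  rewrite addr_ge0// sumr_ge0// => j _; rewrite mulr_ge0 ?exprn_ge0// addr_ge0//.
  by case: (HC j).
move=> x; set G := normc _.
have tE : tensor (fun _ t => weight 1 0 t ^+ m) x =
    (\prod_(j < d) oneDsqr (x ord0 j) ^+ m)^-1.
  rewrite /tensor -prodfV; apply: eq_bigr => j _.
  by rewrite /weight mul1r subr0 exprVn.
have q0 : 0 < \prod_(j < d) oneDsqr (x ord0 j) ^+ m.
  by apply: prodr_gt0 => j _; rewrite exprn_gt0// oneDsqr_gt0.
rewrite tE ler_pdivlMr//.
have G0 : 0 <= G := normc_ge0 _.
rewrite (le_trans (ler_wpM2l G0 (prodr_le_sum_expr (a := fun j => oneDsqr (x ord0 j) ^+ m) _)))//.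
  by move=> j; rewrite exprn_ege1.
rewrite mulrDr mulr1 lerD ?HC0// big_distrr/=; apply: ler_sum => j _.
rewrite -exprM -/N (le_trans (ler_wpM2l G0 (oneDsqr_exp_le N _)))//.
rewrite mulrCA ler_wpM2l ?exprn_ge0// mulrDr mulr1 lerD ?HC0//.
rewrite (le_trans _ ((HC j).2 x))// -(inv_fourier_pderivs x j _ r0 sf fr) mulrC.
(* The factor [2 * pi] attached to the coordinate is at least 1 and may be dropped. *)
rewrite ler_wpM2r// lerXn2r ?nnegrE// normrM ler_peMl//.
rewrite ger0_norm ?mulr_ge0 ?pi_ge0//.
have := @pi_ge2 R; lra.
Qed.

End decay_rV.

Section convolution_decay.
Context {R : realType} {d : nat}.
Notation E := 'rV[R]_d.
Implicit Types (f G : E -> R[i]) (x y : E).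

Lemma cmeasurable_reflect G x : cmeasurable G -> cmeasurable (fun y => G (x - y)).
Proof.
have mr : measurable_fun setT (fun y : E => x - y).
  apply: measurable_fun_rVP => i; under eq_fun do rewrite /rV_coord !mxE.
  apply: measurable_funB; first exact: measurable_cst.
  exact: (measurable_rV_coord i).
by move=> [g1 g2]; split; [exact: (measurableT_comp g1 mr)|exact: (measurableT_comp g2 mr)].
Qed.

Lemma integral_tensor_weight (e : R) (c : 'I_d -> R) : 0 < e ->
  (\int[leb d]_x (tensor (fun j => weight e (c j)) x)%:E = ((pi / e) ^+ d)%:E)%E.
Proof.
move=> e0; rewrite ge0_integral_tensor; last 2 first.
- by move=> j; apply: continuous_measurable_fun; exact: continuous_weight.
- by move=> j t; rewrite ltW ?weight_gt0.
under eq_bigr do rewrite integral_weight//.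
by rewrite prodEFin prodr_const card_ord.
Qed.

Lemma integrable_tensor_weight (e : R) (c : 'I_d -> R) : 0 < e ->
  (leb d).-integrable setT (EFin \o tensor (fun j => weight e (c j))).
Proof.
move=> e0; apply: integrable_tensor => [j t|j]; first by rewrite ltW ?weight_gt0.
exact: integrable_weight.
Qed.

(** Of the [m + 1] powers of the weight that [G] offers, [m] are spent on Peetre's inequality, which
    moves the decay of [f] from [y] to [x] at a cost of [2 ^+ m] per coordinate. The last one is
    integrated in [y] and contributes [pi] per coordinate. *)
Lemma conv_decay f G (e A B : R) m x : 0 < e <= 1 -> 0 <= A -> 0 <= B ->
  cmeasurable f -> cmeasurable G ->
  (forall y, normc (f y) <= A * tensor (fun _ t => weight e 0 t ^+ m) y) ->
  (forall y, normc (G y) <= B * tensor (fun _ t => weight 1 0 t ^+ m.+1) y) ->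
  normc (cint (leb d) (fun y => f y * G (x - y))) <=
    2 * (A * B * (2 ^+ m * pi) ^+ d) * tensor (fun _ t => weight e 0 t ^+ m) x.
Proof.
move=> /andP[e0 e1] A0 B0 mf mG fA GB.
pose K := A * B * (2 ^+ m) ^+ d * tensor (fun _ t => weight e 0 t ^+ m) x.
have iK : (leb d).-integrable setT
    (EFin \o (fun y => K * tensor (fun j => weight 1 (x ord0 j)) y)).
  by have := integrableZl measurableT K
    (integrable_tensor_weight (fun j => x ord0 j) (@ltr01 R)).
have w0 k c t : 0 <= weight k c t :> R by rewrite ltW ?weight_gt0.
apply: (le_trans (normc_cint_le (g := fun y =>
    K * tensor (fun j => weight 1 (x ord0 j)) y) _ iK _)).
- by apply: cmeasurableM => //; exact: cmeasurable_reflect.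
- move=> y; rewrite normcM (le_trans (ler_pM (normc_ge0 _) (normc_ge0 _) (fA y) (GB _)))//.
  rewrite mulrACA /K -!(mulrA (A * B)) ler_wpM2l ?mulr_ge0//.
  rewrite -[(2 ^+ m) ^+ d](_ : tensor (fun (_ : 'I_d) (_ : R) => 2 ^+ m) x = _); last first.
    by rewrite /tensor prodr_const card_ord.
  rewrite /tensor -!big_split/=; apply: ler_prod => j _.
  rewrite !mxE mulr_ge0 ?exprn_ge0//= exprSr mulrA.
  have -> : weight 1 0 (x ord0 j - y ord0 j) = weight 1 (x ord0 j) (y ord0 j).
    by rewrite /weight !mul1r subr0 -opprB /oneDsqr sqrrN.
  rewrite ler_wpM2r// -!exprMn lerXn2r ?nnegrE ?mulr_ge0//.
  by apply: weight_peetre; rewrite ltW.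
- rewrite RintegralZl//; last exact: integrable_tensor_weight.
  rewrite /Rintegral integral_tensor_weight// divr1/= /K exprMn.
  rewrite le_eqVlt; apply/orP; left; apply/eqP.
  set T := tensor _ x; set a := (2 ^+ m) ^+ d; set b := pi ^+ d; ring.
Qed.

End convolution_decay.

(** * Upper and lower bounds for L^p norms *)

Section Lpnorm_bounds.
Context {R : realType} {d : nat}.
Notation E := 'rV[R]_d.
Implicit Types h : E -> R[i].

(* This is [0] at [p = +oo], since [fine +oo = 0] and [0^-1 = 0]. *)
Definition invp (p : \bar R) : R := (fine p)^-1.

(** The profile is at most 1 and [m p >= 1], so its power of exponent [m p] is at most the profile
    itself, whose integral is [(pi / e) ^+ d]. No triangle inequality is involved, so [p < 1] is
    covered. At [p = +oo] the bound of the profile by 1 is enough. *)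
Lemma Lpnorm_decay (p : \bar R) h (e A : R) m : (0 < p)%E -> 0 < e -> 0 <= A ->
  (p \is a fin_num -> 1 <= m%:R * fine p) ->
  cmeasurable h -> (forall x, normc (h x) <= A * tensor (fun _ t => weight e 0 t ^+ m) x) ->
  (Lpnorm p h <= (A * ((pi / e) ^+ d) `^ invp p)%:E)%E.
Proof.
move=> p0 e0 A0 mp mh hA; have w0 k c t : 0 <= weight k c t :> R by rewrite ltW ?weight_gt0.
rewrite /Lpnorm unlock; case: p p0 mp => [r| |//] p0 mp; last first.
  rewrite /invp /= invr0 powRr0 mulr1; case: ifPn => // _.
  apply/ess_supP/aeW => x /=; rewrite lee_fin ger0_norm ?normc_ge0//.
  rewrite (le_trans (hA x))// ler_piMr// /tensor.
  by apply: prodr_ile1 => j _; rewrite exprn_ge0//= exprn_ile1// weight_le1.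
have {}p0 : 0 < r by rewrite lte_fin in p0.
(* [A] is rewritten as the power [1 / r] of the power [r] of [A], so that both sides become powers
   of exponent [1 / r] and only integrals remain to be compared. *)
rewrite /invp /= -[X in X * _](@powRr1 _ A)// -(divff (lt0r_neq0 p0)) powRrM.
rewrite -powRM ?powR_ge0//; last by rewrite exprn_ge0// divr_ge0 ?pi_ge0 ?ltW.
rewrite -poweR_EFin; apply: gt0_ler_poweR.
- by rewrite invr_ge0 ltW.
- by rewrite in_itv/= leey andbT integral_ge0// => x _; rewrite poweR_ge0.
- rewrite in_itv/= leey andbT lee_fin mulr_ge0 ?powR_ge0//.
  by rewrite exprn_ge0// divr_ge0 ?pi_ge0 ?ltW.
rewrite EFinM -(integral_tensor_weight (fun=> 0) e0).
have mt : measurable_fun setT (EFin \o tensor (fun _ : 'I_d => weight e 0)).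
  by case/integrableP : (integrable_tensor_weight (fun _ : 'I_d => 0) e0).
rewrite -ge0_integralZl//; last 2 first.
- by move=> x _; rewrite lee_fin tensor_ge0.
- by rewrite lee_fin powR_ge0.
apply: ge0_le_integral => //.
- apply/measurable_EFinP; apply: (measurableT_comp (measurable_powR _)).
  by apply: measurableT_comp => //; exact: measurable_normc.
- exact: measurable_funeM.
move=> x _ /=; rewrite ger0_norm ?normc_ge0// -EFinM lee_fin.
rewrite (le_trans (ge0_ler_powR (ltW p0) _ _ (hA x)))// ?nnegrE ?normc_ge0//.
  by rewrite mulr_ge0// tensor_ge0// => j t; rewrite exprn_ge0.
rewrite powRM//; last by rewrite tensor_ge0// => j t; rewrite exprn_ge0.
rewrite ler_wpM2l ?powR_ge0//.
rewrite (_ : tensor (fun _ t => weight e 0 t ^+ m) x =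
  tensor (fun _ : 'I_d => weight e 0) x ^+ m); last by rewrite /tensor prodrXl.
have t01 : 0 < tensor (fun _ : 'I_d => weight e 0) x <= 1.
  rewrite prodr_gt0 => [|j _]; last exact: weight_gt0.
  by apply: prodr_ile1 => j _; rewrite w0 weight_le1.
rewrite -powR_mulrn ?(ltW (andP t01).1)// -powRrM.
rewrite -[leRHS]powRr1 ?(ltW (andP t01).1)//.
exact: ger_powR (mp isT).
Qed.

(** The integral is restricted to the box with centre [y / e] and side [2 * delta / e], on which the
    modulus is at least [c]. *)
Lemma Lpnorm_box (q : R) h (e c delta : R) (y : 'I_d -> R) : 0 < q -> 0 < e ->
  0 <= c -> 0 < delta -> cmeasurable h ->
  (forall x : E, (forall j, `|e * x ord0 j - y j| <= delta) -> c <= normc (h x)) ->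
  ((c * ((2 * delta / e) ^+ d) `^ q^-1)%:E <= Lpnorm q%:E h)%E.
Proof.
move=> q0 e0 c0 dl0 mh hc.
pose A (j : 'I_d) : set R := `[(y j - delta) / e, (y j + delta) / e]%classic.
pose B := [set x : E | forall j, A j (x ord0 j)].
have mA j : measurable (A j) by exact: measurable_itv.
have mB : measurable B := measurable_rV_box mA.
have lB : leb d B = ((2 * delta / e) ^+ d)%:E.
  rewrite /B leb_box// (eq_bigr (fun=> (2 * delta / e)%:E)).
    by rewrite prodEFin prodr_const card_ord.
  move=> j _; rewrite lebesgue_measure_itv/= lte_fin ltr_pM2r ?invr_gt0//.
  rewrite ltrD2l gtrN// -EFinB -mulrBl; congr (_ / _)%:E; ring.
have b0 : 0 <= (2 * delta / e) ^+ d.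
  by rewrite exprn_ge0// divr_ge0 ?mulr_ge0 ?ltW.
move: ((2 * delta / e) ^+ d) b0 lB => b b0 lB.
rewrite /Lpnorm unlock -[X in X * _](@powRr1 _ c)// -(divff (lt0r_neq0 q0)) powRrM.
rewrite -powRM ?powR_ge0// -poweR_EFin; apply: gt0_ler_poweR.
- by rewrite invr_ge0 ltW.
- by rewrite in_itv/= leey andbT lee_fin mulr_ge0 ?powR_ge0.
- by rewrite in_itv/= leey andbT integral_ge0// => x _; rewrite poweR_ge0.
have mn : measurable_fun setT (fun x => (`|normc (h x)| `^ q)%:E).
  apply/measurable_EFinP; apply: (measurableT_comp (measurable_powR _)).
  by apply: measurableT_comp => //; exact: measurable_normc.
rewrite EFinM -lB -integral_cst//.
apply: (@le_trans _ _ (\int[leb d]_(x in B) (`|normc (h x)| `^ q)%:E)%E); last first.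
  by apply: ge0_subset_integral => // x _; rewrite lee_fin powR_ge0.
apply: ge0_le_integral => //.
- by move=> x _; rewrite lee_fin powR_ge0.
- exact: measurable_funTS.
move=> x Bx /=; rewrite lee_fin ger0_norm ?normc_ge0//.
apply: ge0_ler_powR; rewrite ?nnegrE ?normc_ge0// ?(ltW q0)//; apply: hc => j.
have := Bx j; rewrite /A/= in_itv/= ler_pdivrMr// ler_pdivlMr// => /andP[b1 b2].
rewrite ler_norml; apply/andP; split; lra.
Qed.

End Lpnorm_bounds.

(** * One-dimensional wave packets and Fourier inversion *)

Section oscillatory.
Context {R : realType}.
Notation mu := (@lebesgue_measure R).
Implicit Types (u : nat -> R -> R[i]) (v w : R -> R[i]) (r a e x t : R).

(** A smooth compactly supported function on the line, given together with all its derivatives. With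
    the derivatives as data, new towers are defined by formulas, as in [tower_freq]. *)
Definition tower r u : Prop :=
  (forall k (t : R), is_cderive t 1 (u k) (u k.+1 t)) /\
  (forall k t, r < `|t| -> u k t = 0).

Lemma tower_ccontinuous r u k : tower r u -> ccontinuous (u k).
Proof. by move=> [du _]; exact: (is_cderive_continuous (du k)). Qed.

Lemma line_bounded r v : 0 <= r -> ccontinuous v -> (forall t, r < `|t| -> v t = 0) ->
  exists2 M : R, 0 <= M & forall t, normc (v t) <= M * ind r t.
Proof.
move=> r0 cv vr; have rr : - r <= r by rewrite ge0_cp.
have [c _ vc] := EVT_max rr (continuous_subspaceT (continuous_normc cv)).
exists (normc (v c)) => [|t]; first exact: normc_ge0.
rewrite indE; case: (lerP `|t| r) => [tr|/vr ->]; last by rewrite normc0 mulr0.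
by rewrite mulr1; apply: vc; rewrite in_itv/= -ler_norml.
Qed.

Lemma integrable_indM r (M : R) : mu.-integrable setT (EFin \o (fun t => M * ind r t)).
Proof. by have := integrableZl measurableT M (integrable_ind r). Qed.

(* [osc v a e] is the inverse Fourier transform of the rescaled bump
[s |-> v ((s - a) / e) / e], written without the change of variables, so that
bounds on it are visibly uniform in [a] and [e]. *)
Definition phase a e x t : R[i] := expi (2 * pi * x * (a + e * t)).

Definition osc v a e x : R[i] := cint mu (fun t => v t * phase a e x t).

(** The factor that differentiating [phase] in [x] brings down: [2 pi i] times the frequency
    [a + e * t]. *)
Definition freq a e t : R[i] := Complex 0 (2 * pi * (a + e * t)).

Lemma normc_phase a e x t : normc (phase a e x t) = 1.
Proof. exact: normc_expi. Qed.

Lemma is_cderive_phase_t a e x t :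
  is_cderive t 1 (phase a e x) (Complex 0 (2 * pi * x * e) * phase a e x t).
Proof.
have -> : phase a e x = fun t => expi ((2 * pi * x * e) * t + 2 * pi * x * a).
  by apply/funext => s; rewrite /phase; congr expi; ring.
exact: is_cderive_expi.
Qed.

Lemma is_cderive_phase_x a e x t :
  is_cderive x 1 (fun x => phase a e x t) (freq a e t * phase a e x t).
Proof.
have E y : phase a e y t = expi ((2 * pi * (a + e * t)) * y + 0).
  by rewrite /phase; congr expi; ring.
under eq_fun do rewrite E; rewrite E; exact: is_cderive_expi.
Qed.

Lemma ccontinuous_phase a e x : ccontinuous (phase a e x).
Proof. exact: is_cderive_continuous (is_cderive_phase_t a e x). Qed.

Lemma is_cderive_freq a e t : is_cderive t 1 (freq a e) (Complex 0 (2 * pi * e)).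
Proof.
split; first exact: is_derive_cst.
have H := is_deriveM (is_derive_cst (2 * pi) t 1)
  (is_deriveD (is_derive_cst a t 1) (is_deriveM (is_derive_cst e t 1) (is_derive_id t 1))).
by apply: (is_derive_eq H); rewrite /GRing.scale/= !mulr0 !addr0 add0r mulr1.
Qed.

Lemma ccontinuous_freq a e : ccontinuous (freq a e).
Proof. exact: is_cderive_continuous (is_cderive_freq a e). Qed.

Lemma integrable_osc r v a e x : 0 <= r -> ccontinuous v -> (forall t, r < `|t| -> v t = 0) ->
  cintegrable mu (fun t => v t * phase a e x t).
Proof.
move=> r0 cv vr; have [M M0 vM] := line_bounded r0 cv vr.
apply: (@le_cintegrable _ _ R mu _ (fun t => M * ind r t)).
- apply: ccontinuous_cmeasurable; exact: ccontinuousM cv (ccontinuous_phase a e x).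
- exact: integrable_indM.
- by move=> t; rewrite normcM normc_phase mulr1.
Qed.

Lemma is_cderive_osc r v a e x : 0 <= r -> ccontinuous v -> (forall t, r < `|t| -> v t = 0) ->
  is_cderive x 1 (osc v a e) (osc (fun t => freq a e t * v t) a e x).
Proof.
move=> r0 cv vr.
have cw : ccontinuous (fun t => freq a e t * v t).
  exact: ccontinuousM (ccontinuous_freq a e) cv.
have wr t : r < `|t| -> freq a e t * v t = 0 by move=> /vr ->; rewrite mulr0.
have [M M0 wM] := line_bounded r0 cw wr.
have dx t (y : R) : is_cderive y 1 (fun y => v t * phase a e y t)
    (freq a e t * v t * phase a e y t).
  apply: (is_cderive_eq (is_cderiveZ (v t) (is_cderive_phase_x a e y t))).
  by rewrite mulrCA mulrA.
have b t y : normc (freq a e t * v t * phase a e y t) <= M * ind r t.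
  by rewrite normcM normc_phase mulr1.
have Mi t : 0 <= M * ind r t by rewrite mulr_ge0 ?ind_ge0.
(* Any interval around [x] would do, as the majorant [M * ind r t] does not depend on the point. *)
have x01 : x \in `](x - 1), (x + 1)[ by rewrite in_itv/= ltrBlDr ltrDl ltr01.
split.
- pose f y t := cRe (v t * phase a e y t).
  have df t (y : R) : derivable (f ^~ t) y 1 by case: (dx t y).1.
  have d1f t y : partial1of2 f y t = cRe (freq a e t * v t * phase a e y t).
    by rewrite partial1of2E; case: (dx t y).1.
  have fi y : mu.-integrable setT (EFin \o f y).
    exact: cintegrable_Re (integrable_osc a e y r0 cv vr).
  have fb y t : `](x - 1), (x + 1)[%classic y -> setT t ->
      `|partial1of2 f y t| <= M * ind r t.
    by move=> _ _; rewrite d1f (le_trans (ler_Re _)).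
  split.
  + exact: (derivable_under_integral measurableT x01 (fun y _ => fi y)
      (fun y t _ _ => df t y) Mi (integrable_indM r M) fb).
  + rewrite -derive1E (differentiation_under_integral measurableT x01 (fun y _ => fi y)
      (fun y t _ _ => df t y) Mi (integrable_indM r M) fb).
    by apply: eq_Rintegral => t _; rewrite d1f.
- pose f y t := cIm (v t * phase a e y t).
  have df t (y : R) : derivable (f ^~ t) y 1 by case: (dx t y).2.
  have d1f t y : partial1of2 f y t = cIm (freq a e t * v t * phase a e y t).
    by rewrite partial1of2E; case: (dx t y).2.
  have fi y : mu.-integrable setT (EFin \o f y).
    exact: cintegrable_Im (integrable_osc a e y r0 cv vr).
  have fb y t : `](x - 1), (x + 1)[%classic y -> setT t ->
      `|partial1of2 f y t| <= M * ind r t.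
    by move=> _ _; rewrite d1f (le_trans (ler_Im _)).
  split.
  + exact: (derivable_under_integral measurableT x01 (fun y _ => fi y)
      (fun y t _ _ => df t y) Mi (integrable_indM r M) fb).
  + rewrite -derive1E (differentiation_under_integral measurableT x01 (fun y _ => fi y)
      (fun y t _ _ => df t y) Mi (integrable_indM r M) fb).
    by apply: eq_Rintegral => t _; rewrite d1f.
Qed.

(** Integration by parts in [t]. The factor that comes out is a multiple of [x * e] rather than of
    [x], which is why decay is measured in the variable [e * x]. *)
Lemma osc_partial r v w a e x : 0 < r -> ccontinuous w ->
  (forall t : R, is_cderive t 1 v (w t)) ->
  (forall t, r < `|t| -> v t = 0) -> (forall t, r < `|t| -> w t = 0) ->
  Complex 0 (2 * pi * x * e) * osc v a e x = - osc w a e x.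
Proof.
move=> r0 cw vw vr wr; apply/eqP; rewrite -addr_eq0 addrC; apply/eqP.
have cv : ccontinuous v := is_cderive_continuous vw.
have iv := integrable_osc a e x (ltW r0) cv vr.
have iw := integrable_osc a e x (ltW r0) cw wr.
have r2 : r < 2 * r by rewrite ltr_pMl// ltr1n.
have r20 : 0 < 2 * r by rewrite mulr_gt0.
rewrite /osc -cintZ// -cintD//; last exact: cintegrableZ.
rewrite (@cint_derive_supp _ (fun t => v t * phase a e x t) _ (2 * r))//.
- by rewrite !vr ?mul0r ?subrr// ?normrN gtr0_norm.
- apply: ccontinuousD; first exact: ccontinuousM cw (ccontinuous_phase a e x).
  apply: ccontinuousM; first exact: ccontinuous_cst.
  exact: ccontinuousM cv (ccontinuous_phase a e x).
- move=> t; apply: (is_cderive_eq (is_cderiveM (vw t) (is_cderive_phase_t a e x t))).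
  by congr (_ + _); rewrite mulrCA.
- by move=> t /(lt_trans r2) rt; rewrite vr// wr// !mul0r mulr0 addr0.
Qed.

Lemma normc_osc_tower r u a e x m : 0 < r -> tower r u ->
  `|2 * pi * x * e| ^+ m * normc (osc (u 0) a e x) = normc (osc (u m) a e x).
Proof.
move=> r0 tu; have [du ur] := tu; elim: m => [|m IH]; first by rewrite expr0 mul1r.
rewrite exprS -mulrA IH -normc_Complex0 -normcM.
rewrite (osc_partial a e x r0 (tower_ccontinuous m.+1 tu) (du m) (ur m) (ur m.+1)).
by rewrite normcN.
Qed.

Lemma osc_bounded r v : 0 <= r -> ccontinuous v -> (forall t, r < `|t| -> v t = 0) ->
  exists2 C : R, 0 <= C & forall a e x, normc (osc v a e x) <= C.
Proof.
move=> r0 cv vr; have [M M0 vM] := line_bounded r0 cv vr.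
exists (2 * \int[mu]_t (M * ind r t)).
  by rewrite mulr_ge0// Rintegral_ge0// => t _; rewrite mulr_ge0 ?ind_ge0.
move=> a e x; apply: normc_cint_le.
- apply: ccontinuous_cmeasurable; exact: ccontinuousM cv (ccontinuous_phase a e x).
- exact: integrable_indM.
- by move=> t; rewrite normcM normc_phase mulr1.
Qed.

(** Obtained from [2 * m] integrations by parts. The constant is uniform in [a] and [e] because
    [osc_bounded] uses only that the phase has modulus 1. *)
Lemma osc_decay r u m : 0 < r -> tower r u ->
  exists2 C : R, 0 <= C &
    forall a e x, normc (osc (u 0) a e x) <= C * weight e 0 x ^+ m.
Proof.
move=> r0 tu; have [du ur] := tu.
have [C0 C00 HC0] := osc_bounded (ltW r0) (tower_ccontinuous 0 tu) (ur 0).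
have [C1 C10 HC1] := osc_bounded (ltW r0) (tower_ccontinuous (2 * m) tu) (ur (2 * m)%N).
exists (2 ^+ m * (C0 + C1)); first by rewrite mulr_ge0 ?exprn_ge0// addr_ge0.
move=> a e x; rewrite /weight subr0 exprVn ler_pdivlMr ?exprn_gt0 ?oneDsqr_gt0//.
rewrite (le_trans (ler_wpM2l (normc_ge0 _) (oneDsqr_exp_le m _)))//.
rewrite mulrCA ler_wpM2l ?exprn_ge0// mulrDr mulr1 lerD//.
rewrite (le_trans _ (HC1 a e x))// -(normc_osc_tower a e x (2 * m) r0 tu) mulrC.
rewrite ler_wpM2r ?normc_ge0// lerXn2r ?nnegrE// -[2 * pi * x * e]mulrA [leRHS]normrM.
rewrite [x * e]mulrC ler_peMl// ger0_norm ?mulr_ge0 ?pi_ge0//.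
have := @pi_ge2 R; lra.
Qed.

(** Leibniz's rule for the product with an affine function, whose second derivative vanishes. At
    [k = 0] the coefficient [k%:R] cancels the spurious term [u k.-1], which is then [u 0]. *)
Lemma tower_freq r u a e : tower r u ->
  tower r (fun k t => freq a e t * u k t + k%:R * Complex 0 (2 * pi * e) * u k.-1 t).
Proof.
move=> [du ur]; split => [k t|k t rt]; last by rewrite !ur// !mulr0 addr0.
set z := Complex 0 _.
have [c1 c2] := is_cderiveM (is_cderive_freq a e t) (du k t).
have [c3 c4] : is_cderive t 1 (fun t => k%:R * z * u k.-1 t) (k%:R * z * u k t).
  case: k {c1 c2} => [|k]; last exact: is_cderiveZ.
  have -> : (fun t => 0%:R * z * u 0.-1 t) = fun=> 0 by apply/funext => s; rewrite !mul0r.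
  by rewrite !mul0r; exact: is_cderive_cst.
have E : z * u k t + freq a e t * u k.+1 t + k%:R * z * u k t =
    freq a e t * u k.+1 t + k.+1%:R * z * u k t.
  by rewrite -natr1; ring.
split.
- under eq_fun do rewrite ReD.
  by apply: (is_derive_eq (is_deriveD c1 c3)); rewrite -ReD E.
- under eq_fun do rewrite ImD.
  by apply: (is_derive_eq (is_deriveD c2 c4)); rewrite -ImD E.
Qed.

End oscillatory.

(** * Improper integrals over half-lines *)

Section rays.
Context {R : realType}.
Notation mu := (@lebesgue_measure R).
Implicit Types f g F : R -> R.

(** Dominated convergence along the compact intervals [[lo n, hi n]], with the modulus of [f] as
    majorant; [A] will be an open half-line. *)
Lemma Rintegral_exhaust f F (A : set R) (lo hi : nat -> R) (l : R) :
  measurable A -> continuous f -> (forall t : R, is_derive t 1 F (f t)) ->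
  mu.-integrable A (EFin \o f) ->
  (forall n, lo n < hi n) -> (forall n, `[lo n, hi n] `<=` A) ->
  (forall t, A t -> \forall n \near \oo, t \in `[lo n, hi n]) ->
  (F (hi n) - F (lo n)) @[n --> \oo] --> l ->
  \int[mu]_(t in A) f t = l.
Proof.
move=> mA cf Ff fA lohi subA covA Fl.
have mf : measurable_fun setT f by exact: continuous_measurable_fun.
have mf' : measurable_fun A (EFin \o f) by apply/measurable_EFinP; exact: (measurable_funTS mf).
pose f_ n : R -> \bar R := EFin \o (f \_ `[lo n, hi n]).
have mf_ n : measurable_fun A (f_ n).
  apply/measurable_EFinP; apply: measurable_funTS.
  by apply/(measurable_restrictT _ _).1 => //; exact: (measurable_funTS mf).
have f_f : \forall t \ae mu, A t -> f_ n t @[n --> \oo] --> (f t)%:E.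
  apply/aeW => t At; apply: cvg_near_cst; apply: filterS (covA t At) => n tn.
  by rewrite /f_ /= patchE mem_setE tn.
have f_b : \forall t \ae mu, forall n, A t -> (`|f_ n t| <= `|(f t)%:E|)%E.
  apply/aeW => t n At; rewrite /f_ /= patchE; case: ifPn => // _.
  by rewrite normr0 lee_fin.
have [_ _] := @dominated_convergence _ _ R mu A mA f_ (EFin \o f) _ mf_ mf' f_f
  (integrable_abse fA) f_b.
have E n : (\int[mu]_(t in A) f_ n t = (F (hi n) - F (lo n))%:E)%E.
  rewrite -(Rintegral_derive (lohi n) cf Ff) /Rintegral fineK; last first.
    apply: integrable_fin_num => //; apply: continuous_compact_integrable => //.
      exact: segment_compact.
    exact: continuous_subspaceT.
  by rewrite /f_ -restrict_EFin -integral_mkcondr setIidr.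
under eq_fun do rewrite E.
move=> cv; have {}cv := cvg_unique _ cv (cvg_EFin _ Fl).
rewrite /Rintegral cv//.
by apply: nearW.
Qed.

(** Meant for integrands with a corner or a jump at [c]: on each side [g] agrees with a continuous
    function that has a primitive on the whole line, and the value at [c] is immaterial. *)
Lemma Rintegral_two_rays g g1 g2 F1 F2 (c : R) :
  mu.-integrable setT (EFin \o g) -> continuous g1 -> continuous g2 ->
  (forall t : R, is_derive t 1 F1 (g1 t)) -> (forall t : R, is_derive t 1 F2 (g2 t)) ->
  (forall t, c < t -> g t = g1 t) -> (forall t, t < c -> g t = g2 t) ->
  F1 (c + n.+1%:R) @[n --> \oo] --> (0 : R) ->
  F2 (c - n.+1%:R) @[n --> \oo] --> (0 : R) ->
  \int[mu]_t g t = F2 c - F1 c.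
Proof.
move=> ig c1 c2 dF1 dF2 E1 E2 l1 l2.
have mg : measurable_fun setT g by apply/measurable_EFinP; case/integrableP : ig.
have TE : [set: R] = `]-oo, c[%classic `|` `[c, +oo[%classic.
  by apply/seteqP; split => // t _ /=; rewrite !in_itv/= andbT; case: (ltP t c); [left|right].
have cF1 : continuous F1 := is_derive_continuous dF1.
have cF2 : continuous F2 := is_derive_continuous dF2.
(* The endpoint near [c] is at distance [1 / (n + 2)]: with [1 / (n + 1)] the two endpoints would
   coincide at [n = 0]. *)
have n1 (n : nat) : n.+2%:R^-1 < n.+1%:R :> R.
  by rewrite (@lt_le_trans _ _ 1)// ?invf_lt1 ?ltr1n ?ler1n.
have inv0 : (n.+2%:R^-1 : R) @[n --> \oo] --> (0 : R).
  by rewrite (@cvg_shiftS _ (fun n : nat => n.+1%:R^-1 : R)); exact: cvg_harmonic.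
rewrite {1}TE Rintegral_setU//; last 2 first.
- by rewrite -TE.
- rewrite disj_set2E; apply/eqP/seteqP; split => // t /=; rewrite !in_itv/= andbT.
  by move=> [tc ct]; have := lt_le_trans tc ct; rewrite ltxx.
congr (_ + _).
  transitivity (\int[mu]_(t in `]-oo, c[) g2 t).
    by apply: eq_Rintegral => t; rewrite inE/= in_itv/= => tc; exact: E2.
  apply: (@Rintegral_exhaust _ F2 _ (fun n => c - n.+1%:R) (fun n => c - n.+2%:R^-1)) => //.
  - apply: (@eq_integrable _ _ R mu _ _ (EFin \o g)) => //; last exact: integrableS ig.
    by move=> t; rewrite inE/= in_itv/= => tc; rewrite /= E2.
  - by move=> n; rewrite ltrD2l ltrN2.
  - move=> n t /=; rewrite !in_itv/= => /andP[_ tn]; rewrite (le_lt_trans tn)//.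
    by rewrite gtrDl oppr_lt0 invr_gt0.
  - move=> t /=; rewrite in_itv/= => tc; near=> n; rewrite in_itv/=; apply/andP; split.
      rewrite lerBlDr -lerBlDl ltW// (lt_trans _ (_ : n%:R < _)) ?ltr_nat//.
      near: n; exact: nbhs_infty_gtr.
    rewrite lerBrDr -lerBrDl ltW//; near: n; apply: (cvgr_lt _ inv0).
    by rewrite subr_gt0.
  - rewrite -[F2 c]subr0; apply: cvgB => //.
    apply: (cvg_comp (fun n : nat => c - n.+2%:R^-1) F2 _ (cF2 c)).
    suff : (c - n.+2%:R^-1) @[n --> \oo] --> c - 0 by rewrite subr0.
    by apply: cvgB => //; exact: cvg_cst.
rewrite -Rintegral_itv_obnd_cbnd; last exact: integrableS ig.
transitivity (\int[mu]_(t in `]c, +oo[) g1 t).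
  by apply: eq_Rintegral => t; rewrite inE/= in_itv/= andbT => tc; exact: E1.
apply: (@Rintegral_exhaust _ F1 _ (fun n => c + n.+2%:R^-1) (fun n => c + n.+1%:R)) => //.
- apply: (@eq_integrable _ _ R mu _ _ (EFin \o g)) => //; last exact: integrableS ig.
  by move=> t; rewrite inE/= in_itv/= andbT => tc; rewrite /= E1.
- by move=> n; rewrite ltrD2l.
- move=> n t /=; rewrite !in_itv/= andbT => /andP[tn _]; rewrite (lt_le_trans _ tn)//.
  by rewrite ltrDl invr_gt0.
- move=> t /=; rewrite in_itv/= andbT => tc; near=> n; rewrite in_itv/=; apply/andP; split.
    rewrite -lerBrDl ltW//; near: n; apply: (cvgr_lt _ inv0).
    by rewrite subr_gt0.
  rewrite -lerBlDl ltW// (lt_trans _ (_ : n%:R < _)) ?ltr_nat//.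
  near: n; exact: nbhs_infty_gtr.
- rewrite -sub0r; apply: cvgB => //.
  apply: (cvg_comp (fun n : nat => c + n.+2%:R^-1) F1 _ (cF1 c)).
  suff : (c + n.+2%:R^-1) @[n --> \oo] --> c + 0 by rewrite addr0.
  by apply: cvgD => //; exact: cvg_cst.
Unshelve. all: by end_near. Qed.

End rays.

Section dominated.
Context d {T : measurableType d} {R : realType} (mu : {measure set T -> \bar R}).

Definition ccvg (z_ : nat -> R[i]) (z : R[i]) : Prop :=
  (cRe (z_ n) @[n --> \oo] --> cRe z) /\ (cIm (z_ n) @[n --> \oo] --> cIm z).

Lemma ccvg_uniq z_ z w : ccvg z_ z -> ccvg z_ w -> z = w.
Proof.
move=> [z1 z2] [w1 w2]; apply: complex_ext.
- exact: cvg_unique _ z1 w1.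
- exact: cvg_unique _ z2 w2.
Qed.

Lemma Rintegral_dominated (f_ : nat -> T -> R) (f g : T -> R) :
  (forall n, measurable_fun setT (f_ n)) -> measurable_fun setT f ->
  (forall x, f_ n x @[n --> \oo] --> f x) -> mu.-integrable setT (EFin \o g) ->
  (forall n x, `|f_ n x| <= g x) ->
  (\int[mu]_x f_ n x) @[n --> \oo] --> \int[mu]_x f x.
Proof.
move=> mf_ mf f_f ig fg.
have ae1 : \forall x \ae mu, setT x -> (f_ n x)%:E @[n --> \oo] --> (f x)%:E.
  by apply/aeW => x _; apply: cvg_EFin; [exact: nearW|exact: f_f].
have ae2 : \forall x \ae mu, forall n, setT x -> (`|(f_ n x)%:E| <= (EFin \o g) x)%E.
  by apply/aeW => x n _ /=; rewrite lee_fin.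
have [fi _ cv] := @dominated_convergence _ _ R mu setT measurableT
  (fun n => EFin \o f_ n) (EFin \o f) _ (fun n => (measurable_EFinP _ _).2 (mf_ n))
  ((measurable_EFinP _ _).2 mf) ae1 ig ae2.
apply: fine_cvg; rewrite fineK//; exact: integrable_fin_num.
Qed.

Lemma cint_dominated (f_ : nat -> T -> R[i]) (f : T -> R[i]) (g : T -> R) :
  (forall n, cmeasurable (f_ n)) -> cmeasurable f ->
  (forall x, ccvg (f_ ^~ x) (f x)) -> mu.-integrable setT (EFin \o g) ->
  (forall n x, normc (f_ n x) <= g x) ->
  ccvg (fun n => cint mu (f_ n)) (cint mu f).
Proof.
move=> mf_ mf f_f ig fg; split => /=.
- apply: (Rintegral_dominated _ _ _ ig).
  + by move=> n; case: (mf_ n).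
  + by case: mf.
  + by move=> x; case: (f_f x).
  + by move=> n x; rewrite (le_trans (ler_Re _)).
- apply: (Rintegral_dominated _ _ _ ig).
  + by move=> n; case: (mf_ n).
  + by case: mf.
  + by move=> x; case: (f_f x).
  + by move=> n x; rewrite (le_trans (ler_Im _)).
Qed.

End dominated.

(** * The Fourier transform of the Abel factor *)

Section inversion.
Context {R : realType}.
Notation mu := (@lebesgue_measure R).
Implicit Types (g v w : R -> R[i]) (tau b : R).

Lemma cint_two_rays g g1 g2 v1 v2 (c : R) :
  cintegrable mu g -> ccontinuous g1 -> ccontinuous g2 ->
  (forall t : R, is_cderive t 1 v1 (g1 t)) -> (forall t : R, is_cderive t 1 v2 (g2 t)) ->
  (forall t, c < t -> g t = g1 t) -> (forall t, t < c -> g t = g2 t) ->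
  ccvg (fun n => v1 (c + n.+1%:R)) 0 -> ccvg (fun n => v2 (c - n.+1%:R)) 0 ->
  cint mu g = v2 c - v1 c.
Proof.
move=> ig [c11 c12] [c21 c22] d1 d2 E1 E2 [l11 l12] [l21 l22].
apply: complex_ext; rewrite ?ReD ?ImD ?ReN ?ImN /=.
- apply: (@Rintegral_two_rays _ (fun t => cRe (g t)) (fun t => cRe (g1 t))
    (fun t => cRe (g2 t)) (fun t => cRe (v1 t)) (fun t => cRe (v2 t))) => //.
  + exact: cintegrable_Re.
  + by move=> t; case: (d1 t).
  + by move=> t; case: (d2 t).
  + by move=> t /E1 ->.
  + by move=> t /E2 ->.
- apply: (@Rintegral_two_rays _ (fun t => cIm (g t)) (fun t => cIm (g1 t))
    (fun t => cIm (g2 t)) (fun t => cIm (v1 t)) (fun t => cIm (v2 t))) => //.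
  + exact: cintegrable_Im.
  + by move=> t; case: (d1 t).
  + by move=> t; case: (d2 t).
  + by move=> t /E1 ->.
  + by move=> t /E2 ->.
Qed.

Lemma ccvg0_bound (z_ : nat -> R[i]) (K : R) :
  (forall n, normc (z_ n) <= K * n.+1%:R^-1) -> ccvg z_ 0.
Proof.
move=> zK; have K0 : (K * n.+1%:R^-1 : R) @[n --> \oo] --> (0 : R).
  suff : (K * n.+1%:R^-1 : R) @[n --> \oo] --> (K * 0 : R) by rewrite mulr0.
  by apply: cvgM; [exact: cvg_cst|exact: cvg_harmonic].
split => /=.
- apply/cvgr0Pnorm_le => e e0; move/cvgr0Pnorm_le : K0 => /(_ e e0).
  apply: filterS => n; apply: le_trans; rewrite (le_trans (ler_Re _))//.
  by rewrite (le_trans (zK n))// ler_norm.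
- apply/cvgr0Pnorm_le => e e0; move/cvgr0Pnorm_le : K0 => /(_ e e0).
  apply: filterS => n; apply: le_trans; rewrite (le_trans (ler_Im _))//.
  by rewrite (le_trans (zK n))// ler_norm.
Qed.

(** The complex exponential of [(s + i b) t]. *)
Definition damped (s b t : R) : R[i] := Complex (expR (s * t)) 0 * expi (b * t).

Lemma is_cderive_damped (s b t : R) :
  is_cderive t 1 (damped s b) (Complex s b * damped s b t).
Proof.
have dl : is_derive t 1 (fun x : R => s * x) s.
  have H := is_deriveM (is_derive_cst s t 1) (is_derive_id t 1).
  by apply: (is_derive_eq H); rewrite /GRing.scale/= mulr0 addr0 mulr1.
have d1 : is_cderive t 1 (fun x : R => Complex (expR (s * x)) 0)
    (Complex (s * expR (s * t)) 0).
  split; last exact: is_derive_cst.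
  have H := @is_derive1_comp _ (@expR R) (fun x => s * x) t _ _ (is_derive_expR (s * t)) dl.
  by apply: (is_derive_eq H); rewrite mulrC.
have := is_cderive_expi b 0 t; rewrite addr0.
under eq_fun do rewrite addr0.
move=> d2; apply: (is_cderive_eq (is_cderiveM d1 d2)).
by apply: complex_ext; rewrite /damped ?ReD ?ImD ?ReM ?ImM /=; ring.
Qed.

Lemma normc_damped s b t : normc (damped s b t) = expR (s * t).
Proof. by rewrite normcM normc_expi mulr1 normc_real ger0_norm ?expR_ge0. Qed.

Lemma expR_le_inv (y : R) : 0 < y -> expR (- y) <= y^-1.
Proof.
move=> y0; rewrite expRN lef_pV2 ?posrE ?expR_gt0//.
by rewrite (le_trans _ (expR_ge1Dx _))// lerDr.
Qed.

(** With [y = tau * |t|], this follows by squaring [1 + y / 2 <= expR (y / 2)]. It reduces the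
    integrability of [abel] to that of the weight. *)
Lemma expR_le_weight tau (t : R) : 0 <= tau -> expR (- (tau * `|t|)) <= 4 * weight tau 0 t.
Proof.
move=> t0; rewrite /weight subr0; have y0 : 0 <= tau * `|t| by rewrite mulr_ge0.
have -> : oneDsqr (tau * t) = 1 + (tau * `|t|) ^+ 2.
  by rewrite /oneDsqr !exprMn real_normK ?num_real.
move: (tau * `|t|) y0 => y y0.
have q0 : 0 < 1 + y ^+ 2 by rewrite ltr_pwDl ?sqr_ge0.
rewrite expRN ler_pdivlMr// mulrC ler_pdivrMr ?expR_gt0//.
have -> : expR y = expR (y / 2) ^+ 2 by rewrite -expRM_natl; congr expR; field.
have h : (1 + y / 2) ^+ 2 <= expR (y / 2) ^+ 2.
  by rewrite lerXn2r ?nnegrE ?expR_ge0 ?expR_ge1Dx// addr_ge0// divr_ge0.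
apply: (@le_trans _ _ (4 * (1 + y / 2) ^+ 2)); last by rewrite ler_pM2l.
nra.
Qed.

Definition abel tau (t : R) : R := expR (- (tau * `|t|)).

Lemma continuous_abel tau : continuous (abel tau).
Proof.
move=> t; apply: (continuous_comp (f := fun t : R => - (tau * `|t|)) (g := @expR R)).
  apply: cvgN; apply: cvgM; [exact: cvg_cst|exact: norm_continuous].
exact: continuous_expR.
Qed.

Lemma integrable_abel tau : 0 < tau -> mu.-integrable setT (EFin \o abel tau).
Proof.
move=> t0; have iw := integrableZl measurableT (4 : R) (integrable_weight 0 t0).
apply: le_integrable iw => //.
  by apply/measurable_EFinP; apply: continuous_measurable_fun; exact: continuous_abel.
move=> t _ /=; rewrite lee_fin ger0_norm ?expR_ge0// (le_trans (expR_le_weight _ (ltW t0)))//.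
by rewrite ler_norm.
Qed.

(** On each half-line the integrand is a complex exponential with an explicit primitive; the
    boundary terms at 0 add up to [1 / (tau + i b) + 1 / (tau - i b)]. *)
Lemma cint_abel tau b : 0 < tau ->
  cint mu (fun t => Complex (abel tau t) 0 * expi (b * t)) =
  Complex (2 * tau / (tau ^+ 2 + b ^+ 2)) 0.
Proof.
move=> t0; have n0 : tau ^+ 2 + b ^+ 2 != 0.
  by rewrite gt_eqF// ltr_wpDr ?sqr_ge0// exprn_gt0.
have c1 : Complex (- tau) b != 0 by rewrite eq_complex /= oppr_eq0 gt_eqF.
have c2 : Complex tau b != 0 by rewrite eq_complex /= gt_eqF.
have ig : cintegrable mu (fun t => Complex (abel tau t) 0 * expi (b * t)).
  apply: (@le_cintegrable _ _ R mu _ (abel tau)).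
  - apply: ccontinuous_cmeasurable; apply: ccontinuousM.
      split => t; [exact: continuous_abel|exact: cst_continuous].
    apply: ccontinuous_expi; apply: continuous_mul => t; [exact: cst_continuous|exact: cvg_id].
  - exact: integrable_abel.
  - by move=> t; rewrite normcM normc_expi mulr1 normc_real ger0_norm ?expR_ge0.
rewrite (@cint_two_rays _ (damped (- tau) b) (damped tau b)
   (fun t => (Complex (- tau) b)^-1 * damped (- tau) b t)
   (fun t => (Complex tau b)^-1 * damped tau b t) 0 ig).
- rewrite /damped !mulr0 expR0 expi0 !mulr1.
  by apply: complex_ext; rewrite ?ReD ?ImD ?ReN ?ImN /= ?sqrrN; field.
- by apply: is_cderive_continuous => t; exact: is_cderive_damped.
- by apply: is_cderive_continuous => t; exact: is_cderive_damped.
- move=> t; apply: (is_cderive_eq (is_cderiveZ _ (is_cderive_damped _ _ _))).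
  by rewrite mulKf.
- move=> t; apply: (is_cderive_eq (is_cderiveZ _ (is_cderive_damped _ _ _))).
  by rewrite mulKf.
- by move=> t tp; rewrite /abel /damped gtr0_norm// mulNr.
- by move=> t tn; rewrite /abel /damped ltr0_norm// mulrN opprK.
- apply: (@ccvg0_bound _ (normc (Complex (- tau) b)^-1 * tau^-1)) => n.
  rewrite normcM normc_damped -mulrA ler_wpM2l ?normc_ge0// add0r mulNr.
  by rewrite -invfM expR_le_inv// mulr_gt0.
- apply: (@ccvg0_bound _ (normc (Complex tau b)^-1 * tau^-1)) => n.
  rewrite normcM normc_damped -mulrA ler_wpM2l ?normc_ge0// sub0r mulrN.
  by rewrite -invfM expR_le_inv// mulr_gt0.
Qed.

End inversion.

Lemma ccvg_mul_real {R : realType} (z : R[i]) (l_ : nat -> R) (l : R) :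
  l_ n @[n --> \oo] --> l -> ccvg (fun n => z * Complex (l_ n) 0) (z * Complex l 0).
Proof.
move=> ll; split.
- rewrite ReM /= mulr0 subr0; under eq_fun do rewrite ReM /= mulr0 subr0.
  by apply: cvgM => //; exact: cvg_cst.
- rewrite ImM /= mulr0 add0r; under eq_fun do rewrite ImM /= mulr0 add0r.
  by apply: cvgM => //; exact: cvg_cst.
Qed.

Lemma ccvg_near0 {R : realType} (z_ : nat -> R[i]) :
  (\forall n \near \oo, z_ n = 0) -> ccvg z_ 0.
Proof.
by move=> z0; split; apply: cvg_near_cst; apply: filterS z0 => n ->.
Qed.

(** * Fourier inversion for oscillatory integrals *)

Section osc_inversion.
Context {R : realType}.
Notation mu := (@lebesgue_measure R).
Variables (r : R) (u : nat -> R -> R[i]) (a e : R).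
Hypotheses (r0 : 0 < r) (tu : tower r u) (e0 : 0 < e).

Lemma cmeasurable_osc (v : R -> R[i]) : ccontinuous v ->
  (forall t, r < `|t| -> v t = 0) -> cmeasurable (osc v a e).
Proof.
move=> cv vr; apply: ccontinuous_cmeasurable.
by apply: is_cderive_continuous => x; exact: (is_cderive_osc a e x (ltW r0) cv vr).
Qed.

Lemma cintegrable_osc : cintegrable mu (osc (u 0) a e).
Proof.
have [C C0 HC] := osc_decay 1 r0 tu.
apply: (@le_cintegrable _ _ R mu _ (fun x => C * weight e 0 x)).
- by apply: cmeasurable_osc; [exact: tower_ccontinuous tu|exact: tu.2].
- by have := integrableZl measurableT C (integrable_weight 0 e0).
- by move=> x; have := HC a e x; rewrite expr1.
Qed.

(* [A tau] is a primitive of the Poisson kernel [P tau], the Fourier transform of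
[abel tau]; as [tau] tends to 0 it tends to the jump function [S]. *)
Let A (tau s : R) : R := (pi * e)^-1 * atan ((2 * pi * e / tau) * s).

Let P (tau s : R) : R := 2 * tau / (tau ^+ 2 + (2 * pi * e * s) ^+ 2).

Let is_derive_A tau z (s : R) : 0 < tau ->
  is_derive s 1 (fun s => A tau (s - z)) (P tau (s - z)).
Proof.
move=> t0; have pi0 : pi != 0 :> R by rewrite gt_eqF ?pi_gt0.
have H := is_deriveM (is_derive_cst (pi * e)^-1 s 1)
  (@is_derive1_comp _ (@atan R) (fun s => (2 * pi * e / tau) * (s - z)) s _ _
    (is_derive1_atan _) (derive_affine (2 * pi * e / tau) z s)).
apply: (is_derive_eq H); rewrite /GRing.scale/= mulr0 addr0 /P.
have q0 : tau ^+ 2 + (2 * pi * e * (s - z)) ^+ 2 != 0.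
  by rewrite gt_eqF// ltr_wpDr ?sqr_ge0// exprn_gt0.
have t1 : tau != 0 by rewrite gt_eqF.
have e1 : e != 0 by rewrite gt_eqF.
by clear H; move: pi pi0 q0 => p p0 q0; field; rewrite q0 t1 e1 p0.
Qed.

Let continuous_P tau z : 0 < tau -> continuous (fun s => P tau (s - z)).
Proof.
move=> t0; apply: continuous_mul; first by move=> s; exact: cst_continuous.
move=> s; apply: cvgV; first by rewrite gt_eqF// ltr_wpDr ?sqr_ge0// exprn_gt0.
apply: cvgD; first exact: cvg_cst.
apply: cvgM; exact: (is_derive_continuous (derive_affine (2 * pi * e) z)).
Qed.

Let half_inv : (2 * e)^-1 = (pi * e)^-1 * (pi / 2) :> R.
Proof.
have e1 : e != 0 by rewrite gt_eqF.
have pi0 : pi != 0 :> R by rewrite gt_eqF ?pi_gt0.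
by move: pi pi0 => p p0; field; rewrite e1 p0.
Qed.

Let A_bounded tau s : `|A tau s| <= (2 * e)^-1.
Proof.
rewrite /A normrM gtr0_norm ?invr_gt0 ?mulr_gt0 ?pi_gt0//.
rewrite half_inv.
apply: ler_wpM2l; first by rewrite invr_ge0 mulr_ge0 ?pi_ge0// ltW.
by rewrite ler_norml (ltW (atan_gtNpi2 _)) (ltW (atan_ltpi2 _)).
Qed.

Let S (s : R) : R := (2 * e)^-1 * Num.sg s.

Let A_cvg (s : R) : A n.+1%:R^-1 s @[n --> \oo] --> S s.
Proof.
have pos (t : R) : 0 < t -> A n.+1%:R^-1 t @[n --> \oo] --> S t.
  move=> t0; rewrite /S gtr0_sg// mulr1.
  rewrite half_inv.
  apply: cvgM; first exact: cvg_cst.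
  apply: (cvg_comp (fun n : nat => 2 * pi * e / n.+1%:R^-1 * t) (@atan R) _ (@cvgy_atan R)).
  apply/cvgryPge => B; near=> n.
  have k0 : 0 < 2 * pi * e * t by rewrite !mulr_gt0 ?pi_gt0.
  rewrite invrK mulrAC -ler_pdivrMl// ltW// (lt_trans _ (_ : n%:R < _)) ?ltr_nat//.
  by near: n; exact: nbhs_infty_gtr.
have [s0|s0|<-] := ltgtP 0 s; first exact: pos.
- have -> : S s = - S (- s) by rewrite /S sgrN mulrN opprK.
  rewrite (_ : (fun n => A n.+1%:R^-1 s) = (fun n => - A n.+1%:R^-1 (- s))).
    by apply: cvgN; apply: pos; rewrite oppr_gt0.
  by apply/funext => n; rewrite /A mulrN atanN mulrN opprK.
- rewrite /S sgr0 mulr0 (_ : (fun n => _) = fun=> 0); first exact: cvg_cst.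
  by apply/funext => n; rewrite /A mulr0 atan0 mulr0.
Unshelve. all: by end_near. Qed.

(** After Fubini the integral in [x] is the Poisson kernel at [t - z]. These kernels have no common
    integrable majorant as [tau] tends to 0, but their primitives [A] are uniformly bounded; an
    integration by parts in [t] therefore prepares the limit for dominated convergence. *)
Let abel_osc (tau z : R) : 0 < tau ->
  cint mu (fun x => osc (u 0) a e x * expi (- (2 * pi * x * (a + e * z))) *
      Complex (abel tau x) 0) =
  - cint mu (fun t => u 1 t * Complex (A tau (t - z)) 0).
Proof.
move=> t0; have [du ur] := tu.
have c0 : ccontinuous (u 0) := tower_ccontinuous 0 tu.
have c1 : ccontinuous (u 1) := tower_ccontinuous 1 tu.
have [M M0 uM] := line_bounded (ltW r0) c0 (ur 0).
pose F (y : R * R) : R[i] :=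
  u 0 y.2 * (Complex (abel tau y.1) 0 * expi ((2 * pi * e * (y.2 - z)) * y.1)).
have mF : cmeasurable F.
  have mu0 := ccontinuous_cmeasurable c0.
  apply: cmeasurableM.
    by split; [exact: (measurableT_comp mu0.1 measurable_snd)|
      exact: (measurableT_comp mu0.2 measurable_snd)].
  apply: cmeasurableM.
    apply: cmeasurable_real.
    exact: (measurableT_comp (continuous_measurable_fun (@continuous_abel R tau)) measurable_fst).
  apply: cmeasurable_expi; apply: measurable_funM => //.
  by apply: measurable_funM => //; apply: measurable_funB.
have FM x t : normc (F (x, t)) <= abel tau x * (M * ind r t).
  rewrite /F !normcM normc_expi mulr1 normc_real ger0_norm ?expR_ge0// mulrC.
  by rewrite ler_wpM2l ?expR_ge0.
have L : cint mu (fun x => osc (u 0) a e x * expi (- (2 * pi * x * (a + e * z))) *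
      Complex (abel tau x) 0) = cint mu (fun x => cint mu (fun t => F (x, t))).
  apply: eq_cint => x; rewrite -mulrA mulrC /osc -cintZ; last first.
    exact: (integrable_osc a e x (ltW r0) c0 (ur 0)).
  apply: eq_cint => t; rewrite /F /phase mulrCA; congr (_ * _).
  rewrite mulrAC [RHS]mulrC -expiD /=; congr (expi _ * _); ring.
rewrite L (@cint_Fubini _ _ _ _ R mu mu F _ _ mF (integrable_abel t0) (integrable_indM r M) FM).
have E : cint mu (fun t => cint mu (fun x => F (x, t))) =
    cint mu (fun t => u 0 t * Complex (P tau (t - z)) 0).
  apply: eq_cint => t.
  pose G x := Complex (abel tau x) 0 * expi ((2 * pi * e * (t - z)) * x).
  have iG : cintegrable mu G.
    apply: (@le_cintegrable _ _ R mu _ (abel tau)).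
    - apply: cmeasurableM.
        by apply: cmeasurable_real; apply: continuous_measurable_fun; exact: continuous_abel.
      by apply: cmeasurable_expi; exact: measurable_funM.
    - exact: integrable_abel.
    - by move=> x; rewrite normcM normc_expi mulr1 normc_real ger0_norm ?expR_ge0.
  by rewrite -[LHS]/(cint mu (fun x => u 0 t * G x)) cintZ// cint_abel.
rewrite E; apply/eqP; rewrite -addr_eq0 addrC; apply/eqP.
have cA : ccontinuous (fun t => Complex (A tau (t - z)) 0).
  split => [|t]; last exact: cst_continuous.
  exact: (is_derive_continuous (fun t => is_derive_A z t t0)).
have cP : ccontinuous (fun t => Complex (P tau (t - z)) 0).
  by split => [|t]; [exact: continuous_P|exact: cst_continuous].
have isupp v : ccontinuous v -> (forall t, r < `|t| -> v t = 0) -> cintegrable mu v.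
  move=> cv vr; have [N N0 vN] := line_bounded (ltW r0) cv vr.
  apply: (@le_cintegrable _ _ R mu _ (fun t => N * ind r t)) => //.
    exact: ccontinuous_cmeasurable.
  exact: integrable_indM.
rewrite -cintD; last 2 first.
- by apply: isupp => [|t rt]; [exact: ccontinuousM|rewrite ur// mul0r].
- by apply: isupp => [|t rt]; [exact: ccontinuousM|rewrite ur// mul0r].
have r2 : r < 2 * r by rewrite ltr_pMl// ltr1n.
rewrite (@cint_derive_supp _ (fun t => u 0 t * Complex (A tau (t - z)) 0) _ (2 * r)).
- by rewrite !ur ?mul0r ?subrr// ?normrN gtr0_norm ?mulr_gt0.
- by rewrite mulr_gt0.
- by apply: ccontinuousD; exact: ccontinuousM.
- move=> t; apply: is_cderiveM; first exact: du.
  by split; [exact: is_derive_A|exact: is_derive_cst].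
- by move=> t /(lt_trans r2) rt; rewrite !ur// !mul0r addr0.
Qed.

(** As [tau] tends to 0 the two sides of [abel_osc] converge, the left one to the integral sought.
    The right one becomes minus the integral of the derivative of the bump against a jump of height
    [1 / e] at [z]; each half-line contributes [u 0 z / (2 * e)]. *)
Theorem osc_inversion (xi : R) :
  cint mu (fun x => osc (u 0) a e x * expi (- (2 * pi * x * xi))) =
  Complex e^-1 0 * u 0 ((xi - a) / e).
Proof.
have [du ur] := tu; pose z := (xi - a) / e.
have -> : xi = a + e * z by rewrite /z; field; rewrite gt_eqF.
have -> : (a + e * z - a) / e = z by field; rewrite gt_eqF.
have c0 : ccontinuous (u 0) := tower_ccontinuous 0 tu.
have c1 : ccontinuous (u 1) := tower_ccontinuous 1 tu.
have t0 (n : nat) : 0 < n.+1%:R^-1 :> R by rewrite invr_gt0.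
have [C C0 HC] := osc_decay 1 r0 tu.
pose k x := osc (u 0) a e x * expi (- (2 * pi * x * (a + e * z))).
have mk : cmeasurable k.
  apply: cmeasurableM; first by case: cintegrable_osc.
  apply: cmeasurable_expi; apply: continuous_measurable_fun.
  move=> x; apply: cvgN; apply: cvgM; last exact: cvg_cst.
  by apply: cvgM; [exact: cvg_cst|exact: cvg_id].
have kC x : normc (k x) <= C * weight e 0 x.
  by rewrite normcM normc_expi mulr1; have := HC a e x; rewrite expr1.
have iC : mu.-integrable setT (EFin \o (fun x => C * weight e 0 x)).
  by have := integrableZl measurableT C (integrable_weight 0 e0).
have lim1 : ccvg (fun n => cint mu (fun x => k x * Complex (abel n.+1%:R^-1 x) 0)) (cint mu k).
  apply: (@cint_dominated _ _ R mu _ _ (fun x => C * weight e 0 x)) => //.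
  - move=> n; apply: cmeasurableM => //; apply: cmeasurable_real.
    by apply: continuous_measurable_fun; exact: continuous_abel.
  - move=> x; have lx : abel n.+1%:R^-1 x @[n --> \oo] --> (1 : R).
      rewrite -[X in _ --> X](@expR0 R).
      apply: (cvg_comp (fun n : nat => - (n.+1%:R^-1 * `|x|)) (@expR R) _ (@continuous_expR R 0)).
      suff : (- (n.+1%:R^-1 * `|x|)) @[n --> \oo] --> - (0 * `|x|) by rewrite mul0r oppr0.
      by apply: cvgN; apply: cvgM; [exact: cvg_harmonic|exact: cvg_cst].
    have : ccvg (fun n => k x * Complex (abel n.+1%:R^-1 x) 0) (k x * 1).
      exact: ccvg_mul_real lx.
    by rewrite mulr1.
  - move=> n x; rewrite normcM normc_real ger0_norm ?expR_ge0//.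
    rewrite (le_trans _ (kC x))// ler_piMr ?normc_ge0//.
    by rewrite -expR0 ler_expR oppr_le0 mulr_ge0// ltW.
have [M M0 uM] := line_bounded (ltW r0) c1 (ur 1%N).
have cA n : continuous (fun t : R => A n.+1%:R^-1 (t - z)).
  exact: (is_derive_continuous (fun t => is_derive_A z t (t0 n))).
(* The jump function is measurable as a pointwise limit of the continuous functions [A]. *)
have mS : measurable_fun setT (fun t : R => S (t - z)).
  apply: (measurable_fun_cvg (h := fun n (t : R) => A n.+1%:R^-1 (t - z))).
    by move=> n; exact: continuous_measurable_fun.
  by move=> t _; exact: A_cvg.
have iM : mu.-integrable setT (EFin \o (fun t => (2 * e)^-1 * M * ind r t)).
  exact: integrable_indM.
have mNu1 : cmeasurable (fun t : R => - u 1 t).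
  have := cmeasurableM (cmeasurable_cst (-1)) (ccontinuous_cmeasurable c1).
  by under eq_fun do rewrite mulN1r.
have uA (s t : R) : `|s| <= (2 * e)^-1 ->
    normc (- u 1 t * Complex s 0) <= (2 * e)^-1 * M * ind r t.
  move=> se; rewrite normcM normcN normc_real mulrC -mulrA.
  by apply: ler_pM => //; exact: normc_ge0.
have S_bounded s : `|S s| <= (2 * e)^-1.
  rewrite /S normrM ger0_norm ?invr_ge0 ?mulr_ge0 ?(ltW e0)//.
  rewrite ler_piMr ?invr_ge0 ?mulr_ge0 ?(ltW e0)//.
  by case: sgrP; rewrite ?normr0 ?normrN ?normr1.
have iuA n : cintegrable mu (fun t => - u 1 t * Complex (A n.+1%:R^-1 (t - z)) 0).
  apply: (@le_cintegrable _ _ R mu _ (fun t => (2 * e)^-1 * M * ind r t)) => //.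
    apply: cmeasurableM => //; apply: cmeasurable_real; exact: continuous_measurable_fun.
  by move=> t; exact: uA.
have lim2 : ccvg (fun n => cint mu (fun t => - u 1 t * Complex (A n.+1%:R^-1 (t - z)) 0))
    (cint mu (fun t => - u 1 t * Complex (S (t - z)) 0)).
  apply: (@cint_dominated _ _ R mu _ _ (fun t => (2 * e)^-1 * M * ind r t)) => //.
  - by move=> n; case: (iuA n).
  - by apply: cmeasurableM => //; exact: cmeasurable_real.
  - by move=> t; apply: ccvg_mul_real; exact: A_cvg.
  - by move=> n t; exact: uA.
have E n : cint mu (fun x => k x * Complex (abel n.+1%:R^-1 x) 0) =
    cint mu (fun t => - u 1 t * Complex (A n.+1%:R^-1 (t - z)) 0).
  rewrite [LHS](abel_osc z (t0 n)) -[RHS]opprK; congr (- _).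
  rewrite -[RHS]mulN1r -(cintZ (-1) (iuA n)); apply: eq_cint => t.
  by rewrite mulN1r mulNr opprK.
have -> : cint mu k = cint mu (fun t => - u 1 t * Complex (S (t - z)) 0).
  by apply: (ccvg_uniq lim1); under eq_fun do rewrite E.
(* Far from [z] in either direction the bump vanishes, which removes the boundary terms at
   infinity. *)
have far (s : R) : `|s| = 1 -> \forall n \near \oo, r < `|z + s * n.+1%:R|.
  move=> s1; near=> n; rewrite addrC; apply: (lt_le_trans _ (lerB_normD (s * n.+1%:R) z)).
  rewrite normrM s1 mul1r normr_nat.
  rewrite ltrBrDr (lt_trans _ (_ : n%:R < _)) ?ltr_nat//.
  near: n; exact: nbhs_infty_gtr.
have iS : cintegrable mu (fun t => - u 1 t * Complex (S (t - z)) 0).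
  apply: (@le_cintegrable _ _ R mu _ (fun t => (2 * e)^-1 * M * ind r t)) => //.
    by apply: cmeasurableM => //; exact: cmeasurable_real.
  by move=> t; exact: uA.
rewrite (@cint_two_rays _ _
  (fun t => Complex (- (2 * e)^-1) 0 * u 1 t) (fun t => Complex (2 * e)^-1 0 * u 1 t)
  (fun t => Complex (- (2 * e)^-1) 0 * u 0 t) (fun t => Complex (2 * e)^-1 0 * u 0 t)
  z iS).
- rewrite -mulrBl; congr (_ * _); apply: complex_ext; rewrite ?ReD ?ImD ?ReN ?ImN /= ?subr0//.
  by rewrite opprK; field; rewrite gt_eqF.
- by apply: ccontinuousM => //; exact: ccontinuous_cst.
- by apply: ccontinuousM => //; exact: ccontinuous_cst.
- by move=> t; apply: is_cderiveZ; exact: du.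
- by move=> t; apply: is_cderiveZ; exact: du.
- move=> t zt; rewrite /S gtr0_sg ?subr_gt0// mulr1 mulNr mulrC -mulNr; congr (_ * _).
  by apply: complex_ext; rewrite ?ReN ?ImN /= ?oppr0.
- move=> t zt; rewrite /S ltr0_sg ?subr_lt0// mulrN1 mulNr mulrC -mulNr; congr (_ * _).
  by apply: complex_ext; rewrite ?ReN ?ImN /= ?oppr0 ?opprK.
- apply: ccvg_near0; apply: filterS (far 1 (normr1 _)) => n rn.
  by rewrite mul1r in rn; rewrite ur ?mulr0.
- apply: ccvg_near0; apply: filterS (far (-1) (normrN1 _)) => n rn.
  by rewrite mulN1r in rn; rewrite ur ?mulr0.
Unshelve. all: by end_near. Qed.

End osc_inversion.

(** * Tensor products *)

(** Bernoulli's inequality with distinct factors; it compares [1 + |x|^2] with the product of the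
    [1 + x_j^2]. *)
Lemma sum_le_prod1D {R : realType} (J : Type) (s : seq J) (b : J -> R) :
  (forall j, 0 <= b j) -> 1 + \sum_(j <- s) b j <= \prod_(j <- s) (1 + b j).
Proof.
move=> b0; elim: s => [|j s IH]; first by rewrite !big_nil addr0.
rewrite !big_cons mulrDl mul1r; have s0 : 0 <= \sum_(j <- s) b j by exact: sumr_ge0.
have := ler_wpM2l (b0 j) IH; have := mulr_ge0 (b0 j) s0; lra.
Qed.

Section tensor_smooth.
Context {R : realType} {d : nat}.
Notation E := 'rV[R]_d.
Implicit Types (x : E) (v : 'I_d -> nat -> R -> R[i]).

Lemma ccontinuous_prod (T : topologicalType) (J : Type) (s : seq J) (F : J -> T -> R[i]) :
  (forall j, ccontinuous (F j)) -> ccontinuous (fun y => \prod_(j <- s) F j y).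
Proof.
move=> cF; elim: s => [|j s IH].
  by under eq_fun do rewrite big_nil; exact: ccontinuous_cst.
by under eq_fun do rewrite big_cons; exact: ccontinuousM.
Qed.

Lemma ccontinuous_tensor (w : 'I_d -> R -> R[i]) :
  (forall j, ccontinuous (w j)) -> ccontinuous (tensor w).
Proof.
move=> cw; apply: ccontinuous_prod => j.
by apply: (ccontinuous_comp (h := fun x : E => x ord0 j)) => //; exact: coord_continuous.
Qed.

Lemma is_cderive_tensor (w : 'I_d -> R -> R[i]) (dw : R -> R[i]) j x :
  is_cderive (x ord0 j) 1 (w j) (dw (x ord0 j)) ->
  is_cderive x (evec j) (tensor w)
    (tensor (fun i => if i == j then dw else w i) x).
Proof.
move=> wj; apply/is_cderive_line0.
have wj' : is_cderive (0 : R) 1 (fun h : R => w j (h *: 1 + x ord0 j)) (dw (x ord0 j)).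
  by apply/(is_cderive_line0 (w j)).
have -> : (fun h : R => tensor w (h *: evec j + x)) =
    fun h => \prod_(i < d | i != j) w i (x ord0 i) * w j (h *: 1 + x ord0 j).
  apply/funext => h; rewrite /tensor (bigD1 j)//= mulrC !mxE !eqxx /=; congr (_ * _).
  apply: eq_bigr => i ij; rewrite !mxE eqxx /=.
  by rewrite (negbTE ij) mulr0 add0r.
apply: (is_cderive_eq (is_cderiveZ _ wj')).
rewrite /tensor [RHS](bigD1 j)//= eqxx mulrC; congr (_ * _).
by apply: eq_bigr => i /negbTE ->.
Qed.

Lemma pderiv_eq (f : E -> R[i]) j x z : is_cderive x (evec j) f z -> pderiv j f x = z.
Proof.
by move=> [f1 f2]; apply: complex_ext => /=; exact: derive_val.
Qed.

Section derivatives.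
Variable v : 'I_d -> nat -> R -> R[i].
Hypothesis dv : forall j k (t : R), is_cderive t 1 (v j k) (v j k.+1 t).

(** An iterated partial derivative of a tensor depends on the list of directions only through
    multiplicities: the factor [i] is differentiated as often as [i] occurs in [s]. *)
Lemma is_cderive_tensor_count s j x :
  is_cderive x (evec j) (tensor (fun i => v i (count_mem i s)))
    (tensor (fun i => v i (count_mem i (j :: s))) x).
Proof.
apply: (is_cderive_eq (is_cderive_tensor (dw := v j (count_mem j s).+1) _)).
  exact: dv.
apply: eq_bigr => i _ /=; rewrite eq_sym.
by case: eqVneq => [->|_]; rewrite ?add1n ?add0n.
Qed.

Lemma pderivs_tensor s :
  pderivs s (tensor (fun j => v j 0)) = tensor (fun j => v j (count_mem j s)).
Proof.
elim: s => //= j s ->; apply/funext => x.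
by rewrite (pderiv_eq (is_cderive_tensor_count s j x)).
Qed.

Lemma smooth_tensor : smooth (tensor (fun j => v j 0)).
Proof.
move=> s; rewrite pderivs_tensor.
have [c1 c2] : ccontinuous (tensor (fun j => v j (count_mem j s))).
  by apply: ccontinuous_tensor => j; exact: is_cderive_continuous (dv j _).
split => // j x; have [h1 h2] := is_cderive_tensor_count s j x.
by split; [case: h1|case: h2].
Qed.

Lemma mderiv_tensor alpha :
  mderiv alpha (tensor (fun j => v j 0)) = tensor (fun j => v j (alpha j)).
Proof.
rewrite /mderiv pderivs_tensor; congr tensor; apply/funext => j; congr (v j _).
rewrite count_flatten -map_comp sumnE big_map big_enum /= (bigD1 j)//=.
rewrite count_nseq /= eqxx mul1n big1 ?addn0// => i ij.
by rewrite count_nseq /= (negbTE ij) mul0n.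
Qed.

Lemma schwartz_tensor :
  (forall j k N, exists C : R, forall t, oneDsqr t ^+ N * normc (v j k t) <= C) ->
  schwartz (tensor (fun j => v j 0)).
Proof.
move=> decay; split; first exact: smooth_tensor.
move=> N alpha; rewrite mderiv_tensor.
have /choice[C HC] : forall j, exists C : R, forall t,
    oneDsqr t ^+ N * normc (v j (alpha j) t) <= C.
  by move=> j; exact: decay.
exists (2 ^+ N * \prod_j C j) => x.
(* The weight in the Schwartz seminorms is dominated by a product of one-variable weights, so that
   the estimate factors over the coordinates. *)
have h1 : 1 + enorm x <= 2 * \prod_(j < d) oneDsqr (x ord0 j).
  have s0 : 0 <= dot x x by rewrite sumr_ge0// => j _; rewrite -expr2 sqr_ge0.
  have h2 : enorm x <= 1 + dot x x.
    rewrite /enorm -[leRHS]ger0_norm ?addr_ge0// -sqrtr_sqr ler_wsqrtr//.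
    by rewrite sqrrD; nra.
  have h3 : 1 + dot x x <= \prod_(j < d) oneDsqr (x ord0 j).
    apply: (le_trans (sum_le_prod1D _ (fun j => _))) => [j|]; first by rewrite -expr2 sqr_ge0.
    by apply: ler_prod => j _; rewrite /oneDsqr expr2 lexx addr_ge0// -expr2 sqr_ge0.
  lra.
apply: (@le_trans _ _ ((2 * \prod_(j < d) oneDsqr (x ord0 j)) ^+ N *
    normc (tensor (fun j => v j (alpha j)) x))).
  rewrite ler_wpM2r ?normc_ge0// lerXn2r ?nnegrE ?addr_ge0 ?sqrtr_ge0//.
  by rewrite mulr_ge0// prodr_ge0// => j _; exact: oneDsqr_ge0.
rewrite exprMn -mulrA ler_wpM2l ?exprn_ge0// normc_prod -prodrXl -big_split/=.
by apply: ler_prod => j _; rewrite HC andbT mulr_ge0 ?normc_ge0.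
Qed.

End derivatives.

Lemma compact_box (a : 'I_d -> R) (rho : R) :
  compact [set x : E | forall j, `|x ord0 j - a j| <= rho].
Proof.
have -> : [set x : E | forall j, `|x ord0 j - a j| <= rho] =
    [set x : E | forall j, `[a j - rho, a j + rho]%classic (x ord0 j)].
  apply/seteqP; split => x /= h j; have := h j; rewrite in_itv/= ler_distl; first by [].
  by [].
by apply: (@rV_compact R d (fun j => `[a j - rho, a j + rho]%classic)) => j; exact: segment_compact.
Qed.

Lemma test_tensor (O : set E) v (a : 'I_d -> R) (rho : R) :
  (forall j k (t : R), is_cderive t 1 (v j k) (v j k.+1 t)) ->
  (forall j t, rho < `|t - a j| -> v j 0%N t = 0) ->
  [set x : E | forall j, `|x ord0 j - a j| <= rho] `<=` O ->
  test O (tensor (fun j => v j 0)).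
Proof.
move=> dv vr sub; split; first exact: smooth_tensor.
exists [set x : E | forall j, `|x ord0 j - a j| <= rho]; split => //.
  exact: compact_box.
move=> x /= /existsNP[j /negP]; rewrite -ltNge => rj.
by rewrite /tensor (bigD1 j)//= vr// mul0r.
Qed.

Lemma expi_sum (s : seq 'I_d) (F : 'I_d -> R) :
  expi (\sum_(j <- s) F j) = \prod_(j <- s) expi (F j).
Proof. by rewrite (big_morph expi (@expiD R) (@expi0 R)). Qed.

Lemma fourier_tensor (w : 'I_d -> R -> R[i]) (xi : E) :
  (forall j, cintegrable lebesgue_measure (w j)) ->
  fourier (tensor w) xi =
  \prod_j cint lebesgue_measure (fun t => w j t * expi (- (2 * pi * t * xi ord0 j))).
Proof.
move=> iw; rewrite /fourier -[cintegral _]/(cint (leb d) _) -cint_tensor; last first.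
  move=> j; apply: (cintegrableMb (M := 1) (iw j)).
    apply: cmeasurable_expi; apply: continuous_measurable_fun.
    move=> t; apply: cvgN; apply: cvgM; last exact: cvg_cst.
    by apply: cvgM; [exact: cvg_cst|exact: cvg_id].
  by move=> t; rewrite normc_expi.
apply: eq_cint => x; rewrite /tensor big_split/=; congr (_ * _).
rewrite -expi_sum; congr expi; rewrite /dot big_distrr/= -sumrN.
by apply: eq_bigr => j _; rewrite mulrA.
Qed.

End tensor_smooth.

(** * Duality and frequency pieces *)

Section duality.
Context {R : realType} {d : nat}.
Notation E := 'rV[R]_d.
Implicit Types (f g : E -> R[i]) (x y : E) (O : set E).

Lemma measurable_dot : measurable_fun setT (fun z : E * E => dot z.1 z.2).
Proof.
apply: measurable_sum => j; apply: measurable_funM.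
- exact: (measurableT_comp (measurable_rV_coord j) measurable_fst).
- exact: (measurableT_comp (measurable_rV_coord j) measurable_snd).
Qed.

Lemma cmeasurable_fst f : cmeasurable f -> cmeasurable (fun z : E * E => f z.1).
Proof.
by move=> [f1 f2]; split; [exact: (measurableT_comp f1 measurable_fst)|
  exact: (measurableT_comp f2 measurable_fst)].
Qed.

Lemma cmeasurable_snd f : cmeasurable f -> cmeasurable (fun z : E * E => f z.2).
Proof.
by move=> [f1 f2]; split; [exact: (measurableT_comp f1 measurable_snd)|
  exact: (measurableT_comp f2 measurable_snd)].
Qed.

Lemma cmeasurable_inv_fourier f : cmeasurable f -> cmeasurable (inv_fourier f).
Proof.
move=> mf; apply: (@cmeasurable_cint _ _ _ _ R (leb d)
  (fun z : E * E => f z.2 * wave z.1 z.2)).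
apply: cmeasurableM; first exact: cmeasurable_snd.
by apply: cmeasurable_expi; apply: measurable_funM => //; exact: measurable_dot.
Qed.

(** The multiplication formula: Fubini with the product of the two moduli as majorant. *)
Lemma of_fun_fourier f g : cintegrable (leb d) f -> cintegrable (leb d) g ->
  of_fun f (fourier g) = of_fun (fourier f) g.
Proof.
move=> [mf fi] [mg gi].
pose F (z : E * E) := f z.1 * (g z.2 * expi (- (2 * pi * dot z.1 z.2))).
have me : cmeasurable (fun z : E * E => expi (- (2 * pi * dot z.1 z.2))).
  apply: cmeasurable_expi; apply: measurableT_comp => //.
  by apply: measurable_funM => //; exact: measurable_dot.
have mF : cmeasurable F.
  apply: cmeasurableM; first exact: cmeasurable_fst.
  by apply: cmeasurableM => //; exact: cmeasurable_snd.
have FM y xi : normc (F (y, xi)) <= normc (f y) * normc (g xi).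
  by rewrite /F !normcM normc_expi mulr1.
have me2 y : cmeasurable (fun xi => expi (- (2 * pi * dot y xi))).
  exact: cmeasurable_pair2 me.
transitivity (cint (leb d) (fun y => cint (leb d) (fun xi => F (y, xi)))).
  apply: eq_cint => y; rewrite /fourier -[cintegral _]/(cint (leb d) _) -cintZ; last first.
    apply: (cintegrableMb (M := 1)) => [//||xi]; last by rewrite normc_expi.
    by under eq_fun do rewrite dotC; exact: me2.
  by apply: eq_cint => xi; rewrite /F /= [dot xi y]dotC.
rewrite (@cint_Fubini _ _ _ _ R (leb d) (leb d) F _ _ mF fi gi FM).
apply: eq_cint => xi; rewrite /fourier -[cintegral _]/(cint (leb d) _) mulrC -cintZ; last first.
  apply: (cintegrableMb (M := 1)) => [//||y]; last by rewrite normc_expi.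
  by under eq_fun do rewrite dotC; exact: me2.
by apply: eq_cint => y; rewrite /F /= mulrCA.
Qed.

(** The Fourier transform of [phi * wave x] at [y] is the inverse transform of [phi] at [x - y], by
    combining the exponentials under the inner integral. This form of a piece gives its size. *)
Lemma freq_piece_conv (phi : E -> R[i]) f x :
  freq_piece phi (fourierZ (of_fun f)) x =
  cint (leb d) (fun y => f y * inv_fourier phi (x - y)).
Proof.
apply: eq_cint => y; congr (_ * _); apply: eq_cint => xi.
by rewrite /wave -mulrA -expiD dotDl dotNl [dot xi y]dotC; congr (_ * expi _); ring.
Qed.

(** The multiplication formula moves the transform onto [f]. This form of a piece shows that it
    vanishes when the frequency supports do not meet. *)
Lemma freq_piece_inv_fourier (r : R) (phi : E -> R[i]) f x : 0 <= r ->
  ccontinuous phi -> off_box r phi -> cintegrable (leb d) f ->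
  freq_piece phi (fourierZ (of_fun f)) x = inv_fourier (fun xi => fourier f xi * phi xi) x.
Proof.
move=> r0 cp pr fi; have cpw := ccontinuousM cp (ccontinuous_wave x).
rewrite /freq_piece /fourierZ of_fun_fourier//.
  by apply: eq_cint => xi; rewrite mulrA.
exact: (cintegrable_box r0 cpw (off_boxM _ pr)).
Qed.

(** By the multiplication formula the functional on test functions is integration against the
    integrable function [fourier f]. *)
Lemma Zdual_of_fun O f : cintegrable (leb d) f -> cintegrable (leb d) (fourier f) ->
  Zdual O (of_fun f).
Proof.
move=> fi Fi.
have testP g : test O g -> exists2 r : R, 0 <= r & ccontinuous g /\ off_box r g.
  move=> tg; have [r r0 gr] := test_off_box tg; exists r; first exact: ltW.
  by split => //; case: tg => sg _; exact: (smooth_ccontinuous [::] sg).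
have ti g : test O g -> cintegrable (leb d) g.
  by move=> /testP[r r0 [cg gr]]; exact: cintegrable_box r0 cg gr.
have tFi g : test O g -> cintegrable (leb d) (fun x => fourier f x * g x).
  move=> /testP[r r0 [cg gr]]; have [M M0 gM] := box_bounded r0 cg gr.
  apply: (cintegrableMb (M := M) Fi); first exact: ccontinuous_cmeasurable_rV.
  move=> x; rewrite (le_trans (gM x))// ler_piMr//.
  by apply: prodr_ile1 => j _; rewrite ind_ge0 /= indE lern1 leq_b1.
split.
- move=> g h tg th; rewrite /fourierZ !of_fun_fourier//; [|exact: ti|exact: ti|].
    rewrite /of_fun -cintD; [|exact: tFi|exact: tFi].
    by apply: eq_cint => x; rewrite mulrDr.
  by apply: cintegrableD; exact: ti.
- move=> a g tg; rewrite /fourierZ !of_fun_fourier//; [|exact: ti|].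
    rewrite /of_fun -cintZ; last exact: tFi.
    by apply: eq_cint => x; rewrite mulrCA.
  by apply: cintegrableZ; exact: ti.
(* The distribution has order 0, and its constant is twice the L^1 norm of [fourier f] for every
   [K]; the 2 is the one of [normc_cint_le]. *)
move=> K cK KO; exists 0%N, (2 * \int[leb d]_x normc (fourier f x)).
move=> g sg gK M gM; have tg : test O g by split => //; exists K.
have {}gM x : normc (g x) <= M.
  have := gM (fun=> 0%N) x; rewrite /morder big1//= => /(_ isT).
  have -> : mderiv (fun=> 0%N) g = g; last by [].
  by rewrite /mderiv /=; elim: (enum 'I_d).
rewrite /fourierZ of_fun_fourier//; last exact: ti.
have FiM : (leb d).-integrable setT (EFin \o (fun x => M * normc (fourier f x))).
  by have := integrableZl measurableT M Fi.2.
apply: (le_trans (normc_cint_le (g := fun x => M * normc (fourier f x)) _ FiM _)).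
- by case: (tFi g tg).
- by move=> x; rewrite normcM mulrC ler_wpM2r ?normc_ge0.
- by rewrite RintegralZl//; [rewrite mulrCA mulrC|exact: Fi.2].
Qed.

End duality.

(** * Derivatives and size of one-dimensional wave packets *)

Section wave_packet.
Context {R : realType}.
Notation mu := (@lebesgue_measure R).
Variables (r : R) (u : nat -> R -> R[i]).
Hypotheses (r0 : 0 < r) (tu : tower r u).

(** Derivatives of a wave packet are again oscillatory integrals, of the bump times a power of
    [freq]. As such a product starts a tower, the decay estimates apply to it. *)
Lemma tower_freq_exp (a e : R) k :
  exists2 w, tower r w & w 0%N = fun t => freq a e t ^+ k * u 0 t.
Proof.
elim: k => [|k [w tw w0]]; first by exists u => //; apply/funext => t; rewrite expr0 mul1r.
exists (fun k t => freq a e t * w k t + k%:R * Complex 0 (2 * pi * e) * w k.-1 t).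
  exact: tower_freq.
by apply/funext => t; rewrite w0 !mul0r addr0 mulrA -exprS.
Qed.

Lemma is_cderive_osc_freq (a e : R) k (x : R) :
  is_cderive x 1 (osc (fun t => freq a e t ^+ k * u 0 t) a e)
    (osc (fun t => freq a e t ^+ k.+1 * u 0 t) a e x).
Proof.
have [w tw w0] := tower_freq_exp a e k; rewrite -w0.
have := is_cderive_osc a e x (ltW r0) (tower_ccontinuous 0 tw) (tw.2 0%N).
congr is_cderive; congr (osc _ a e x).
by apply/funext => t; rewrite w0 mulrA -exprS.
Qed.

(** The constant may depend on [e] here, through [oneDsqr x <= oneDsqr (e * x) / e ^+ 2], since only
    membership in the Schwartz class is at stake. *)
Lemma osc_freq_schwartz (a e : R) k N : 0 < e <= 1 -> exists C : R, forall x,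
  oneDsqr x ^+ N * normc (osc (fun t => freq a e t ^+ k * u 0 t) a e x) <= C.
Proof.
move=> /andP[e0 e1]; have [w tw w0] := tower_freq_exp a e k.
have [C C0 HC] := osc_decay N r0 tw; exists ((e ^+ 2)^-1 ^+ N * C) => x.
have e2 : 0 < e ^+ 2 by rewrite exprn_gt0.
have h : oneDsqr x <= (e ^+ 2)^-1 * oneDsqr (e * x).
  rewrite ler_pdivlMl// /oneDsqr mulrDr mulr1 exprMn lerD2r.
  by rewrite expr_le1 // ltW.
rewrite -w0; apply: (@le_trans _ _ (oneDsqr x ^+ N * (C * weight e 0 x ^+ N))).
  by rewrite ler_wpM2l ?HC// exprn_ge0// oneDsqr_ge0.
rewrite mulrCA mulrC ler_wpM2r// /weight subr0 -exprMn.
have e2' := ltW e2.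
rewrite lerXn2r ?nnegrE ?divr_ge0 ?invr_ge0 ?oneDsqr_ge0//.
by rewrite ler_pdivrMr// oneDsqr_gt0.
Qed.

Lemma osc_rescale (v : R -> R[i]) (a e x : R) :
  (forall y, cintegrable mu (fun t => v t * phase 0 1 y t)) ->
  osc v a e x = expi (2 * pi * x * a) * osc v 0 1 (e * x).
Proof.
move=> iv; rewrite /osc -cintZ//; apply: eq_cint => t.
by rewrite mulrCA /phase -expiD; congr (_ * expi _); ring.
Qed.

(** Otherwise Fourier inversion at the origin would give [u 0 0 = 0]. *)
Lemma osc_nonzero : u 0 0 != 0 -> exists y : R, osc (u 0) 0 1 y != 0.
Proof.
move=> u00; apply: contrapT => /forallNP h; move/eqP: u00; apply.
have := osc_inversion 0 r0 tu ltr01 0.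
rewrite subr0 divr1 invr1 [RHS]mul1r => <-.
rewrite -[RHS](cint0 mu); apply: eq_cint => y.
by have /negP/negPn/eqP -> := h y; rewrite mul0r.
Qed.

Lemma osc_ball : u 0 0 != 0 -> exists c delta y0 : R,
  [/\ 0 < c, 0 < delta & forall y, `|y - y0| <= delta -> c <= normc (osc (u 0) 0 1 y)].
Proof.
move=> /osc_nonzero[y0 h0].
have ch : ccontinuous (osc (u 0) 0 1).
  apply: is_cderive_continuous => x.
  exact: (is_cderive_osc 0 1 x (ltW r0) (tower_ccontinuous 0 tu) (tu.2 0%N)).
have n0 := normc_gt0 h0; pose c := normc (osc (u 0) 0 1 y0) / 2.
have cc : c < normc (osc (u 0) 0 1 y0) by rewrite /c; lra.
have cn : continuous (fun y => normc (osc (u 0) 0 1 y)) := continuous_normc ch.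
have := @cvgr_gt R _ _ (nbhs_filter y0) (fun y => normc (osc (u 0) 0 1 y)) _ (cn y0) _ cc.
move=> /nbhs_ballP[dl /= dl0 H].
exists c, (dl / 2), y0; split; [by rewrite divr_gt0|by rewrite divr_gt0|].
move=> y yy; apply/ltW/H; rewrite /ball/= distrC.
by apply: (le_lt_trans yy); rewrite ltr_pdivrMr// mulr_natr mulr2n ltrDl.
Qed.

(** On the support of the bump [freq a e t] tends to the constant [l = 2 pi i a] uniformly as [e]
    tends to 0. With [l] in its place the integral is a modulated dilate of [osc (u 0) 0 1], whose
    modulus is at least [c] near [y0]; for small [e] the error takes away at most half of the
    resulting bound. *)
Lemma osc_lower (a c delta y0 : R) k : a != 0 -> 0 < c ->
  (forall y, `|y - y0| <= delta -> c <= normc (osc (u 0) 0 1 y)) ->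
  exists2 c' : R, 0 < c' & \forall e \near 0^'+, forall x, `|e * x - y0| <= delta ->
    c' <= normc (osc (fun t => freq a e t ^+ k * u 0 t) a e x).
Proof.
move=> a0 c0 hc; have c0' := tower_ccontinuous 0 tu.
have [M M0 uM] := line_bounded (ltW r0) c0' (tu.2 0%N).
pose J := 2 * \int[mu]_t (M * ind r t).
have J0 : 0 <= J.
  by rewrite mulr_ge0// Rintegral_ge0// => t _; rewrite mulr_ge0 ?ind_ge0.
pose L := (2 * pi) ^+ k : R; have L0 : 0 < L by rewrite exprn_gt0// mulr_gt0 ?pi_gt0.
pose A := `|a| ^+ k; have A0 : 0 < A by rewrite exprn_gt0// normr_gt0.
(* Chosen so that the error [L * eta * J] is at most half of the main term [L * A * c]; the added 1
   avoids a division by zero. *)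
pose eta := A * c / (2 * (J + 1)).
have J1 : 0 < J + 1 by rewrite ltr_wpDl.
have eta0 : 0 < eta by rewrite divr_gt0 ?mulr_gt0.
exists (L * A * c / 2); first by rewrite divr_gt0 ?mulr_gt0.
have cX : {for a, continuous (fun s : R => s ^+ k)} by exact: exprn_continuous.
have /nbhs_ballP[rho /= rho0 H] : \forall s \near a, `|a ^+ k - s ^+ k| < eta.
  by move/cvgrPdist_lt : cX => /(_ eta eta0).
have er : 0 < rho / (r + 1) by rewrite divr_gt0// addr_gt0.
near=> e => x xy.
have e0 : 0 < e by near: e; exact: nbhs_right_gt.
have erho t : `|t| <= r -> `|(a + e * t) ^+ k - a ^+ k| <= eta.
  move=> tr; rewrite distrC ltW//; apply: H; rewrite /ball/= opprD addNKr normrN normrM gtr0_norm//.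
  have : e < rho / (r + 1) by near: e; exact: nbhs_right_lt.
  rewrite ltr_pdivlMr ?addr_gt0// => ee.
  rewrite (le_lt_trans _ ee)// ler_pM2l// (le_trans tr)// lerDl//.
pose l : R[i] := Complex 0 (2 * pi * a).
pose D t := (freq a e t ^+ k - l ^+ k) * u 0 t.
have lE (s : R) : Complex 0 (2 * pi * s) = Complex 0 (2 * pi) * Complex s 0.
  by apply: complex_ext; rewrite ?ReM ?ImM /=; ring.
have realX (s : R) n : (Complex s 0) ^+ n = Complex (s ^+ n) 0.
  elim: n => [|n IH]; first by rewrite !expr0.
  by rewrite !exprS IH; apply: complex_ext; rewrite ?ReM ?ImM /=; ring.
have Db t : normc (D t) <= L * eta * (M * ind r t).
  rewrite /D normcM; have [tr|rt] := lerP `|t| r; last first.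
    rewrite tu.2// normc0 mulr0; apply: mulr_ge0; last by rewrite mulr_ge0 ?ind_ge0.
    exact/ltW/mulr_gt0.
  rewrite ler_pM ?normc_ge0// /freq /l lE [Complex 0 (2 * pi * a)]lE !exprMn -mulrBr.
  rewrite normcM normcX normc_Complex0 ger0_norm ?mulr_ge0 ?pi_ge0//.
  rewrite ler_wpM2l ?(ltW L0)// !realX.
  have -> : Complex ((a + e * t) ^+ k) 0 - Complex (a ^+ k) 0 =
      Complex ((a + e * t) ^+ k - a ^+ k) 0.
    by apply: complex_ext; rewrite ?ReD ?ImD ?ReN ?ImN /= ?subr0.
  by rewrite normc_real erho.
have iu y : cintegrable mu (fun t => u 0 t * phase 0 1 y t).
  exact: integrable_osc (ltW r0) c0' (tu.2 0%N).
have iu' := integrable_osc a e x (ltW r0) c0' (tu.2 0%N).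
have cD : ccontinuous D.
  apply: ccontinuousM => //; apply: ccontinuousD; last exact: ccontinuous_cst.
  elim: (k) => [|n IH]; first by under eq_fun do rewrite expr0; exact: ccontinuous_cst.
  by under eq_fun do rewrite exprS; exact: ccontinuousM (ccontinuous_freq a e) IH.
have Dr t : r < `|t| -> D t = 0 by move=> rt; rewrite /D tu.2// mulr0.
have iD := integrable_osc a e x (ltW r0) cD Dr.
have oE : osc (fun t => freq a e t ^+ k * u 0 t) a e x =
    l ^+ k * osc (u 0) a e x + osc D a e x.
  rewrite /osc -cintZ// -cintD//; last exact: cintegrableZ.
  by apply: eq_cint => t; rewrite /D; ring.
have oD : normc (osc D a e x) <= L * eta * J.
  apply: (le_trans (@normc_cint_le _ _ R mu (fun t => D t * phase a e x t)
    (fun t => L * eta * (M * ind r t)) _ _ _)).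
  - apply: ccontinuous_cmeasurable; exact: ccontinuousM cD (ccontinuous_phase a e x).
  - by have := integrableZl measurableT (L * eta) (integrable_indM r M).
  - by move=> t; rewrite normcM normc_phase mulr1.
  - by rewrite RintegralZl//; [rewrite mulrCA|exact: integrable_indM].
have ol : L * A * c <= normc (l ^+ k * osc (u 0) a e x).
  rewrite normcM normcX normc_Complex0 osc_rescale// normcM normc_expi mul1r.
  rewrite normrM exprMn ger0_norm ?mulr_ge0 ?pi_ge0//.
  by rewrite ler_wpM2l ?hc// mulr_ge0 ?(ltW L0) ?(ltW A0).
have tri : normc (l ^+ k * osc (u 0) a e x) <=
    normc (l ^+ k * osc (u 0) a e x + osc D a e x) + normc (osc D a e x).
  have := normcD (l ^+ k * osc (u 0) a e x + osc D a e x) (- osc D a e x).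
  by rewrite addrK normcN.
have etaJ : eta * J <= A * c / 2.
  have -> : A * c / 2 = eta * (J + 1) by rewrite /eta; field; rewrite gt_eqF.
  by rewrite ler_pM2l// lerDl.
rewrite [leRHS](_ : _ = normc (l ^+ k * osc (u 0) a e x + osc D a e x)).
  by have := ler_wpM2l (ltW L0) etaJ; lra.
exact: (congr1 (fun z => normc z) oE).
Unshelve. all: by end_near. Qed.

End wave_packet.

(** * The wave packet in several variables *)

Section packet.
Context {R : realType} {d : nat}.
Notation E := 'rV[R]_d.
Notation mu := (@lebesgue_measure R).
Variables (r : R) (u : nat -> R -> R[i]).
Hypotheses (r0 : 0 < r) (tu : tower r u).
Implicit Types (a : 'I_d -> R) (e : R) (x : E).

Definition packet a e : E -> R[i] := tensor (fun j => osc (u 0) (a j) e).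

(** The trivial factor [freq ^+ 0] shows the packet as the entry [k = 0] of a family closed under
    differentiation, as the lemmas on tensors demand. *)
Let packetE a e :
  packet a e = tensor (fun j => osc (fun t => freq (a j) e t ^+ 0 * u 0 t) (a j) e).
Proof.
congr tensor; apply/funext => j; congr (osc _ (a j) e).
by apply/funext => t; rewrite expr0 mul1r.
Qed.

Let dv a e j k (t : R) := is_cderive_osc_freq r0 tu (a j) e k t.

Lemma packet_schwartz a e : 0 < e <= 1 -> schwartz (packet a e).
Proof.
move=> e01; rewrite packetE.
apply: (schwartz_tensor (v := fun j k => osc (fun t => freq (a j) e t ^+ k * u 0 t) (a j) e)).
  by move=> j k t; exact: dv.
by move=> j k N; exact: (osc_freq_schwartz r0 tu (a j) k N e01).
Qed.

Lemma packet_mderiv a e alpha : mderiv alpha (packet a e) =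
  tensor (fun j => osc (fun t => freq (a j) e t ^+ alpha j * u 0 t) (a j) e).
Proof.
rewrite packetE.
apply: (mderiv_tensor (v := fun j k => osc (fun t => freq (a j) e t ^+ k * u 0 t) (a j) e)).
by move=> j k t; exact: dv.
Qed.

Lemma cmeasurable_packet_mderiv a e alpha : cmeasurable (mderiv alpha (packet a e)).
Proof.
rewrite packet_mderiv; apply: cmeasurable_tensor => j.
apply: ccontinuous_cmeasurable; apply: is_cderive_continuous => t.
exact: (@dv a e j (alpha j)).
Qed.

Lemma cintegrable_packet a e : 0 < e -> cintegrable (leb d) (packet a e).
Proof. by move=> e0; apply: cintegrable_tensor => j; exact: (cintegrable_osc (a j) r0 tu e0). Qed.

Lemma fourier_packet a e : 0 < e -> fourier (packet a e) =
  tensor (fun j t => Complex e^-1 0 * u 0 (e^-1 * (t - a j))).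
Proof.
move=> e0; apply/funext => x; rewrite fourier_tensor; last first.
  by move=> j; exact: (cintegrable_osc (a j) r0 tu e0).
by apply: eq_bigr => j _; rewrite (osc_inversion (a j) r0 tu e0) mulrC [_ / e]mulrC mulrC.
Qed.

(** The [k]-th derivative of the rescaled bump: each differentiation brings a factor [1 / e], on top
    of the one from Fourier inversion. *)
Let scaled a e j k (t : R) : R[i] := Complex (e^-1 ^+ k.+1) 0 * u k (e^-1 * (t - a j)).

Let dscaled a e j k (t : R) : is_cderive t 1 (scaled a e j k) (scaled a e j k.+1 t).
Proof.
have [d1 d2] := tu.1 k (e^-1 * (t - a j)).
have dl := derive_affine e^-1 (a j) t.
have du : is_cderive t 1 (fun t : R => u k (e^-1 * (t - a j)))
    (Complex e^-1 0 * u k.+1 (e^-1 * (t - a j))).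
  split.
  - have H := @is_derive1_comp _ (fun s => cRe (u k s)) (fun s => e^-1 * (s - a j)) t _ _ d1 dl.
    by apply: (is_derive_eq H); rewrite ReM /= mul0r subr0 mulrC.
  - have H := @is_derive1_comp _ (fun s => cIm (u k s)) (fun s => e^-1 * (s - a j)) t _ _ d2 dl.
    by apply: (is_derive_eq H); rewrite ImM /= mul0r addr0 mulrC.
apply: (is_cderive_eq (is_cderiveZ _ du)); rewrite mulrA /scaled; congr (_ * _).
by apply: complex_ext; rewrite ?ReM ?ImM /= ?mulr0 ?mul0r ?subr0 ?addr0// -exprSr.
Qed.

Let scaled_supp a e j (t : R) : 0 < e -> e * r < `|t - a j| -> scaled a e j 0 t = 0.
Proof.
move=> e0 rt; rewrite /scaled tu.2 ?mulr0// normrM gtr0_norm ?invr_gt0//.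
by rewrite ltr_pdivlMl.
Qed.

Let fourier_scaled a e : 0 < e -> fourier (packet a e) = tensor (fun j => scaled a e j 0).
Proof.
move=> e0; rewrite fourier_packet//.
Qed.

Lemma test_fourier_packet (O : set E) a e : 0 < e ->
  [set x : E | forall j, `|x ord0 j - a j| <= e * r] `<=` O ->
  test O (fourier (packet a e)).
Proof.
move=> e0 sub; rewrite fourier_scaled//.
apply: (test_tensor (v := scaled a e) (a := a) (rho := e * r)) => //.
by move=> j t; exact: scaled_supp.
Qed.

Lemma fourier_packet_supp a e x : 0 < e -> fourier (packet a e) x != 0 ->
  forall j, `|x ord0 j - a j| <= e * r.
Proof.
move=> e0 + j; apply: contraNT; rewrite -ltNge => rj.
by rewrite fourier_scaled// /tensor (bigD1 j)//= scaled_supp// mul0r.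
Qed.

Lemma packet_decay m : exists2 C : R, 0 <= C & forall a e x,
  normc (packet a e x) <= C * tensor (fun _ t => weight e 0 t ^+ m) x.
Proof.
have [C C0 HC] := osc_decay m r0 tu; exists (C ^+ d); first by rewrite exprn_ge0.
move=> a e x; rewrite normc_prod.
have -> : C ^+ d = \prod_(j < d) C by rewrite prodr_const card_ord.
rewrite /tensor -big_split; apply: ler_prod => j _.
by apply/andP; split; [exact: normc_ge0|exact: HC].
Qed.

(** The profile is the same in every coordinate, so one [y0] and one [delta] serve them all, and the
    finitely many smallness conditions on [e] hold together. *)
Lemma packet_lower a alpha : u 0 0 != 0 -> (forall j, a j != 0) ->
  exists c delta y0 : R, [/\ 0 < c, 0 < delta &
    \forall e \near 0^'+, forall x : E, (forall j, `|e * x ord0 j - y0| <= delta) ->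
      c <= normc (mderiv alpha (packet a e) x)].
Proof.
move=> u0 a0; have [c [delta [y0 [c0 dl0 H]]]] := osc_ball r0 tu u0.
have /choice[cc Hcc] : forall j, exists c' : R, 0 < c' /\ \forall e \near 0^'+,
    forall t, `|e * t - y0| <= delta ->
    c' <= normc (osc (fun t => freq (a j) e t ^+ alpha j * u 0 t) (a j) e t).
  by move=> j; have [c' ? ?] := osc_lower r0 tu (alpha j) (a0 j) c0 H; exists c'.
exists (\prod_j cc j), delta, y0; split => //.
  by apply: prodr_gt0 => j _; case: (Hcc j).
have : \forall e \near 0^'+, forall j, forall t, `|e * t - y0| <= delta ->
    cc j <= normc (osc (fun t => freq (a j) e t ^+ alpha j * u 0 t) (a j) e t).
  by apply: filter_forall => j; case: (Hcc j).
apply: filterS => e He x xy; rewrite packet_mderiv normc_prod.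
apply: ler_prod => j _; rewrite He ?xy// andbT.
by case: (Hcc j) => /ltW.
Qed.

End packet.

(** * Norms in the decomposition space *)

Section sequence_space.
Context {R : realType} {d : nat} {I : choiceType}.
Notation E := 'rV[R]_d.
Variables (Q : affine_family R d I) (O : set E) (phi : I -> E -> R[i]).
Variables (Y : set (I -> R[i])) (nY : (I -> R[i]) -> R).

Definition delta_seq (i0 i : I) : R[i] := (i == i0)%:R.

Lemma clustering_delta i0 i :
  clustering Q (delta_seq i0) i = (`[< Defs.cluster Q i i0 >])%:R.
Proof.
rewrite /clustering; case: asboolP => h.
  rewrite -(@fsbig_widen _ _ _ _ [set i0]) ?fsbig_set1 /delta_seq ?eqxx//.
    by move=> l ->.
  by move=> l /= [_ /eqP/negbTE ->].
rewrite fsbig1// => l hl; rewrite /delta_seq; case: eqVneq => // li.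
by rewrite li in hl.
Qed.

Lemma cluster_sym i j : Defs.cluster Q i j -> Defs.cluster Q j i.
Proof. by move=> [x [xi xj]]; exists x. Qed.

Lemma normc_nat (b : bool) : normc (b%:R : R[i]) = b%:R.
Proof. by case: b; rewrite ?normc1 ?normc0. Qed.

(* Some [y i1] is nonzero for a [y] in [Y], but [phi i1] may vanish identically; a
neighbour [i0] of [i1] does not have this defect, and it inherits [delta_seq i0 \in Y]
from the clustering of [delta_seq i1]. *)
Lemma active_index : covers Q O -> admissible Q -> partition_of_unity O Q phi ->
  regular_sequence_space Q Y nY -> Y <> [set (fun=> 0)] ->
  exists i0 x0, phi i0 x0 != 0 /\ Y (clustering Q (delta_seq i0)).
Proof.
move=> cQ [Q0 _] [_ phi0 phi1] [[Y0 YD YZ] _ _ Ysol [k Yk]] Yne.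
have [y Yy [i1 yi1]] : exists2 y, Y y & exists i, y i != 0.
  apply: contrapT => h; apply: Yne; apply/seteqP; split => y /=; last by move=> ->.
  move=> Yy; apply/funext => i; apply/eqP/negP => /negP yi; apply: h.
  by exists y => //; exists i.
have Yd1 : Y (delta_seq i1).
  (* Solidity: the multiple of [y] whose entry at [i1] equals 1 dominates [delta_seq i1]. *)
  apply: (Ysol _ (fun i => (y i1)^-1 * y i) _ _).1; first exact: YZ.
  move=> i; rewrite /delta_seq normc_nat; case: eqVneq => [->|_]; last exact: normc_ge0.
  by rewrite mulVf// normc1.
have [x xi1] := Q0 i1.
have Ox : O x by rewrite -cQ; exists i1.
have [l phil] : exists l, phi l x != 0.
  apply: contrapT => h; have := phi1 x Ox; rewrite fsbig1 => [/eqP|l _].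
    by rewrite eq_sym oner_eq0.
  by apply/eqP/negP => /negP hl; apply: h; exists l.
have xl : cell Q l x.
  by apply: contrapT => h; move: phil; rewrite phi0// eqxx.
exists l, x; split => //; apply: (Yk _ _).1.
apply: (Ysol _ _ (Yk _ Yd1).1 _).1 => i; rewrite clustering_delta /delta_seq !normc_nat.
case: eqVneq => [->|_]; last by case: `[< _ >].
by rewrite asboolT//; exists x.
Qed.

End sequence_space.

(** * Choice of the centre and of the bump *)

Section local_analysis.
Context {R : realType} {d : nat}.
Notation E := 'rV[R]_d.
Implicit Types (phi : E -> R[i]) (x a : E).

Lemma ccontinuous_nonzero phi x0 : ccontinuous phi -> phi x0 != 0 ->
  exists2 rho : R, 0 < rho & forall x, (forall j, `|x ord0 j - x0 ord0 j| <= rho) -> phi x != 0.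
Proof.
move=> cp px; have cn : continuous (fun x => normc (phi x)) := continuous_normc cp.
have := @cvgr_gt R _ _ (nbhs_filter x0) (fun x => normc (phi x)) _ (cn x0) _ (normc_gt0 px).
move=> /nbhs_ballP[rho /= rho0 H]; exists (rho / 2); first by rewrite divr_gt0.
move=> x xx; have : ball x0 rho x.
  rewrite -ball_normE /=; apply: rV_norm_lt => // j; rewrite !mxE distrC.
  by apply: (le_lt_trans (xx j)); rewrite ltr_pdivrMr// mulr_natr mulr2n ltrDl.
by move=> /H; apply: contraTneq => ->; rewrite normc0 ltxx.
Qed.

(** The point moves along the diagonal by a small positive [t]: nonnegative coordinates become
    positive, negative ones stay negative, and [phi] stays nonzero by continuity. *)
Lemma nonzero_coordinates phi x0 : ccontinuous phi -> phi x0 != 0 ->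
  exists2 a, phi a != 0 & forall j, a ord0 j != 0.
Proof.
move=> cp px; have [rho rho0 H] := ccontinuous_nonzero cp px.
near (0 : R)^'+ => t.
have t0 : 0 < t by near: t; exact: nbhs_right_gt.
exists (x0 + const_mx t).
  have tr : t < rho by near: t; exact: nbhs_right_lt.
  by apply: H => j; rewrite !mxE addrAC subrr add0r gtr0_norm// ltW.
move=> j; rewrite !mxE; move: j; near: t; apply: filter_forall => j.
have [h|h] := ltP (x0 ord0 j) 0.
  near=> t; rewrite lt_eqF//= -ltrBrDl sub0r; near: t.
  by apply: nbhs_right_lt; rewrite oppr_gt0.
near=> t; rewrite gt_eqF//= ltr_wpDl//; near: t; exact: nbhs_right_gt.
Unshelve. all: by end_near. Qed.

Lemma tower_line phi a (j : 'I_d) (rho : R) : 0 < rho -> smooth phi -> off_box rho phi ->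
  exists r u, [/\ 0 < r, tower r u & u 0%N 0 = phi a].
Proof.
move=> rho0 sp pr.
(* At parameter [t] the [j]-th coordinate is [t + a_j], so the radius [rho] has to be enlarged by
   [|a_j|]. *)
exists (rho + `|a ord0 j|), (fun k t => pderivs (nseq k j) phi (t *: evec j + a)); split.
- by rewrite ltr_pwDl.
- split => [k t|k t rt].
    apply/(is_cderive_line (pderivs (nseq k j) phi)).
    exact: (smooth_is_cderive (nseq k j) j _ sp).
  apply: (off_box_pderivs _ pr); exists j; rewrite !mxE !eqxx mulr1.
  by rewrite -ltrBDr in rt; rewrite (lt_le_trans rt)// lerB_normD.
- by rewrite /= scale0r add0r.
Qed.

(** The quotient of the two powers has the positive exponent [sg - s], and its base is at least
    [e^-1] because [d] is positive. The threshold [Z] solves [Z ^ (sg - s) = T + 1]. *)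
Lemma powR_dominates (s sg T : R) : (0 < d)%N -> s < sg -> 0 <= T ->
  \forall e \near 0^'+, T * ((e^-1) ^+ d) `^ s < ((e^-1) ^+ d) `^ sg.
Proof.
move=> d0 ssg T0; have g0 : 0 < sg - s by rewrite subr_gt0.
pose Z := (T + 1) `^ (sg - s)^-1; have Z0 : 0 < Z by rewrite powR_gt0// ltr_wpDl.
near=> e; have e0 : 0 < e by near: e; exact: nbhs_right_gt.
have e1 : e <= 1 by apply: ltW; near: e; exact: nbhs_right_lt.
have eZ : e <= Z^-1 by apply: ltW; near: e; apply: nbhs_right_lt; rewrite invr_gt0.
have i1 : 1 <= e^-1 by rewrite invf_ge1.
have Ze : Z <= e^-1 by rewrite -[Z]invrK lef_pV2// posrE invr_gt0.
have X0 : 0 < e^-1 ^+ d by rewrite exprn_gt0// invr_gt0.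
have ZX : Z <= e^-1 ^+ d.
  rewrite (le_trans Ze)// -[leLHS]expr1 ler_weXn2l//.
rewrite -[sg in ltRHS](subrK s) powRD; last by apply/implyP => _; rewrite gt_eqF.
rewrite ltr_pM2r ?powR_gt0//.
apply: (@lt_le_trans _ _ (Z `^ (sg - s))).
  by rewrite /Z -powRrM mulVf ?gt_eqF// powRr1 ?ltrDl// addr_ge0.
by apply: ge0_ler_powR => //; rewrite ?nnegrE; exact: ltW.
Unshelve. all: by end_near. Qed.

End local_analysis.

Lemma finite_ubound {R : realType} {I : choiceType} (A : set I) (B : I -> R) :
  finite_set A -> exists2 M : R, 0 <= M & forall i, A i -> B i <= M.
Proof.
move=> /finite_seqP[t ->]; exists (\big[Num.max/0]_(i <- t) B i).
  exact: bigmax_ge_id.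
by move=> i it; apply: le_bigmax_seq.
Qed.

(** * Upper bound for the decomposition norm *)

Section upper_bound.
Context {R : realType} {d : nat} {I : choiceType}.
Notation E := 'rV[R]_d.
Variables (Q : affine_family R d I) (O : set E) (phi : I -> E -> R[i]).
Variables (Y : set (I -> R[i])) (nY : (I -> R[i]) -> R).

(** The sequence of piece norms is dominated by [D] times the indicator of the cluster of [i0];
    solidity puts it in [Y] and bounds its quasi-norm. *)
Lemma decomp_norm_le (p : \bar R) (f : E -> R[i]) (i0 : I) (D : R) :
  regular_sequence_space Q Y nY -> Y (clustering Q (delta_seq i0)) -> 0 <= D ->
  (forall i, Defs.cluster Q i i0 -> (piece_norms p phi (of_fun f) i <= D%:E)%E) ->
  (forall i, ~ Defs.cluster Q i i0 -> piece_norms p phi (of_fun f) i = 0%E) ->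
  (decomp_norm p phi Y nY (of_fun f) <= (D * nY (clustering Q (delta_seq i0)))%:E)%E.
Proof.
move=> [[_ _ YZ] [_ _ nYZ _] _ Ysol _] Ycl D0 hin hout.
have fin i : piece_norms p phi (of_fun f) i \is a fin_num.
  have [h|h] := pselect (Defs.cluster Q i i0); last by rewrite hout.
  rewrite ge0_fin_numE ?Lnorm_ge0//; exact: le_lt_trans (hin i h) (ltry _).
pose z : I -> R[i] := fun i => Complex D 0 * clustering Q (delta_seq i0) i.
have Yz : Y z by exact: YZ.
have dom i : normc (Complex (fine (piece_norms p phi (of_fun f) i)) 0) <= normc (z i).
  rewrite /z normcM clustering_delta normc_nat !normc_real (ger0_norm D0).
  rewrite ger0_norm ?fine_ge0 ?Lnorm_ge0//; case: asboolP => h.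
    by rewrite mulr1 -lee_fin fineK// hin.
  by rewrite hout// mulr0.
have [Yc nc] := Ysol _ _ Yz dom.
rewrite /decomp_norm asboolT// lee_fin (le_trans nc)// /z nYZ//.
by rewrite normc_real ger0_norm.
Qed.

Lemma piece_norm_le (p : \bar R) (i : I) (f : E -> R[i]) (e A B : R) m :
  (0 < p)%E -> 0 < e <= 1 -> 0 <= A -> 0 <= B ->
  (p \is a fin_num -> 1 <= m%:R * fine p) ->
  test O (phi i) -> cintegrable (leb d) f ->
  (forall x, normc (f x) <= A * tensor (fun _ t => weight e 0 t ^+ m) x) ->
  (forall x, normc (inv_fourier (phi i) x) <= B * tensor (fun _ t => weight 1 0 t ^+ m.+1) x) ->
  (piece_norms p phi (of_fun f) i <=
    (2 * (A * B * (2 ^+ m * pi) ^+ d) * ((pi / e) ^+ d) `^ invp p)%:E)%E.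
Proof.
move=> p0 e01 A0 B0 mp tphi fi fA GB.
have [r r0 pr] := test_off_box tphi.
have cp : ccontinuous (phi i) by case: tphi => s _; exact: (smooth_ccontinuous [::] s).
have E1 x : freq_piece (phi i) (fourierZ (of_fun f)) x =
    cint (leb d) (fun y => f y * inv_fourier (phi i) (x - y)) := freq_piece_conv _ _ _.
have mG : cmeasurable (inv_fourier (phi i)).
  exact/cmeasurable_inv_fourier/ccontinuous_cmeasurable_rV.
apply: (@Lpnorm_decay R d p _ e _ m) => //.
- by case/andP : e01.
- by rewrite !mulr_ge0// exprn_ge0// mulr_ge0 ?pi_ge0 ?exprn_ge0.
- rewrite (funext E1); apply: (@cmeasurable_cint _ _ _ _ R (leb d)
    (fun z : E * E => f z.2 * inv_fourier (phi i) (z.1 - z.2))).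
  apply: cmeasurableM; first exact: cmeasurable_snd fi.1.
  have ms : measurable_fun setT (fun z : E * E => z.1 - z.2).
    apply: measurable_fun_rVP => j; under eq_fun do rewrite /rV_coord !mxE.
    apply: measurable_funB.
    - exact: (measurableT_comp (measurable_rV_coord j) measurable_fst).
    - exact: (measurableT_comp (measurable_rV_coord j) measurable_snd).
  by split; [exact: (measurableT_comp mG.1 ms)|exact: (measurableT_comp mG.2 ms)].
- by move=> x; rewrite E1; exact: conv_decay e01 A0 B0 fi.1 mG fA GB.
Qed.

Lemma piece_norm_eq0 (p : \bar R) (i : I) (f : E -> R[i]) :
  (0 < p)%E -> test O (phi i) -> cintegrable (leb d) f ->
  (forall xi, fourier f xi * phi i xi = 0) -> piece_norms p phi (of_fun f) i = 0%E.
Proof.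
move=> p0 tphi fi f0; have [r r0 pr] := test_off_box tphi.
have cp : ccontinuous (phi i) by case: tphi => s _; exact: (smooth_ccontinuous [::] s).
have F0 x : freq_piece (phi i) (fourierZ (of_fun f)) x = 0.
  rewrite (freq_piece_inv_fourier _ (ltW r0) cp pr fi) -[RHS](cint0 (leb d)).
  by apply: eq_cint => xi; rewrite f0 mul0r.
rewrite /piece_norms /Lpnorm (_ : (fun x => _) = cst 0%E); last first.
  by apply/funext => x; rewrite F0 normc0.
by rewrite Lnorm0// gt_eqF.
Qed.

End upper_bound.

(** * Comparison of the upper and lower bounds *)

Theorem theorem4p4 (R : realType) (d : nat) (hd : (0 < d)%N)
    (p q : \bar R) (hp : (0 < p)%E) (hq : (0 < q)%E)
    (O : set 'rV[R]_d) (hO : open O) (hO0 : O !=set0)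
    (I : choiceType) (Q : affine_family R d I)
    (hQ : Lp_decomposition_covering O Q p)
    (phi : I -> 'rV[R]_d -> R[i]) (hphi : Lp_bapu O Q p phi)
    (Y : set (I -> R[i])) (nY : (I -> R[i]) -> R)
    (hY : regular_sequence_space Q Y nY) (hY0 : Y <> [set (fun=> 0)])
    (alpha : 'I_d -> nat)
    (hbound : exists2 c : R, 0 <= c & forall f : 'rV[R]_d -> R[i],
       SOpY O p phi Y nY f ->
       (Lpnorm q (mderiv alpha f)
          <= c%:E * decomp_norm p phi Y nY (of_fun f))%E) :
  (p <= q)%E.
Proof.
rewrite leNgt; apply/negP => qp.
case: q hq qp hbound => [q| |]//; last by case: p {hp hQ hphi} => [?||]/=; rewrite ?ltNge ?leey.
rewrite lte_fin => q0 qp [c c0 hbound].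
have [cQ [aQ _ _] _] := hQ; have [PU _ _] := hphi.
have [tphi voff _] := PU.
(* This includes [p = +oo], where [invp p] is 0. *)
have sq : invp p < q^-1.
  rewrite /invp; case: p hp qp {hQ hphi hbound} => [p| |]//= p0 qp.
    by rewrite ltf_pV2 ?posrE.
  by rewrite invr0 invr_gt0.
(* For small [p] a large decay exponent is needed to make the power [p] of the profile integrable;
   at [p = +oo] there is no constraint. *)
have [m mp] : exists m : nat, p \is a fin_num -> 1 <= m%:R * fine p.
  case: p hp {qp hQ hphi hbound sq} => [p| |]// p0; last by exists 0%N.
  have p1 : 0 <= p^-1 by rewrite invr_ge0 ltW.
  exists (Num.bound p^-1) => _ /=; rewrite -ler_pdivrMr// div1r ltW//.
  exact: archi_boundP.
have [i0 [x0 [px0 Ycl]]] := active_index cQ aQ PU hY hY0.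
have sphi i : smooth (phi i) by case: (tphi i).
have cphi i : ccontinuous (phi i) := smooth_ccontinuous [::] (sphi i).
have [a pa a0] := nonzero_coordinates (cphi i0) px0.
have [rho rho0 Ha] := ccontinuous_nonzero (cphi i0) pa.
have [ri ri0 phir] := test_off_box (tphi i0).
(* One bump, taken along a line parallel to the first axis, serves in every coordinate: all that
   matters is its compact support and that it is nonzero at 0. *)
have [r [u [r0 tu u0]]] := tower_line a (Ordinal hd) ri0 (sphi i0) phir.
have u00 : u 0%N 0 != 0 by rewrite u0.
have [A A0 HA] := packet_decay (d := d) r0 tu m.
have /choice[B HB] : forall i, exists B : R, 0 <= B /\ forall x,
    normc (inv_fourier (phi i) x) <= B * tensor (fun _ t => weight 1 0 t ^+ m.+1) x.
  move=> i; have [s s0 ps] := test_off_box (tphi i).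
  by have [b b0 hb] := inv_fourier_decay m.+1 s0 (sphi i) ps; exists b.
have fcl : finite_set (Defs.cluster Q i0).
  by have [_ [N hN]] := aQ; apply: card_le_finite (hN i0) _; exact: finite_II.
(* The decay constants of the [phi i] need not be bounded over all [i], but the cluster of [i0] is
   finite. *)
have [M M0 HM] := finite_ubound B fcl.
have [cl [delta [y0 [cl0 dl0 Hlow]]]] := packet_lower r0 tu (a := fun j => a ord0 j) alpha u00 a0.
pose K0 := 2 * (A * M * (2 ^+ m * pi) ^+ d).
have K00 : 0 <= K0.
  by rewrite !mulr_ge0// exprn_ge0// mulr_ge0 ?pi_ge0 ?exprn_ge0.
pose N := nY (clustering Q (delta_seq i0)).
have N0 : 0 <= N by case: hY => _ [n0 _ _ _] _ _ _; exact: n0.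
(* The quotient of the constants of the upper and lower bounds: the assumed inequality would say
   that [T] times the power [invp p] of [e^-1 ^+ d] is at least its power [q^-1]. *)
pose T := c * (K0 * (pi ^+ d) `^ invp p * N) / (cl * ((2 * delta) ^+ d) `^ q^-1).
have den0 : 0 < cl * ((2 * delta) ^+ d) `^ q^-1.
  by rewrite mulr_gt0// powR_gt0// exprn_gt0// mulr_gt0.
have T0 : 0 <= T.
  apply: divr_ge0; last exact: ltW.
  by do 3 apply: mulr_ge0 => //; exact: powR_ge0.
near (0 : R)^'+ => e.
have e0 : 0 < e by near: e; exact: nbhs_right_gt.
have e1 : e <= 1 by apply: ltW; near: e; exact: nbhs_right_lt.
have e01 : 0 < e <= 1 by rewrite e0.
have er : e * r <= rho.
  by rewrite -ler_pdivlMr//; apply: ltW; near: e; apply: nbhs_right_lt; rewrite divr_gt0.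
have low : forall x : 'rV[R]_d, (forall j, `|e * x ord0 j - y0| <= delta) ->
    cl <= normc (mderiv alpha (packet u (fun j => a ord0 j) e) x) by near: e.
have dom : T * ((e^-1) ^+ d) `^ invp p < ((e^-1) ^+ d) `^ q^-1.
  by near: e; exact: powR_dominates.
pose f := packet u (fun j => a ord0 j) e : 'rV[R]_d -> R[i].
have fi : cintegrable (leb d) f by exact: cintegrable_packet r0 tu _ _ e0.
have box (x : 'rV[R]_d) : (forall j, `|x ord0 j - a ord0 j| <= e * r) -> phi i0 x != 0.
  by move=> h; apply: Ha => j; exact: le_trans (h j) er.
(* The cell is not known to be open; the box lies in it because [phi i0] is nonzero on the box and
   vanishes off the cell. *)
have boxQ (x : 'rV[R]_d) : (forall j, `|x ord0 j - a ord0 j| <= e * r) -> cell Q i0 x.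
  by move=> /box h; apply: contrapT => nQ; move: h; rewrite voff// eqxx.
have tF : test O (fourier f).
  apply: (test_fourier_packet r0 tu e0) => x /= /boxQ xQ.
  by rewrite -cQ; exists i0.
have Fi : cintegrable (leb d) (fourier f).
  have [s s0 Fs] := test_off_box tF.
  exact: cintegrable_box (ltW s0) (smooth_ccontinuous [::] tF.1) Fs.
have upper : (decomp_norm p phi Y nY (of_fun f) <=
    (K0 * ((pi / e) ^+ d) `^ invp p * N)%:E)%E.
  apply: decomp_norm_le => //; first by rewrite mulr_ge0 ?powR_ge0.
  - move=> i ii0; apply: (piece_norm_le hp e01 A0 M0 mp (tphi i) fi).
      by move=> x; exact: HA.
    move=> x; rewrite (le_trans ((HB i).2 x))// ler_wpM2r//.
      apply: tensor_ge0 => j t; rewrite exprn_ge0//; exact/ltW/weight_gt0.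
    by apply: HM; exact: cluster_sym.
  (* A frequency at which both factors are nonzero would belong to the cells of [i] and of [i0],
     putting [i0] in the cluster of [i]. *)
  - move=> i ii0; apply: (piece_norm_eq0 hp (tphi i) fi) => xi.
    have [->|F0] := eqVneq (fourier f xi) 0; first by rewrite mul0r.
    have [->|p0] := eqVneq (phi i xi) 0; first by rewrite mulr0.
    exfalso; apply: ii0; exists xi; split.
      by apply: contrapT => h; move: p0; rewrite voff// eqxx.
    by apply: boxQ; exact: (fourier_packet_supp (a := fun j => a ord0 j) r0 tu e0 F0).
have SOf : SOpY O p phi Y nY f.
  split; first by split => //; exact: packet_schwartz r0 tu _ _ e01.
  by split; [exact: Zdual_of_fun|exact: le_lt_trans upper (ltry _)].
have lower := Lpnorm_box (y := fun=> y0) q0 e0 (ltW cl0) dl0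
  (cmeasurable_packet_mderiv r0 tu _ e alpha) low.
have := le_trans lower (hbound f SOf); apply/negP; rewrite -ltNge.
have step : (c%:E * decomp_norm p phi Y nY (of_fun f) <=
    (c * (K0 * ((pi / e) ^+ d) `^ invp p * N))%:E)%E.
  by rewrite EFinM; apply: lee_wpmul2l; rewrite ?lee_fin.
apply: (le_lt_trans step); rewrite lte_fin.
have ie : 0 <= (e^-1) ^+ d by rewrite exprn_ge0// invr_ge0 ltW.
have pd : 0 <= pi ^+ d :> R by rewrite exprn_ge0 ?pi_ge0.
have dd : 0 <= (2 * delta) ^+ d by rewrite exprn_ge0 ?mulr_ge0 ?(ltW dl0).
(* Both bounds are split into a constant free of [e] and a power of [e^-1 ^+ d], which reduces the
   claim to [dom]. *)
rewrite [(pi / e) ^+ d]exprMn [(2 * delta / e) ^+ d]exprMn.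
rewrite [(pi ^+ d * _) `^ _]powRM// [((2 * delta) ^+ d * _) `^ _]powRM//.
have -> : c * (K0 * ((pi ^+ d) `^ invp p * (e^-1 ^+ d) `^ invp p) * N) =
    (cl * ((2 * delta) ^+ d) `^ q^-1) * (T * (e^-1 ^+ d) `^ invp p).
  have TE : cl * ((2 * delta) ^+ d) `^ q^-1 * T = c * (K0 * (pi ^+ d) `^ invp p * N).
    by rewrite mulrC divfK// gt_eqF.
  by rewrite [RHS]mulrA TE; ring.
by rewrite [ltRHS]mulrA ltr_pM2l.
Unshelve. all: by end_near. Qed.
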